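(* Suppose that for each odd integer $N\in 2\mathbb{N}+1$ an initial datum $\mathbf{S}_{0,N}:\mathbb{S}_N\to\mathbb{S}^2$ is given, and that the trigonometric interpolations satisfy $$\sup_N \|\widetilde{\mathbf{S}}_{0,N}\|_{H^{1/2}(\mathbb{S})}<+\infty .$$ Let $\mathbf{S}_N:[0,\infty)\times\mathbb{S}_N\to\mathbb{S}^2$ be the unique global solution of $$\partial_t\mathbf{S}_N=\mathbf{S}_N\times|\nabla|_N\mathbf{S}_N,\qquad \mathbf{S}_N|_{t=0}=\mathbf{S}_{0,N},$$ and let $\widetilde{\mathbf{S}}_N(t)$ be the trigonometric interpolation of $\mathbf{S}_N(t)$. Then, for any $T>0$ and $\varepsilon>0$, there exist a subsequence (still denoted by $N\to\infty$) and a function $\mathbf{S}:[0,T]\times\mathbb{S}\to\mathbb{S}^2$ such that $$\widetilde{\mathbf{S}}_N\rightharpoonup\mathbf{S}\quad\text{weakly-}*\text{ in } L^\infty\big([0,T];H^{1/2}(\mathbb{S})\big)\cap W^{1,\infty}\big([0,T];H^{-1/2-\varepsilon}(\mathbb{S})\big)\quad\text{as }N\to\infty,$$ and $\mathbf{S}$ is a weak solution of the half-wave maps equation (HWM) on $[0,T]$ (for some initial datum $\mathbf{S}_0\in H^{1/2}(\mathbb{S};\mathbb{S}^2)$). In addition, along this subsequence, $$\|\widetilde{\mathbf{S}}_N-\mathbf{S}\|_{L^2([0,T];H^{1/2-\varepsilon}(\mathbb{S}))}\to0\quad\text{as }N\to\infty.$$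
   Context: $\mathbb{S}=\{z\in\mathbb{C}:|z|=1\}\simeq\mathbb{T}=\mathbb{R}/2\pi\mathbb{Z}$ via $x\mapsto e^{ix}$; $\mathbb{S}^2\subset\mathbb{R}^3$ is the standard unit two-sphere; $\times$ is the cross product in $\mathbb{R}^3$. $|\nabla|=\sqrt{-\Delta}$ is the Fourier multiplier $|\nabla| z^k=|k|z^k$ on $\mathbb{S}$, and $H^s(\mathbb{S})$ are the usual ($L^2$-based) Sobolev spaces; $H^s(\mathbb{S};\mathbb{S}^2)$ denotes maps in $H^s(\mathbb{S};\mathbb{R}^3)$ with values a.e. in $\mathbb{S}^2$. The half-wave maps equation is $$\text{(HWM)}\qquad \partial_t\mathbf{S}=\mathbf{S}\times|\nabla|\mathbf{S}.$$ Lattice: $N=2n+1$ odd, $\mathbb{S}_N=\{z_0,\dots,z_{N-1}\}$ with $z_k=e^{2\pi i k/N}$. For functions $f$ on $\mathbb{S}_N$ (acting componentwise on vector-valued functions), $$(|\nabla|_Nf)(z_k)=\frac{2}{N}\sum_{\ell=0,\,\ell\neq k}^{N-1}\frac{f(z_k)-f(z_\ell)}{|z_k-z_\ell|^2}=\frac{1}{2N}\sum_{\ell=0,\,\ell\ne k}^{N-1}\frac{f(z_k)-f(z_\ell)}{\sin^2(\pi(k-\ell)/N)} .$$ Trigonometric interpolation: for $f$ on $\mathbb{S}_N$, $\widetilde f(z)=\sum_{k=-n}^n c_kz^k$ with $c_k=\frac1N\sum_{j=0}^{N-1}f(z_j)\overline{z_j}^{\,k}$; it is the unique trigonometric polynomial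 of degree at most $n$ with $\widetilde f(z_k)=f(z_k)$ for all $k$. It is applied componentwise to vector-valued functions. Weak solution: let $\mathbf{S}_0\in H^{1/2}(\mathbb{S};\mathbb{S}^2)$ and $T>0$. A map $\mathbf{S}:[0,T]\times\mathbb{S}\to\mathbb{S}^2$ is a weak solution of (HWM) with initial datum $\mathbf{S}_0$ if: (i) $\mathbf{S}\in L^\infty([0,T];H^{1/2}(\mathbb{S}))$ and $\partial_t\mathbf{S}\in L^\infty([0,T];H^{-1/2}(\mathbb{S}))$; (ii) for every $\boldsymbol\phi\in H^{1/2}(\mathbb{S};\mathbb{R}^3)$, $\langle\boldsymbol\phi,\partial_t\mathbf{S}(t)\rangle=\langle|\nabla|^{1/2}\mathbf{S}(t),|\nabla|^{1/2}(\boldsymbol\phi\times\mathbf{S}(t))\rangle$ for a.e. $t\in[0,T]$, where for $\boldsymbol\phi$ that is not regular enough for the right-hand side to be read literally it is understood as the continuous extension in $\boldsymbol\phi\in H^{1/2}$ from smooth $\boldsymbol\phi$; (iii) $\mathbf{S}(0,x)=\mathbf{S}_0(x)$ for a.e. $x\in\mathbb{S}$ (condition (i) implies $\mathbf{S}\in C^{1/2}([0,T];L^2(\mathbb{S}))$, so this makes sense). *)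

(* Defs.v *)
From HB Require Import structures.
From mathcomp Require Import all_boot all_order all_algebra.
From mathcomp Require Import complex.
From mathcomp Require Import all_classical all_reals all_analysis.

Set Implicit Arguments.
Unset Strict Implicit.
Unset Printing Implicit Defensive.
Import Order.TTheory GRing.Theory Num.Theory.
Import numFieldNormedType.Exports.
Import ComplexField.

Local Open Scope classical_set_scope.
Local Open Scope complex_scope.
Local Open Scope ring_scope.

(* Conventions.  The circle is R / 2 pi Z: a function on the circle is a       *)
(* 2 pi-periodic function of x : R, the point being e^{ix}.  A distribution    *)
(* on the circle with values in C^3 is identified with the family of its       *)
(* Fourier coefficients, of type [coefs R].                                    *)

Section HWM.
Variable R : realType.
Local Notation mu := (@lebesgue_measure R).
Local Notation vec3 := 'rV[R]_3.
Local Notation cvec3 := 'rV[R[i]]_3.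

Definition coefs := int -> cvec3.

Definition cross (u v : vec3) : vec3 :=
  \row_(i < 3) (u 0 (i + 1) * v 0 (i + 2%:R) - u 0 (i + 2%:R) * v 0 (i + 1)).

Definition sphere2 (v : vec3) : Prop := \sum_(i < 3) v 0 i ^+ 2 = 1.

Definition expi (x : R) : R[i] := cos x +i* sin x.

Definition symsum (V : nmodType) (n : nat) (F : int -> V) : V :=
  \sum_(j < n.*2.+1) F (j%:Z - n%:Z).

(* The lattice with N = 2n+1 points; the index k : 'I_N stands for z_k.        *)

Definition node (n : nat) (k : 'I_n.*2.+1) : R[i] :=
  expi (2 * pi * k%:R / n.*2.+1%:R).

Definition lattice_nabla (n : nat) (f : 'I_n.*2.+1 -> vec3) (k : 'I_n.*2.+1) :
    vec3 :=
  (2 / n.*2.+1%:R) *: \sum_(l < n.*2.+1 | l != k)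
     (Normc.normc (node k - node l) ^+ 2)^-1 *: (f k - f l).

Definition dft (n : nat) (f : 'I_n.*2.+1 -> vec3) (k : int) : cvec3 :=
  (n.*2.+1%:R)^-1 *:
    \sum_(j < n.*2.+1) (node j)^* ^ k *: map_mx (real_complex R) (f j).

(* The interpolation polynomial of real data is real-valued, so that taking    *)
(* real parts only changes the codomain.                                       *)
Definition interp (n : nat) (f : 'I_n.*2.+1 -> vec3) (x : R) : vec3 :=
  map_mx (@complex.Re R) (symsum n (fun k => expi x ^ k *: dft f k)).

(* The derivative is taken within [0, +oo[, hence one-sided at t = 0.          *)
Definition has_derivative_on_halfline (u u' : R -> vec3) : Prop :=
  forall t, 0 <= t ->
    h^-1 *: (u (t + h) - u t) @[h --> within [set h | 0 <= t + h] 0^'] --> u' t.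

Definition lattice_solution (n : nat) (S0 : 'I_n.*2.+1 -> vec3)
    (S : R -> 'I_n.*2.+1 -> vec3) : Prop :=
  [/\ forall t k, 0 <= t -> sphere2 (S t k),
      forall k, has_derivative_on_halfline (fun t => S t k)
                  (fun t => cross (S t k) (lattice_nabla (S t) k)) &
      forall k, S 0 k = S0 k].

Definition cintegral (D : set R) (f : R -> R[i]) : R[i] :=
  (\int[mu]_(x in D) complex.Re (f x)) +i* (\int[mu]_(x in D) complex.Im (f x)).

Definition circle : set R := `[0, 2 * pi].

Definition fourier (u : R -> vec3) : coefs := fun k =>
  \row_(i < 3) (((2 * pi)^-1)%:C *
    cintegral circle (fun x => (u x 0 i)%:C * expi x ^ (- k))).

Definition cnormsq (v : cvec3) : R := \sum_(i < 3) Normc.normc (v 0 i) ^+ 2.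

Definition sobolev_norm (s : R) (a : coefs) : \bar R :=
  sqrte (\esum_(k in [set: int])
           ((1 + k%:~R ^+ 2) `^ s * cnormsq (a k))%:E).

(* Coefficients of an R^3-valued distribution.                                 *)
Definition real_coefs (a : coefs) : Prop :=
  forall k i, a (- k) 0 i = (a k 0 i)^*.

Definition periodic_vec (u : R -> vec3) : Prop := periodic u (2 * pi).

(* H^s(S; R^3) for s >= 0, as a space of functions.                            *)
Definition sobolev_fun (s : R) (u : R -> vec3) : Prop :=
  [/\ periodic_vec u,
      forall i, measurable_fun circle (fun x => u x 0 i),
      forall i, mu.-integrable circle (fun x => (u x 0 i ^+ 2)%:E) &
      (sobolev_norm s (fourier u) < +oo)%E].

Definition smooth (f : R -> R) : Prop :=
  forall m t, derivable (derive1n m f) t 1.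

Definition smooth_circle (u : R -> vec3) : Prop :=
  periodic_vec u /\ forall i, smooth (fun x => u x 0 i).

Definition nabla_pow (s : R) (a : coefs) : coefs :=
  fun k => (`|k%:~R : R| `^ s)%:C *: a k.

(* Real duality pairing, normalised by dx / 2 pi.  When a and b are            *)
(* coefficients of real distributions the imaginary parts of the terms of      *)
(* indices k and -k cancel.                                                    *)
Definition pairing (a b : coefs) : R :=
  lim ((fun n => symsum n (fun k =>
          complex.Re (\sum_(i < 3) a k 0 i * (b k 0 i)^*))) @ \oo).

Definition itime (T : R) : set R := `[0, T].

Definition on_interval (T : R) (P : R -> Prop) : Prop :=
  {ae mu, forall t, itime T t -> P t}.

(* H^s being separable, a map into it is strongly measurable iff all its       *)
(* Fourier coefficients are measurable.                                        *)
Definition measurable_coefs (T : R) (c : R -> coefs) : Prop :=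
  forall k i, measurable_fun (itime T) (fun t => complex.Re (c t k 0 i)) /\
              measurable_fun (itime T) (fun t => complex.Im (c t k 0 i)).

Definition Linfty_sobolev (s T : R) (c : R -> coefs) : Prop :=
  [/\ measurable_coefs T c, on_interval T (fun t => real_coefs (c t)) &
      exists M : R, on_interval T (fun t => (sobolev_norm s (c t) <= M%:E)%E)].

Definition L1_sobolev (s T : R) (c : R -> coefs) : Prop :=
  [/\ measurable_coefs T c, on_interval T (fun t => real_coefs (c t)) &
      (\int[mu]_(t in itime T) sobolev_norm s (c t) < +oo)%E].

Definition L2_sobolev_norm (s T : R) (c : R -> coefs) : \bar R :=
  sqrte (\int[mu]_(t in itime T) (sobolev_norm s (c t) ^+ 2))%E.

Definition test_function (T : R) (eta : R -> R) : Prop :=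
  smooth eta /\
  exists a b, [/\ 0 < a, b < T & forall t, eta t != 0 -> a <= t <= b].

Definition time_derivative (T : R) (c g : R -> coefs) : Prop :=
  forall eta, test_function T eta -> forall k i,
    cintegral (itime T) (fun t => (derive1 eta t)%:C * c t k 0 i) =
    - cintegral (itime T) (fun t => (eta t)%:C * g t k 0 i).

(* Weak-* convergence of L^oo(0,T; H^s), the dual of L^1(0,T; H^{-s}).         *)
Definition weakstar_Linfty (s T : R) (c_ : nat -> R -> coefs) (c : R -> coefs) :
    Prop :=
  [/\ forall j, Linfty_sobolev s T (c_ j), Linfty_sobolev s T c &
      forall psi, L1_sobolev (- s) T psi ->
        (\int[mu]_(t in itime T) pairing (c_ j t) (psi t)) @[j --> \oo] -->
        \int[mu]_(t in itime T) pairing (c t) (psi t)].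

Definition weakstar_W1infty (s T : R) (c_ : nat -> R -> coefs) (c : R -> coefs) :
    Prop :=
  exists g_ g,
    [/\ forall j, time_derivative T (c_ j) (g_ j), time_derivative T c g,
        weakstar_Linfty s T c_ c & weakstar_Linfty s T g_ g].

Definition half_wave_form (S phi : R -> vec3) : R :=
  pairing (nabla_pow 2^-1 (fourier S))
          (nabla_pow 2^-1 (fourier (fun x => cross (phi x) (S x)))).

(* v is the value at phi of the form above: the literal one when phi x S is    *)
(* in H^{1/2}, and otherwise the limit along smooth psi -> phi in H^{1/2}.     *)
Definition half_wave_value (S phi : R -> vec3) (v : R) : Prop :=
  (sobolev_fun 2^-1 (fun x => cross (phi x) (S x)) ->
     v = half_wave_form S phi) /\
  (~ sobolev_fun 2^-1 (fun x => cross (phi x) (S x)) ->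
     forall e : R, 0 < e -> exists2 d : R, 0 < d &
       forall psi, smooth_circle psi ->
         (sobolev_norm 2^-1 (fourier (fun x => psi x - phi x)%R) < d%:E)%E ->
         `|half_wave_form S psi - v| < e).

Definition L2_continuous (T : R) (S : R -> R -> vec3) : Prop :=
  forall t, itime T t ->
    (\int[mu]_(x in circle) (\sum_(i < 3) (S r x 0 i - S t x 0 i) ^+ 2)%R%:E)%E
      @[r --> within (itime T) (nbhs t)] --> 0%E.

Definition Linfty_sobolev_fun (s T : R) (S : R -> R -> vec3) : Prop :=
  [/\ forall i, measurable_fun (itime T `*` [set: R])
        (fun p : R * R => S p.1 p.2 0 i),
      on_interval T (fun t => sobolev_fun s (S t)) &
      Linfty_sobolev s T (fun t => fourier (S t))].

(* S is required to be its own L^2-continuous-in-time representative, which    *)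
(* is what makes the initial condition meaningful.                             *)
Definition HWM_weak_solution (T : R) (S0 : R -> vec3) (S : R -> R -> vec3) :
    Prop :=
  [/\ forall t, itime T t ->
        periodic_vec (S t) /\ forall x, sphere2 (S t x),
      Linfty_sobolev_fun 2^-1 T S,
      exists g, [/\ Linfty_sobolev (- 2^-1) T g,
        time_derivative T (fun t => fourier (S t)) g &
        forall phi, sobolev_fun 2^-1 phi ->
          on_interval T (fun t =>
            half_wave_value (S t) phi (pairing (fourier phi) (g t)))],
      L2_continuous T S &
      {ae mu, forall x, S 0 x = S0 x}].

Definition sobolev_sphere (s : R) (u : R -> vec3) : Prop :=
  sobolev_fun s u /\ {ae mu, forall x, sphere2 (u x)}.

End HWM.

(* Main.v *)
(* Trigonometric interpolation turns the lattice operator into a Fourier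
   multiplier comparable with |k| on the frequencies |k| <= n, and the discrete
   energy, which bounds the H^{1/2} norm, is conserved.  The k-th coefficient of
   S_N x |nabla|_N S_N is half the sum of (lam_l - lam_{k-l}) c_{k-l} x c_l, where
   |lam_l - lam_{k-l}| <= |k| and the |c_l|^2 have sum 1.  The coefficients are thus
   Lipschitz in time uniformly in N, and a subsequence converges coefficientwise,
   uniformly on [0, T].
   The limit takes values in the sphere because on a cell of the lattice the
   squared distance of the interpolation to its value at the node is O(1/N) in mean.
   On the sphere |S x S'| <= |S - S'|, so that S x L S is bounded in H^{-1/2} by the
   energy for every L with a nonnegative kernel and a symbol at most that of
   |nabla|_N.  By the maximum principle this applies to the Yosida approximations
   B L / (B + L) of |nabla|_N, which have bounded symbols: the weak form is first
   established for them, then B tends to infinity. *)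

From HB Require Import structures.
Require Import Defs.
From mathcomp Require Import all_boot all_order all_algebra.
From mathcomp Require Import complex ring lra zify.
From mathcomp Require Import all_classical all_reals all_analysis measurable_realfun.
Set Implicit Arguments.
Unset Strict Implicit.
Unset Printing Implicit Defensive.
Import Order.TTheory GRing.Theory Num.Theory.
Import numFieldNormedType.Exports.
Import ComplexField.

Local Open Scope classical_set_scope.
Local Open Scope complex_scope.
Local Open Scope ring_scope.

Local Notation Re := (@complex.Re _).
Local Notation Im := (@complex.Im _).

(** * Cross products and the finite Fourier transform *)

(** The m-th coefficient of the torque has two expansions. The antisymmetrised one has symbol at
    most |m| / 2, so its tails are small uniformly in N and each coefficient converges. The plain
    one, with the symbol on one factor, is the one that the triple product moves onto phi x S; but
    an H^{1/2} bound does not make its tails uniformly small, as energy may escape to high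
    frequencies, and truncations of phi give products with S that are bounded in L^2 only. With a
    bounded symbol both difficulties vanish: both expansions of the same lattice quantity converge,
    so their limits agree, and L^2 bounds suffice to move the symbol. Cutting the symbol off sharply
    would lose the nonnegative kernel and with it the bound in H^{-1/2}. As B grows the
    antisymmetrised form keeps the bound |m| / 2, because x -> B x / (B + x) is 1-Lipschitz. H^{1/2}
    is not an algebra on the circle: phi x S may leave it, and the H^{-1/2} bound on the torque is
    what extends the weak form from smooth phi. Coefficients converge at every time, so the weak
    form holds at every time of [0, T]. *)

Lemma conjCE (R : rcfType) (z : R[i]) : z^* = conjc z.
Proof. by []. Qed.

Lemma conj_realC (R : rcfType) (x : R) : (x%:C)^* = x%:C.
Proof. by rewrite conjCE conjc_real. Qed.

Lemma cRe_conj (R : rcfType) (z : R[i]) : Re z^* = Re z.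
Proof. by case: z. Qed.

Lemma cIm_conj (R : rcfType) (z : R[i]) : Im z^* = - Im z.
Proof. by case: z. Qed.

Section Vec3.
Variable A : comNzRingType.
Implicit Types u v w : 'rV[A]_3.

Definition dotp u v : A := \sum_(i < 3) u 0 i * v 0 i.

(** The formula of [cross] over any commutative ring, so that the same identities serve real vectors
    and complex Fourier coefficients. Correspondingly [dotp] is bilinear, without conjugation:
    Hermitian pairings are written with [map_mx Num.conj]. *)
Definition crossp u v : 'rV[A]_3 :=
  \row_(i < 3) (u 0 (i + 1) * v 0 (i + 2%:R) - u 0 (i + 2%:R) * v 0 (i + 1)).

Lemma sum3E (V : nmodType) (F : 'I_3 -> V) :
  \sum_(i < 3) F i = F 0 + F 1 + F 2%:R.
Proof.
rewrite !big_ord_recl big_ord0 addr0 addrA.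
by congr (F _ + F _ + F _); apply/val_inj.
Qed.

Let i11 : (1 : 'I_3) + 1 = 2%:R. Proof. exact/val_inj. Qed.
Let i12 : (1 : 'I_3) + 2%:R = 0. Proof. exact/val_inj. Qed.
Let i21 : (2%:R : 'I_3) + 1 = 0. Proof. exact/val_inj. Qed.
Let i22 : (2%:R : 'I_3) + 2%:R = 1. Proof. exact/val_inj. Qed.

Lemma crosspE u v :
  [/\ crossp u v 0 0 = u 0 1 * v 0 2%:R - u 0 2%:R * v 0 1,
      crossp u v 0 1 = u 0 2%:R * v 0 0 - u 0 0 * v 0 2%:R &
      crossp u v 0 2%:R = u 0 0 * v 0 1 - u 0 1 * v 0 0].
Proof. by split; rewrite mxE ?add0r ?i11 ?i12 ?i21 ?i22. Qed.

Lemma dotpC u v : dotp u v = dotp v u.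
Proof. by apply: eq_bigr => i _; rewrite mulrC. Qed.

Lemma dotp_triple u v w : dotp u (crossp v w) = dotp v (crossp w u).
Proof.
rewrite /dotp !sum3E; case: (crosspE v w) => -> -> ->.
by case: (crosspE w u) => -> -> ->; ring.
Qed.

Lemma dotp_cross_self u v : dotp (crossp u v) v = 0.
Proof.
by rewrite /dotp sum3E; case: (crosspE u v) => -> -> ->; ring.
Qed.

Lemma crosspC u v : crossp u v = - crossp v u.
Proof. by apply/rowP => i; rewrite !mxE; ring. Qed.

Lemma crossp_sub_self u v : crossp u (u - v) = - crossp u v.
Proof. by apply/rowP => i; rewrite !mxE; ring. Qed.

Lemma dotpZl a u v : dotp (a *: u) v = a * dotp u v.
Proof. by rewrite /dotp mulr_sumr; apply: eq_bigr => i _; rewrite mxE mulrA. Qed.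
Lemma dotpZr a u v : dotp u (a *: v) = a * dotp u v.
Proof. by rewrite dotpC dotpZl dotpC. Qed.
Lemma dotpDl u v w : dotp (u + v) w = dotp u w + dotp v w.
Proof. by rewrite /dotp -big_split; apply: eq_bigr => i _; rewrite mxE mulrDl. Qed.
Lemma dotpDr u v w : dotp w (u + v) = dotp w u + dotp w v.
Proof. by rewrite dotpC dotpDl !(dotpC w). Qed.
Lemma dotpNr u v : dotp u (- v) = - dotp u v.
Proof. by rewrite -scaleN1r dotpZr mulN1r. Qed.
Lemma dotpNl u v : dotp (- u) v = - dotp u v.
Proof. by rewrite dotpC dotpNr dotpC. Qed.
Lemma dotpBl u v w : dotp (u - v) w = dotp u w - dotp v w.
Proof. by rewrite dotpDl dotpNl. Qed.
Lemma dotpBr u v w : dotp w (u - v) = dotp w u - dotp w v.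
Proof. by rewrite dotpDr dotpNr. Qed.
Lemma dotp_sumr I (r : seq I) (F : I -> 'rV[A]_3) u :
  dotp u (\sum_(i <- r) F i) = \sum_(i <- r) dotp u (F i).
Proof.
elim: r => [|a r IH]; last by rewrite !big_cons dotpDr IH.
by rewrite !big_nil /dotp big1 // => i _; rewrite mxE mulr0.
Qed.
Lemma crossp_sumr I (r : seq I) (F : I -> 'rV[A]_3) u :
  crossp u (\sum_(i <- r) F i) = \sum_(i <- r) crossp u (F i).
Proof.
apply/rowP => i; rewrite summxE !mxE !summxE !mulr_sumr -sumrB.
by apply: eq_bigr => k _; rewrite mxE.
Qed.
Lemma crosspZr a u v : crossp u (a *: v) = a *: crossp u v.
Proof. by apply/rowP => i; rewrite !mxE; ring. Qed.
End Vec3.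

Section RealVec3.
Variable R : realType.
Implicit Types u v w : 'rV[R]_3.

Lemma sphere2_dotp u : sphere2 u -> dotp u u = 1.
Proof. by move=> <-; apply: eq_bigr => i _; rewrite expr2. Qed.

Lemma dotp_ge0 u : 0 <= dotp u u.
Proof. by apply: sumr_ge0 => i _; rewrite -expr2 sqr_ge0. Qed.

Lemma dotp_amgm u v : 2 * `|dotp u v| <= dotp u u + dotp v v.
Proof.
have := dotp_ge0 (u + v); have := dotp_ge0 (u - v).
rewrite !(dotpBl, dotpDl, dotpBr, dotpDr, dotpNl, dotpNr) (dotpC v u) => h1 h2.
by case: (lerP 0 (dotp u v)) => h; rewrite ?(ger0_norm h) ?(ltr0_norm h); lra.
Qed.

(* On the sphere S x S' = S x (S' - S), so that |S x S'| <= |S - S'|. *)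
Lemma triple_sphere_le (p p' s s' : 'rV[R]_3) : sphere2 s ->
  2 * `|dotp (p - p') (crossp s s')| <= dotp (p - p') (p - p') + dotp (s - s') (s - s').
Proof.
move=> /sphere2_dotp hs; apply: (le_trans (dotp_amgm _ _)); rewrite lerD2l.
have -> : crossp s s' = - crossp s (s - s') by rewrite crossp_sub_self opprK.
rewrite dotpNl dotpNr opprK; move: (s - s') => d.
suff : dotp (crossp s d) (crossp s d) + dotp s d ^+ 2 = dotp s s * dotp d d.
  by rewrite hs mul1r => <-; rewrite lerDl sqr_ge0.
rewrite /dotp !sum3E; case: (crosspE s d) => -> -> ->; ring.
Qed.

End RealVec3.

Section FiniteFourier.
Variables (R : realType) (G : finZmodType) (chi : G -> G -> R[i]).
Local Notation C := R[i].
Local Notation N := (#|G|%:R : _).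
Hypothesis chi0 : forall k, chi 0 k = 1.
Hypothesis chiD : forall a b k, chi (a + b) k = chi a k * chi b k.
Hypothesis chiC : forall a b, chi a b = chi b a.
Hypothesis chiJ : forall a k, (chi a k)^* = chi (- a) k.
Hypothesis chi_sum : forall k, \sum_j chi j k = N *+ (k == 0).

(** [chi] is a symmetric nondegenerate pairing of G with itself, so that G indexes both points and
    frequencies. The factor 1 / |G| makes Parseval an average over points and a sum over
    frequencies. *)
Definition hat (f : G -> R) (k : G) : C :=
  N^-1 * \sum_j (chi j k)^* * (f j)%:C.

Let N0 : N != 0 :> C.
Proof. by rewrite pnatr_eq0 -lt0n; apply/card_gt0P; exists 0. Qed.

Let N0R : N != 0 :> R.
Proof. by rewrite pnatr_eq0 -lt0n; apply/card_gt0P; exists 0. Qed.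

Let N_gt0 : 0 < N :> R.
Proof. by rewrite lt_neqAle eq_sym N0R ler0n. Qed.

Let chiN a k : chi a k * chi (- a) k = 1.
Proof. by rewrite -chiD subrr chi0. Qed.

Let chiNC a k : chi (- a) k = chi a (- k).
Proof.
have e : chi a k * chi a (- k) = 1 by rewrite !(chiC a) chiN.
have h : chi a k != 0.
  by apply/negP => /eqP h0; move/eqP: e; rewrite h0 mul0r eq_sym oner_eq0.
by apply: (mulfI h); rewrite e chiN.
Qed.

Let chiDr a k m : chi a (k + m) = chi a k * chi a m.
Proof. by rewrite !(chiC a) chiD. Qed.

Lemma hat_inv f j : (f j)%:C = \sum_k chi j k * hat f k.
Proof.
under eq_bigr => k _ do rewrite /hat mulrCA mulr_sumr.
rewrite -mulr_sumr exchange_big /=.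
rewrite (eq_bigr (fun l => (f l)%:C * \sum_k chi k (j - l))).
  rewrite (bigD1 j) //= subrr chi_sum eqxx mulr1n big1 ?addr0; last first.
    move=> l hl; rewrite chi_sum.
    by rewrite subr_eq0 eq_sym (negPf hl) mulr0n mulr0.
  by rewrite mulrC mulfK.
move=> l _; rewrite mulr_sumr; apply: eq_bigr => k _.
rewrite mulrA mulrC; congr (_ * _).
by rewrite chiJ (chiC k) chiD.
Qed.

Lemma hat_conj f k : (hat f k)^* = hat f (- k).
Proof.
rewrite /hat rmorphM rmorph_sum fmorphV rmorph_nat; congr (_ * _).
by apply: eq_bigr => j _; rewrite rmorphM /= conjCK conj_realC chiJ -chiNC opprK.
Qed.

Lemma hat_mul f g m :
  hat (fun j => f j * g j) m = \sum_k hat f (m - k) * hat g k.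
Proof.
rewrite /hat.
under eq_bigr => j _ do rewrite rmorphM /= (hat_inv g j) mulr_sumr mulr_sumr.
rewrite exchange_big mulr_sumr; apply: eq_bigr => k _ /=.
rewrite -/(hat g k); set h := hat g k.
rewrite -mulrA mulr_suml; congr (_ * _).
apply: eq_bigr => j _; rewrite ?mulrA.
by rewrite !chiJ chiDr -chiNC opprK; ring.
Qed.

Lemma hat_parseval f g :
  (N^-1 * \sum_j f j * g j)%:C = \sum_k hat f k * (hat g k)^*.
Proof.
have := hat_mul f g 0; rewrite /hat.
under eq_bigr => j _ do rewrite chiC chi0 conjC1 mul1r.
rewrite -(rmorph_sum (real_complex R)) => e.
rewrite rmorphM fmorphV rmorph_nat e (reindex_inj oppr_inj) /=.
by apply: eq_bigr => k _; rewrite -/(hat _ _) -/(hat _ _) sub0r opprK hat_conj.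
Qed.

Section Kernel.
Variable kap : G -> R.
Hypothesis kap_even : forall r, kap (- r) = kap r.

(** Eigenvalue of [lap] on the character k. The sine parts cancel between r and - r because the
    kernel is even ([symbE]), which is why only the real part of the character is kept. *)
Definition symb (k : G) : R := \sum_r kap r * (1 - Re (chi r k)).
Definition lap (f : G -> R) (j : G) : R := \sum_r kap r * (f j - f (j + r)).

Let Re_chiN r k : Re (chi (- r) k) = Re (chi r k).
Proof. by rewrite -chiJ cRe_conj. Qed.

Lemma symb_even k : symb (- k) = symb k.
Proof. by apply: eq_bigr => r _; rewrite -chiNC Re_chiN. Qed.

Lemma symbE k : (symb k)%:C = \sum_r (kap r)%:C * (1 - chi r k).
Proof.
have -> : \sum_r (kap r)%:C * (1 - chi r k) =
    2^-1 * (\sum_r (kap r)%:C * (1 - chi r k) + \sum_r (kap r)%:C * (1 - chi r k)).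
  by field.
rewrite {2}(reindex_inj oppr_inj) /= -big_split mulr_sumr rmorph_sum.
apply: eq_bigr => r _ /=; rewrite kap_even -mulrDr mulrCA rmorphM; congr (_ * _).
rewrite -chiJ; case: (chi r k) => a b.
have -> : 1 - (a +i* b) + (1 - (a +i* b)^* ) = 2 * (1 - a)%:C.
  by rewrite conjCE; apply/eqP; rewrite eq_complex /=; apply/andP; split; apply/eqP; ring.
by rewrite mulKf // pnatr_eq0.
Qed.

Lemma hat_lap f k : hat (lap f) k = (symb k)%:C * hat f k.
Proof.
rewrite symbE /hat mulr_suml.
under eq_bigr => j _ do rewrite rmorph_sum mulr_sumr.
rewrite exchange_big mulr_sumr; apply: eq_bigr => r _ /=.
have sh : \sum_j (chi j k)^* * (f (j + r))%:C = chi r k * \sum_j (chi j k)^* * (f j)%:C.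
  rewrite [in RHS](reindex_inj (addIr r)) mulr_sumr; apply: eq_bigr => j _.
  by rewrite mulrA chiD rmorphM /= mulrCA (chiJ r) chiN mulr1.
have -> : \sum_j (chi j k)^* * (kap r * (f j - f (j + r)))%:C =
   (kap r)%:C * (\sum_j (chi j k)^* * (f j)%:C - \sum_j (chi j k)^* * (f (j + r))%:C).
  rewrite -sumrB mulr_sumr; apply: eq_bigr => j _.
  by rewrite rmorphM rmorphB /=; ring.
by rewrite sh; ring.
Qed.

(** Summation by parts: substituting j + r for j and - r for r replaces f j by - f (j + r) in the
    double sum, as the kernel is even; the average of the two forms is the Dirichlet form. *)
Lemma lap_dirichlet f g : \sum_j f j * lap g j =
  2^-1 * \sum_j \sum_r kap r * ((f j - f (j + r)) * (g j - g (j + r))).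
Proof.
have e : \sum_j f j * lap g j = \sum_j \sum_r kap r * (f j * (g j - g (j + r))).
  apply: eq_bigr => j _; rewrite mulr_sumr; apply: eq_bigr => r _; ring.
have e2 : \sum_j f j * lap g j = - \sum_j \sum_r kap r * (f (j + r) * (g j - g (j + r))).
  rewrite e exchange_big /= (reindex_inj oppr_inj) /= [in RHS]exchange_big -sumrN /=.
  apply: eq_bigr => r _; rewrite (reindex_inj (addIr r)) -sumrN /=.
  by apply: eq_bigr => j _; rewrite kap_even addrK; ring.
have : 2 * \sum_j f j * lap g j = \sum_j \sum_r kap r * ((f j - f (j + r)) * (g j - g
  (j + r))).
  rewrite mulr_natl mulr2n {1}e e2 -sumrB; apply: eq_bigr => j _; rewrite -sumrB.
  by apply: eq_bigr => r _; ring.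
by move=> <-; rewrite mulKf // pnatr_eq0.
Qed.

Lemma lap_sym f g : \sum_j f j * lap g j = \sum_j g j * lap f j.
Proof.
rewrite !lap_dirichlet; congr (_ * _); apply: eq_bigr => j _.
by apply: eq_bigr => r _; congr (_ * _); rewrite mulrC.
Qed.

Lemma symb_energy f : N^-1 * \sum_j f j * lap f j =
  \sum_k symb k * Re (hat f k * (hat f k)^*).
Proof.
apply: complexI; rewrite hat_parseval rmorph_sum; apply: eq_bigr => k _.
rewrite hat_lap; case: (hat f k) => a b; rewrite !conjCE.
by apply/eqP; rewrite eq_complex /=; apply/andP; split; apply/eqP; ring.
Qed.

Definition vhat (f : G -> 'rV[R]_3) (k : G) : 'rV[C]_3 :=
  \row_i hat (fun j => f j 0 i) k.
Definition vlap (f : G -> 'rV[R]_3) (j : G) : 'rV[R]_3 :=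
  \sum_r kap r *: (f j - f (j + r)).
Definition nrm2 (v : 'rV[C]_3) : R := \sum_i (Re (v 0 i) ^+ 2 + Im (v 0 i) ^+ 2).

Lemma vlapE f j i : vlap f j 0 i = lap (fun j => f j 0 i) j.
Proof. by rewrite summxE; apply: eq_bigr => r _; rewrite !mxE. Qed.

Lemma vlap_sym f g : \sum_j dotp (f j) (vlap g j) = \sum_j dotp (g j) (vlap f j).
Proof.
rewrite /dotp exchange_big [RHS]exchange_big /=; apply: eq_bigr => i _.
under eq_bigr do rewrite vlapE.
by under [RHS]eq_bigr do rewrite vlapE; rewrite lap_sym.
Qed.

Lemma vsymb_energy f :
  N^-1 * \sum_j dotp (f j) (vlap f j) = \sum_k symb k * nrm2 (vhat f k).
Proof.
rewrite /dotp exchange_big mulr_sumr /=.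
under [RHS]eq_bigr do rewrite mulr_sumr.
rewrite [RHS]exchange_big; apply: eq_bigr => i _ /=.
under eq_bigr do rewrite vlapE.
rewrite symb_energy; apply: eq_bigr => k _; congr (_ * _); rewrite mxE.
by case: (hat _ k) => a b /=; ring.
Qed.

Lemma vdirichlet f : \sum_j dotp (f j) (vlap f j) =
  2^-1 * \sum_j \sum_r kap r * dotp (f j - f (j + r)) (f j - f (j + r)).
Proof.
rewrite /dotp exchange_big /=.
under eq_bigr => i _.
  under eq_bigr do rewrite vlapE.
  rewrite lap_dirichlet; over.
rewrite -mulr_sumr exchange_big; congr (_ * _); apply: eq_bigr => j _.
rewrite exchange_big; apply: eq_bigr => r _ /=.
by rewrite mulr_sumr; apply: eq_bigr => i _; rewrite !mxE.
Qed.

Hypothesis kap_ge0 : forall r, 0 <= kap r.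

(* Exchanging j and j + r turns the pairing into a double difference of f,
   where [triple_sphere_le] applies. *)
Lemma torque_le (f s : G -> 'rV[R]_3) : (forall j, sphere2 (s j)) ->
  2 * `|N^-1 * \sum_j dotp (f j) (crossp (s j) (vlap s j))| <=
  \sum_k symb k * nrm2 (vhat f k) + \sum_k symb k * nrm2 (vhat s k).
Proof.
move=> hs.
have e1 : \sum_j dotp (f j) (crossp (s j) (vlap s j)) =
   - \sum_j \sum_r kap r * dotp (f j) (crossp (s j) (s (j + r))).
  rewrite -sumrN; apply: eq_bigr => j _; rewrite crossp_sumr dotp_sumr -sumrN.
  by apply: eq_bigr => r _; rewrite crosspZr dotpZr crossp_sub_self dotpNr mulrN.
have e2 : \sum_j \sum_r kap r * dotp (f j) (crossp (s j) (s (j + r))) =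
   - \sum_j \sum_r kap r * dotp (f (j + r)) (crossp (s j) (s (j + r))).
  rewrite exchange_big /= (reindex_inj oppr_inj) /= [in RHS]exchange_big -sumrN /=.
  apply: eq_bigr => r _; rewrite (reindex_inj (addIr r)) -sumrN /=.
  by apply: eq_bigr => j _; rewrite kap_even addrK crosspC dotpNr mulrN.
have e3 : 2 * \sum_j dotp (f j) (crossp (s j) (vlap s j)) =
   - \sum_j \sum_r kap r * dotp (f j - f (j + r)) (crossp (s j) (s (j + r))).
  rewrite e1 mulr_natl mulr2n {1}e2 opprK -sumrB -sumrN; apply: eq_bigr => j _.
  rewrite -sumrB -sumrN; apply: eq_bigr => r _; rewrite dotpBl; ring.
rewrite normrM (ger0_norm (ltW _)) ?invr_gt0 // mulrCA -!vsymb_energy -mulrDr.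
rewrite ler_pM2l ?invr_gt0 // !vdirichlet -mulrDr -big_split /=.
rewrite -[X in X * `|_| <= _](@ger0_norm _ 2) // -normrM e3 normrN.
apply: (le_trans (ler_norm_sum _ _ _)); rewrite mulr_sumr; apply: ler_sum => j _.
apply: (le_trans (ler_norm_sum _ _ _)); rewrite -big_split mulr_sumr; apply: ler_sum =>
  r _.
rewrite /= normrM (ger0_norm (kap_ge0 _)) -mulrDr mulrCA ler_wpM2l //.
by rewrite ler_pdivlMl //; exact: triple_sphere_le.
Qed.

Lemma symb_ge0 k : 0 <= symb k.
Proof.
apply: sumr_ge0 => r _; apply: mulr_ge0 => //; rewrite subr_ge0.
have : Re (chi r k) ^+ 2 + Im (chi r k) ^+ 2 = 1.
  have := chiN r k; rewrite -chiJ; case: (chi r k) => a b.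
  by rewrite conjCE /= => /eqP; rewrite eq_complex /= => /andP[/eqP <- _]; ring.
by move: (sqr_ge0 (Im (chi r k))) => h1 h2; nra.
Qed.

(* Nonnegativity of the kernel of the resolvent is the maximum principle. *)
Lemma yosida_kernel (B : R) : 0 < B -> exists ker : G -> R,
  [/\ forall r, ker (- r) = ker r, forall r, 0 <= ker r &
      forall k, \sum_r ker r * (1 - Re (chi r k)) = B * symb k / (B + symb k)].
Proof.
move=> B0.
have den k : B + symb k != 0 by rewrite gt_eqF // ltr_wpDr // symb_ge0.
(* The Green function of B + [lap], defined by inverting its symbol. It is real and even because
   [symb] is even. *)
pose uC j : C := N^-1 * \sum_k chi j k * ((B + symb k)^-1)%:C.
have uN j : uC (- j) = uC j.
  rewrite /uC (reindex_inj oppr_inj); congr (_ * _).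
  by apply: eq_bigr => k _; rewrite symb_even chiNC opprK.
have uJ j : (uC j)^* = uC j.
  rewrite -{2}uN /uC rmorphM fmorphV rmorph_nat rmorph_sum; congr (_ * _).
  by apply: eq_bigr => k _; rewrite rmorphM /= conj_realC chiJ.
pose u j := Re (uC j).
have uE j : (u j)%:C = uC j.
  have := uJ j; rewrite /u; case: (uC j) => a b; rewrite conjCE /=.
  by move=> /eqP; rewrite eq_complex /= => /andP[_ /eqP h]; apply/eqP;
    rewrite eq_complex /= eqxx /=; apply/eqP; lra.
have hatu k : hat u k = N^-1 * ((B + symb k)^-1)%:C.
  rewrite /hat; under eq_bigr do rewrite uE.
  rewrite /uC; under eq_bigr => j _ do rewrite mulrCA mulr_sumr.
  rewrite -mulr_sumr exchange_big /= (bigD1 k) //= [X in _ * (_ * (_ + X))]big1; last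
    first.
    move=> l lk; rewrite (eq_bigr (fun j => ((B + symb l)^-1)%:C * chi j (l - k))).
      by rewrite -mulr_sumr chi_sum subr_eq0 (negPf lk) mulr0n mulr0.
    by move=> j _; rewrite chiDr -chiNC chiJ; ring.
  rewrite addr0 (eq_bigr (fun j => ((B + symb k)^-1)%:C)).
    by rewrite sumr_const -[(_ *+ #|_|)]mulr_natl (mulKf N0).
  by move=> j _; rewrite mulrCA mulrA chiJ chiN mul1r.
have resolv j : B * u j + lap u j = (j == 0)%:R.
  apply: complexI.
  rewrite (hat_inv (fun j => B * u j + lap u j)).
  have h k : hat (fun j => B * u j + lap u j) k = N^-1.
    have -> : hat (fun j => B * u j + lap u j) k = B%:C * hat u k + hat (lap u) k.
      rewrite /hat mulrCA -mulrDr; congr (_ * _); rewrite mulr_sumr -big_split /=.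
      by apply: eq_bigr => l _; rewrite rmorphD rmorphM /=; ring.
    rewrite hat_lap hatu -mulrDl -rmorphD mulrCA -rmorphM /= mulfV //.
    by rewrite mulr1.
  under eq_bigr do rewrite h.
  rewrite -mulr_suml; under eq_bigr do rewrite chiC.
  rewrite chi_sum; case: eqP => _; last by rewrite mulr0n mul0r rmorph0.
  by rewrite mulr1n mulfV // rmorph1.
have u_ge0 j : 0 <= u j.
  (* At a minimum point i one has [lap u i] <= 0, so B u(i) is a nonnegative right-hand side minus a
     nonpositive number; hence the minimum of u is nonnegative. *)
  have [i _ hi] := @arg_minP _ R G 0 xpredT u isT.
  have hl : lap u i <= 0.
    by rewrite -oppr_ge0 -sumrN; apply: sumr_ge0 => r _; rewrite -mulrN opprB
      mulr_ge0 // subr_ge0; apply: hi.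
  have : 0 <= B * u i.
    have := resolv i => /(canRL (addrK _)) ->.
    by rewrite addr_ge0 ?ler0n // oppr_ge0.
  by rewrite pmulr_rge0 // => h; apply: (le_trans h); apply: hi.
have su k : \sum_r u r * Re (chi r k) = (B + symb k)^-1.
  have := hatu k; rewrite /hat => /(mulfI (invr_neq0 N0)) /(congr1 Re) /= <-.
  rewrite raddf_sum; apply: eq_bigr => r _ /=.
  by rewrite -(cRe_conj (chi r k)); case: ((chi r k)^*) => a b /=; ring.
(* B x / (B + x) = B - B^2 / (B + x): up to the constant term the kernel is B^2 times the Green
   function, whose total mass is 1 / B. *)
exists (fun r => B ^+ 2 * u r); split.
- by move=> r; rewrite /u uN.
- by move=> r; rewrite mulr_ge0 ?sqr_ge0.
move=> k.
have e0 : \sum_r u r = B^-1.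
  rewrite -[in RHS](addr0 B) -[in X in B + X](_ : symb 0 = 0).
    rewrite -(su 0); apply: eq_bigr => r _.
    by rewrite chiC chi0 mulr1.
  by rewrite /symb big1 // => r _; rewrite chiC chi0 subrr mulr0.
rewrite (eq_bigr (fun r => B ^+ 2 * u r - B ^+ 2 * (u r * Re (chi r k)))); last first.
  by move=> r _; ring.
rewrite sumrB -!mulr_sumr e0 su; field.
by rewrite den gt_eqF.
Qed.

End Kernel.

Lemma vhat_cross (f g : G -> 'rV[R]_3) m :
  vhat (fun j => crossp (f j) (g j)) m = \sum_k crossp (vhat f (m - k)) (vhat g k).
Proof.
apply/rowP => i; rewrite summxE mxE.
under [RHS]eq_bigr do rewrite !mxE.
rewrite sumrB -!hat_mul /hat -mulrBr -sumrB; congr (_ * _).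
by apply: eq_bigr => j _; rewrite mxE rmorphB mulrBr.
Qed.

Lemma vhat_lap kap f k : (forall r, kap (- r) = kap r) ->
  vhat (vlap kap f) k = (symb kap k)%:C *: vhat f k.
Proof.
move=> ke; apply/rowP => i; rewrite !mxE -hat_lap // /hat; congr (_ * _).
by apply: eq_bigr => j _; rewrite vlapE.
Qed.

Lemma vhat_parseval f g : N^-1 * \sum_j dotp (f j) (g j) =
  \sum_k Re (dotp (vhat f k) (map_mx Num.conj (vhat g k))).
Proof.
rewrite /dotp exchange_big mulr_sumr /=.
under [RHS]eq_bigr do rewrite raddf_sum.
rewrite [RHS]exchange_big; apply: eq_bigr => i _ /=.
apply: complexI; rewrite hat_parseval.
have h : \sum_k hat (fun j => f j 0 i) k * (hat (fun j => g j 0 i) k)^* =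
  (Re (\sum_k hat (fun j => f j 0 i) k * (hat (fun j => g j 0 i) k)^*))%:C.
  by rewrite -hat_parseval.
by rewrite h raddf_sum; congr (_%:C); apply: eq_bigr => k _; rewrite !mxE.
Qed.

End FiniteFourier.

(** * Sequences of Fourier coefficients *)

Section SymSum.

Definition sseq (n : nat) : seq int := [seq j%:Z - n%:Z | j <- iota 0 n.*2.+1].

Lemma sseq_uniq n : uniq (sseq n).
Proof. by rewrite map_inj_uniq ?iota_uniq // => i j /addIr []. Qed.

Lemma mem_sseq n k : (k \in sseq n) = (`|k| <= n)%N.
Proof.
apply/mapP/idP => [[j]|h].
  by rewrite mem_iota => hj ->; lia.
exists `|(k + n%:Z)%R|%N; rewrite ?mem_iota; lia.
Qed.

Section Nmod.
Variable V : nmodType.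
Implicit Types F G : int -> V.

Lemma symsumE n F : symsum n F = \sum_(k <- sseq n) F k.
Proof.
by rewrite /symsum /sseq big_map -(big_mkord xpredT (fun j => F (j%:Z - n%:Z)))
  /index_iota subn0.
Qed.

Lemma eq_symsum n F G : (forall k, (`|k| <= n)%N -> F k = G k) ->
  symsum n F = symsum n G.
Proof.
by move=> h; rewrite !symsumE; apply: eq_big_seq => k; rewrite mem_sseq => /h.
Qed.

Lemma symsum0 F : symsum 0 F = F 0.
Proof. by rewrite symsumE /sseq /= big_cons big_nil addr0 subr0. Qed.

Lemma symsum_perm n F (s : seq int) : uniq s -> (forall k, (k \in s) = (`|k| <= n)%N) ->
  symsum n F = \sum_(k <- s) F k.
Proof.
move=> us hs; rewrite symsumE; apply: perm_big; apply: uniq_perm => //.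
  exact: sseq_uniq.
by move=> k; rewrite hs mem_sseq.
Qed.

Lemma symsumS n F : symsum n.+1 F = symsum n F + (F n.+1%:Z + F (- n.+1%:Z)).
Proof.
rewrite (@symsum_perm n.+1 F (n.+1%:Z :: - n.+1%:Z :: sseq n)).
- by rewrite big_cons big_cons symsumE [RHS]addrC addrA.
- by rewrite cons_uniq cons_uniq inE !mem_sseq sseq_uniq; lia.
- by move=> k; rewrite in_cons in_cons mem_sseq; lia.
Qed.

Lemma symsumN n F : symsum n (fun k => F (- k)) = symsum n F.
Proof.
elim: n => [|n IH]; first by rewrite !symsum0 oppr0.
by rewrite !symsumS IH opprK (addrC (F (- _))).
Qed.

Lemma symsumD n F G : symsum n (fun k => F k + G k) = symsum n F + symsum n G.
Proof. by rewrite !symsumE big_split. Qed.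

Lemma symsum_widen n m F : (n <= m)%N -> (forall k, (n < `|k|)%N -> F k = 0) ->
  symsum m F = symsum n F.
Proof.
move=> /subnK <-; elim: (m - n)%N => // d IH hF.
by rewrite addSn symsumS IH // !hF ?addr0 //; lia.
Qed.

Lemma exchange_symsum n m (F : int -> int -> V) :
  symsum n (fun k => symsum m (F k)) = symsum m (fun l => symsum n (F ^~ l)).
Proof.
rewrite symsumE; under eq_bigr do rewrite symsumE.
by rewrite exchange_big symsumE; apply: eq_bigr => l _; rewrite symsumE.
Qed.

Lemma symsum_single n F m : (`|m| <= n)%N -> (forall k, k != m -> F k = 0) ->
  symsum n F = F m.
Proof.
move=> hm h; rewrite symsumE (bigD1_seq m) ?mem_sseq ?sseq_uniq //=.
by rewrite big1 ?addr0 // => k /h.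
Qed.
End Nmod.

Lemma raddf_symsum (V W : nmodType) (f : {additive V -> W}) n (F : int -> V) :
  f (symsum n F) = symsum n (fun k => f (F k)).
Proof. by rewrite !symsumE raddf_sum. Qed.

Lemma mulr_symsumr (A : pzRingType) n (F : int -> A) a :
  a * symsum n F = symsum n (fun k => a * F k).
Proof. by rewrite !symsumE mulr_sumr. Qed.

Lemma mulr_symsuml (A : pzRingType) n (F : int -> A) a :
  symsum n F * a = symsum n (fun k => F k * a).
Proof. by rewrite !symsumE mulr_suml. Qed.

Lemma symsum_mxE (V : nmodType) p q n (F : int -> 'M[V]_(p, q)) i j :
  (symsum n F) i j = symsum n (fun k => F k i j).
Proof. by rewrite !symsumE summxE. Qed.

Variable R : realType.
Implicit Types F G P Q : int -> R.

Lemma ler_symsum n F G : (forall k, (`|k| <= n)%N -> F k <= G k) ->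
  symsum n F <= symsum n G.
Proof.
move=> h; rewrite !symsumE big_seq [leRHS]big_seq; apply: ler_sum => k.
by rewrite mem_sseq => /h.
Qed.

Lemma symsum_ge0 n F : (forall k, 0 <= F k) -> 0 <= symsum n F.
Proof. by move=> h; rewrite symsumE sumr_ge0. Qed.

Lemma symsum_nd F : (forall k, 0 <= F k) -> nondecreasing_seq (fun n => symsum n F).
Proof.
move=> h; apply/nondecreasing_seqP => n; rewrite symsumS lerDl.
by rewrite addr_ge0.
Qed.

Lemma symsum_term n F k : (forall k, 0 <= F k) -> (`|k| <= n)%N -> F k <= symsum n F.
Proof.
move=> h hk; rewrite symsumE (bigD1_seq k) ?mem_sseq ?sseq_uniq //= lerDl.
exact: sumr_ge0.
Qed.

Lemma symsumZ n F a : symsum n (fun k => a * F k) = a * symsum n F.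
Proof. by rewrite mulr_symsumr. Qed.

Lemma symsumB n F G : symsum n (fun k => F k - G k) = symsum n F - symsum n G.
Proof. by rewrite !symsumE sumrB. Qed.

Lemma ler_norm_symsum n F : `|symsum n F| <= symsum n (fun k => `|F k|).
Proof. by rewrite !symsumE ler_norm_sum. Qed.

Lemma symsum_tail_le n m F G : (n <= m)%N -> (forall k, `|F k| <= G k) ->
  `|symsum m F - symsum n F| <= symsum m G - symsum n G.
Proof.
move=> /subnK <- h; elim: (m - n)%N => [|d IH]; first by rewrite add0n !subrr normr0.
rewrite addSn !symsumS ![_ + _ - symsum n _]addrAC.
apply: (le_trans (ler_normD _ _)); apply: lerD => //.
by apply: (le_trans (ler_normD _ _)); apply: lerD.
Qed.

Lemma symsum_cvg F A : (forall n, symsum n (fun k => `|F k|) <= A) ->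
  cvgn (fun n => symsum n F).
Proof.
move=> h.
have c1 : cvgn (fun n => symsum n (fun k => `|F k|)).
  apply: nondecreasing_is_cvgn; first exact: symsum_nd.
  by exists A => _ [n _ <-].
have c2 : cvgn (fun n => symsum n (fun k => `|F k| + F k)).
  apply: nondecreasing_is_cvgn.
    by apply: symsum_nd => k; rewrite -lerBlDr sub0r -normrN ler_norm.
  exists (2 * A) => _ [n _ <-]; rewrite symsumD mulr_natl mulr2n lerD //.
  by apply: le_trans (h n); apply: ler_symsum => k _; apply: ler_norm.
have -> : (fun n => symsum n F) =
    (fun n => symsum n (fun k => `|F k| + F k)) \- (fun n => symsum n (fun k => `|F k|)).
  by apply/funext => n /=; rewrite symsumD addrAC subrr add0r.
exact: is_cvgB.
Qed.

Lemma cvg_symsum (F_ : nat -> int -> R) F n :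
  (forall k, F_ ^~ k @ \oo --> F k) -> (fun j => symsum n (F_ j)) @ \oo --> symsum n F.
Proof.
move=> h; elim: n => [|n IH].
  by rewrite symsum0; under eq_fun do rewrite symsum0; exact: h.
by rewrite symsumS; under eq_fun do rewrite symsumS; apply: cvgD => //; apply: cvgD.
Qed.

End SymSum.

Section Sobolev.
Variable R : realType.
Local Notation C := R[i].
Local Notation cvec3 := 'rV[R[i]]_3.
Implicit Types (a b : int -> cvec3) (s : R).

Definition wt s (k : int) : R := (1 + k%:~R ^+ 2) `^ s.

Lemma wt_base_ge1 (k : int) : 1 <= 1 + k%:~R ^+ 2 :> R.
Proof. by rewrite lerDl sqr_ge0. Qed.

Lemma wt_gt0 s k : 0 < wt s k.
Proof. by rewrite powR_gt0 // (lt_le_trans ltr01) // wt_base_ge1. Qed.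

Lemma wt_ge0 s k : 0 <= wt s k. Proof. exact/ltW/wt_gt0. Qed.

Lemma wtN s k : wt (- s) k = (wt s k)^-1.
Proof. by rewrite /wt powRN. Qed.

Lemma wt0 k : wt 0 k = 1. Proof. by rewrite /wt powRr0. Qed.

Lemma wt_opp s k : wt s (- k) = wt s k.
Proof. by rewrite /wt rmorphN /= sqrrN. Qed.

Lemma wtD s r k : wt (s + r) k = wt s k * wt r k.
Proof.
by rewrite /wt powRD // (gt_eqF (lt_le_trans ltr01 (wt_base_ge1 k))) implybT.
Qed.

Lemma wt_le s r k : s <= r -> wt s k <= wt r k.
Proof. by move=> h; apply: ler_powR => //; exact: wt_base_ge1. Qed.

Lemma wt_half k : wt 2^-1 k ^+ 2 = 1 + k%:~R ^+ 2.
Proof. have h : 0 <= 1 + k%:~R ^+ 2 :> R by rewrite (le_trans ler01) // wt_base_ge1.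
by rewrite /wt powR12_sqrt // sqr_sqrtr. Qed.

Lemma norm_le_wt_half k : `|k%:~R : R| <= wt 2^-1 k.
Proof.
rewrite -(@ler_pXn2r _ 2) ?nnegrE ?wt_ge0 // wt_half real_normK ?num_real //.
by rewrite lerDr.
Qed.

Lemma wt_half_le k : wt 2^-1 k <= 1 + `|k%:~R : R|.
Proof.
rewrite -(@ler_pXn2r _ 2) ?nnegrE ?wt_ge0 ?addr_ge0 // wt_half.
rewrite sqrrD expr1n mul1r real_normK ?num_real //.
by rewrite lerD2r lerDl mulrn_wge0.
Qed.

Lemma wt_half_ge1 k : 1 <= wt 2^-1 k.
Proof. by rewrite -[leLHS](wt0 k); apply: wt_le; rewrite invr_ge0. Qed.

Lemma cnormsqE (v : cvec3) : cnormsq v = \sum_i (Re (v 0 i) ^+ 2 + Im (v 0 i) ^+ 2).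
Proof.
apply: eq_bigr => i _; case: (v 0 i) => x y /=.
by rewrite sqr_sqrtr // addr_ge0 ?sqr_ge0.
Qed.

Lemma cnormsq_ge0 (v : cvec3) : 0 <= cnormsq v.
Proof. by apply: sumr_ge0 => i _; rewrite sqr_ge0. Qed.

Lemma cnormsq0 : cnormsq (0 : cvec3) = 0.
Proof. by rewrite cnormsqE big1 // => i _; rewrite mxE /= expr0n /= addr0. Qed.

Lemma cnormsqZ (x : R) (v : cvec3) : cnormsq (x%:C *: v) = x ^+ 2 * cnormsq v.
Proof.
rewrite !cnormsqE mulr_sumr; apply: eq_bigr => i _; rewrite mxE.
by case: (v 0 i) => p q /=; ring.
Qed.

Lemma cnormsqD (u v : cvec3) : cnormsq (u + v) <= 2 * (cnormsq u + cnormsq v).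
Proof.
rewrite !cnormsqE -big_split mulr_sumr; apply: ler_sum => i _ /=; rewrite mxE.
case: (u 0 i) (v 0 i) => p q [x y] /=.
move: (sqr_ge0 (p - x)) (sqr_ge0 (q - y)); rewrite !sqrrD !sqrrN; lra.
Qed.

Lemma cnormsqB (u v : cvec3) : cnormsq (u - v) <= 2 * (cnormsq u + cnormsq v).
Proof.
have -> : cnormsq v = cnormsq (- v); last exact: cnormsqD.
by rewrite !cnormsqE; apply: eq_bigr => i _; rewrite mxE; case: (v 0 i) => p q /=;
  rewrite !sqrrN.
Qed.

Lemma sqr_coord_le (v : cvec3) i : Re (v 0 i) ^+ 2 + Im (v 0 i) ^+ 2 <= cnormsq v.
Proof.
rewrite cnormsqE (bigD1 i) //= lerDl; apply: sumr_ge0 => j _.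
by rewrite addr_ge0 ?sqr_ge0.
Qed.

Definition rdot (u v : cvec3) : R := Re (\sum_(i < 3) u 0 i * (v 0 i)^* ).

Lemma rdotE u v : rdot u v =
  \sum_(i < 3) (Re (u 0 i) * Re (v 0 i) + Im (u 0 i) * Im (v 0 i)).
Proof.
rewrite /rdot raddf_sum; apply: eq_bigr => i _.
by case: (u 0 i) (v 0 i) => p q [x y] /=; ring.
Qed.

Lemma rdotZl (x : R) u v : rdot (x%:C *: u) v = x * rdot u v.
Proof.
rewrite !rdotE mulr_sumr; apply: eq_bigr => i _; rewrite mxE.
by case: (u 0 i) (v 0 i) => p q [z y] /=; ring.
Qed.

Lemma rdotC u v : rdot u v = rdot v u.
Proof. by rewrite !rdotE; apply: eq_bigr => i _; ring. Qed.

Lemma rdotBl u u' v : rdot (u - u') v = rdot u v - rdot u' v.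
Proof.
rewrite !rdotE -sumrB; apply: eq_bigr => i _; rewrite !mxE.
by case: (u 0 i) (u' 0 i) => p q [x y] /=; ring.
Qed.

Lemma rdot_self u : rdot u u = cnormsq u.
Proof. by rewrite rdotE cnormsqE; apply: eq_bigr => i _; rewrite !expr2. Qed.

(** A free parameter d stands in for the square roots of Cauchy-Schwarz. Taking for d a multiple of
    the weight [wt s k] gives the duality between H^s and H^{-s} term by term. *)
Lemma rdot_amgm u v d : 0 < d -> 2 * `|rdot u v| <= d * cnormsq u + cnormsq v / d.
Proof.
move=> d0; rewrite rdotE !cnormsqE mulr_sumr mulr_suml -big_split.
rewrite -[X in X * `|_| <= _](@ger0_norm _ 2) // -normrM mulr_sumr.
apply: (le_trans (ler_norm_sum _ _ _)); apply: ler_sum => i _ /=.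
move: (Re (u 0 i)) (Im (u 0 i)) (Re (v 0 i)) (Im (v 0 i)) => p q x y.
have e1 : 0 <= (d * p + x) ^+ 2 / d by rewrite divr_ge0 ?sqr_ge0 // ltW.
have e2 : 0 <= (d * p - x) ^+ 2 / d by rewrite divr_ge0 ?sqr_ge0 // ltW.
have e3 : 0 <= (d * q + y) ^+ 2 / d by rewrite divr_ge0 ?sqr_ge0 // ltW.
have e4 : 0 <= (d * q - y) ^+ 2 / d by rewrite divr_ge0 ?sqr_ge0 // ltW.
have E (u1 v1 : R) : (d * u1 + v1) ^+ 2 / d = d * u1 ^+ 2 + 2 * (u1 * v1) + v1 ^+ 2 / d.
  by field; rewrite gt_eqF.
have E2 (u1 v1 : R) : (d * u1 - v1) ^+ 2 / d = d * u1 ^+ 2 - 2 * (u1 * v1) + v1 ^+ 2 / d.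
  by field; rewrite gt_eqF.
move: e1 e2 e3 e4; rewrite (E p x) (E2 p x) (E q y) (E2 q y) !mulrDr mulrDl => e1 e2 e3
  e4.
by rewrite ler_norml; apply/andP; split; lra.
Qed.

Definition hsum s a n : R := symsum n (fun k => wt s k * cnormsq (a k)).
(** Real-valued substitute for a bound on [sobolev_norm]: A bounds the square of the norm through
    all symmetric partial sums. In this form the bound is inherited by coefficientwise limits
    ([hbd_lim]). *)
Definition hbd s a (A : R) : Prop := forall n, hsum s a n <= A.

Lemma hterm_ge0 s a k : 0 <= wt s k * cnormsq (a k).
Proof. by rewrite mulr_ge0 ?wt_ge0 ?cnormsq_ge0. Qed.

Lemma hsum_ge0 s a n : 0 <= hsum s a n.
Proof. by apply: symsum_ge0 => k; exact: hterm_ge0. Qed.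

Lemma hbd_ge0 s a A : hbd s a A -> 0 <= A.
Proof. by move=> /(_ 0%N); apply: le_trans; exact: hsum_ge0. Qed.

Lemma hbd_le s r a A : r <= s -> hbd s a A -> hbd r a A.
Proof.
move=> rs h n; apply: le_trans (h n); apply: ler_symsum => k _.
by rewrite ler_wpM2r ?cnormsq_ge0 // wt_le.
Qed.

Lemma hbdB s a b A B : hbd s a A -> hbd s b B -> hbd s (fun k => a k - b k) (2 * (A + B)).
Proof.
move=> ha hb n; apply: (@le_trans _ _ (2 * (hsum s a n + hsum s b n))); last first.
  by rewrite ler_pM2l // lerD.
rewrite /hsum -symsumD -symsumZ; apply: ler_symsum => k _.
rewrite -mulrDr mulrCA ler_wpM2l ?wt_ge0 //; exact: cnormsqB.
Qed.

Lemma hsum_trunc s a N n :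
  hsum s (fun k => if (`|k| <= N)%N then a k else 0) n <= hsum s a N.
Proof.
set b := (fun k => _); have -> : hsum s a N = hsum s b N.
  by apply: eq_symsum => k hk; rewrite /b hk.
have [nN|Nn] := leqP n N; first exact: (symsum_nd (hterm_ge0 s b)).
rewrite /hsum (symsum_widen (ltnW Nn)) // => k hk.
by rewrite /b leqNgt hk /= cnormsq0 mulr0.
Qed.

Lemma hsum_cvg s a A : hbd s a A -> cvgn (hsum s a).
Proof.
move=> h; apply: nondecreasing_is_cvgn.
  by apply: symsum_nd => k; exact: hterm_ge0.
by exists A => _ [n _ <-].
Qed.

Lemma hsum_small s a A e : hbd s a A -> 0 < e ->
  exists K, forall n, (K <= n)%N -> hsum s a n - hsum s a K <= e.
Proof.
move=> h e0; have c := hsum_cvg h.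
have /cvgrPdist_le /(_ _ e0) [K _ HK] := c; exists K => n Kn.
have nd : nondecreasing_seq (hsum s a) by apply: symsum_nd => k; exact: hterm_ge0.
have l1 := nondecreasing_cvgn_le nd c n; have := HK K (leqnn K).
rewrite /= ger0_norm ?subr_ge0 ?nondecreasing_cvgn_le //.
by apply: le_trans; rewrite lerD2r.
Qed.

(** K depends on b and on the bound A but not on a: in the weighted inequality the part of a is at
    most d A <= e, and the tail of the fixed b in H^{-s} is then taken below d e. Only the tail of b
    has to be small, which is why boundedness of a sequence suffices in [weak_lim]. *)
Lemma pairing_tail s b A B e : hbd (- s) b B -> 0 <= A -> 0 < e -> exists K,
  forall a, hbd s a A -> forall n, (K <= n)%N ->
  `|symsum n (fun k => rdot (a k) (b k)) - symsum K (fun k => rdot (a k) (b k))| <= e.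
Proof.
move=> hb A0 e0; pose d := e / (A + 1).
have A1 : 0 < A + 1 by rewrite ltr_wpDl.
have d0 : 0 < d by rewrite divr_gt0.
have [K hK] := hsum_small hb (mulr_gt0 d0 e0).
exists K => a ha n Kn.
pose G k := 2^-1 * (d * (wt s k * cnormsq (a k)) + (wt (- s) k * cnormsq (b k)) / d).
have hG k : `|rdot (a k) (b k)| <= G k.
  rewrite /G mulrC ler_pdivlMr // mulrC; have dw : 0 < d * wt s k by rewrite mulr_gt0
    ?wt_gt0.
  have := rdot_amgm (a k) (b k) dw; rewrite wtN invfM.
  by congr (_ <= _ + _); [rewrite mulrA | rewrite mulrA mulrAC (mulrC (cnormsq _))].
apply: (le_trans (symsum_tail_le Kn hG)).
have eG m : symsum m G = 2^-1 * (d * hsum s a m + hsum (- s) b m / d).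
  rewrite /hsum mulrC -[_ * d^-1]mulrC -!symsumZ -symsumD mulrC -symsumZ.
  by apply: eq_symsum => k _; rewrite /G (mulrC d^-1).
rewrite !eG.
have := hK n Kn => h1; have h2 := ha n; have h3 := hsum_ge0 s a K.
have h4 : (hsum (- s) b n - hsum (- s) b K) / d <= e.
  by rewrite ler_pdivrMr // mulrC.
have h5 : d * hsum s a n <= e.
  apply: (@le_trans _ _ (d * (A + 1))); last by rewrite divfK // gt_eqF.
  by rewrite ler_pM2l // (le_trans h2) // lerDl.
have h6 : 0 <= d * hsum s a K by rewrite mulr_ge0 // ltW.
by move: h4; rewrite mulrBl; lra.
Qed.

Lemma pairing_cvg s a b A B : hbd s a A -> hbd (- s) b B ->
  symsum n (fun k => rdot (a k) (b k)) @[n --> \oo] --> pairing a b.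
Proof.
move=> ha hb; apply: (@symsum_cvg _ _ (2^-1 * (A + B))) => n.
apply: (@le_trans _ _ (2^-1 * (hsum s a n + hsum (- s) b n))); last first.
  by rewrite ler_pM2l // lerD.
rewrite /hsum -symsumD -symsumZ; apply: ler_symsum => k _; rewrite ler_pdivlMl //.
by rewrite wtN (mulrC (wt s k)^-1); apply: rdot_amgm; exact: wt_gt0.
Qed.

Lemma pairing_le s a b A B d : hbd s a A -> hbd (- s) b B -> 0 < d ->
  2 * `|pairing a b| <= d * A + B / d.
Proof.
move=> ha hb d0; have c := pairing_cvg ha hb.
rewrite -ler_pdivlMl //; apply: (cvgr_to_le (cvg_norm c)); near=> n.
apply: (le_trans (ler_norm_symsum _ _)); rewrite ler_pdivlMl //.
apply: (@le_trans _ _ (d * hsum s a n + d^-1 * hsum (- s) b n)); last first.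
  by rewrite (mulrC B) lerD // ler_pM2l // invr_gt0.
rewrite /hsum -!symsumZ -symsumD; apply: ler_symsum => k _.
have dw : 0 < d * wt s k by rewrite mulr_gt0 ?wt_gt0.
have := rdot_amgm (a k) (b k) dw; rewrite wtN invfM.
by rewrite -mulrA (mulrC (cnormsq (b k))) -mulrA.
Unshelve. all: by end_near. Qed.

(** Stated on real and imaginary parts so that every limit is a limit of real sequences. *)
Definition ccvg (z_ : nat -> C) (z : C) : Prop :=
  (Re (z_ n) @[n --> \oo] --> Re z) /\ (Im (z_ n) @[n --> \oo] --> Im z).
Definition vcvg (v_ : nat -> cvec3) (v : cvec3) : Prop :=
  forall i, ccvg (fun n => v_ n 0 i) (v 0 i).

Lemma ccvgD z_ z y_ y : ccvg z_ z -> ccvg y_ y -> ccvg (fun n => z_ n + y_ n) (z + y).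
Proof.
move=> [h1 h2] [h3 h4]; split.
  rewrite raddfD; under eq_fun do rewrite raddfD; exact: cvgD.
rewrite raddfD; under eq_fun do rewrite raddfD; exact: cvgD.
Qed.

Lemma ccvgN z_ z : ccvg z_ z -> ccvg (fun n => - z_ n) (- z).
Proof.
move=> [h1 h2]; split.
  rewrite raddfN; under eq_fun do rewrite raddfN; exact: cvgN.
rewrite raddfN; under eq_fun do rewrite raddfN; exact: cvgN.
Qed.

Lemma ccvgM z_ z y_ y : ccvg z_ z -> ccvg y_ y -> ccvg (fun n => z_ n * y_ n) (z * y).
Proof.
have RM (u v : C) : Re (u * v) = Re u * Re v - Im u * Im v by case: u v => p q [].
have IM (u v : C) : Im (u * v) = Re u * Im v + Im u * Re v by case: u v => p q [].
move=> [h1 h2] [h3 h4]; split.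
  by rewrite RM; under eq_fun do rewrite RM; apply: cvgB; apply: cvgM.
by rewrite IM; under eq_fun do rewrite IM; apply: cvgD; apply: cvgM.
Qed.

Lemma ccvg_cst z : ccvg (fun=> z) z.
Proof. by split; apply: cvg_cst. Qed.

Lemma ccvgJ z_ z : ccvg z_ z -> ccvg (fun n => (z_ n)^* ) z^*.
Proof.
move=> [h1 h2]; split; first by rewrite cRe_conj; under eq_fun do rewrite cRe_conj.
by rewrite cIm_conj; under eq_fun do rewrite cIm_conj; apply: cvgN.
Qed.

Lemma ccvg_real (x_ : nat -> R) (x : R) : x_ @ \oo --> x -> ccvg (fun n => (x_ n)%:C)
  x%:C.
Proof. by move=> h; split => //=; apply: cvg_cst. Qed.

Lemma ccvg_unique z_ z y : ccvg z_ z -> ccvg z_ y -> z = y.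
Proof.
case: z y => [a b] [c d] [/= h1 h2] [/= h3 h4].
by congr (_ +i* _); [exact: (cvg_unique _ h1 h3) | exact: (cvg_unique _ h2 h4)].
Qed.

Lemma ccvg_symsum (F_ : nat -> int -> C) F n :
  (forall k, ccvg (F_ ^~ k) (F k)) -> ccvg (fun j => symsum n (F_ j)) (symsum n F).
Proof.
move=> h; split.
  rewrite raddf_symsum; under eq_fun do rewrite raddf_symsum.
  by apply: cvg_symsum => k; case: (h k).
rewrite raddf_symsum; under eq_fun do rewrite raddf_symsum.
by apply: cvg_symsum => k; case: (h k).
Qed.

Lemma vcvgZ z_ z v_ v : ccvg z_ z -> vcvg v_ v -> vcvg (fun n => z_ n *: v_ n) (z *: v).
Proof.
move=> h1 h2 i; rewrite !mxE; under [X in ccvg X]eq_fun do rewrite !mxE.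
exact: ccvgM.
Qed.

Lemma vcvg_cross v_ v u_ u : vcvg v_ v -> vcvg u_ u ->
  vcvg (fun n => crossp (v_ n) (u_ n)) (crossp v u).
Proof.
move=> h1 h2 i; rewrite !mxE; under [X in ccvg X]eq_fun do rewrite !mxE.
by apply: ccvgD; [|apply: ccvgN]; apply: ccvgM.
Qed.

Lemma vcvg_symsum (F_ : nat -> int -> cvec3) F n :
  (forall k, vcvg (F_ ^~ k) (F k)) -> vcvg (fun j => symsum n (F_ j)) (symsum n F).
Proof.
move=> h i; rewrite symsum_mxE; under [X in ccvg X]eq_fun do rewrite symsum_mxE.
by apply: (@ccvg_symsum (fun j k => F_ j k 0 i)) => k; apply: h.
Qed.

Lemma cvg_sumr (I : Type) (r : seq I) (f_ : nat -> I -> R) f :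
  (forall i, f_ ^~ i @ \oo --> f i) ->
  (fun n => \sum_(i <- r) f_ n i) @ \oo --> \sum_(i <- r) f i.
Proof.
move=> h; elim: r => [|a r IH].
  by rewrite big_nil; under eq_fun do rewrite big_nil; apply: cvg_cst.
by rewrite big_cons; under eq_fun do rewrite big_cons; apply: cvgD.
Qed.

Lemma cvg_cnormsq v_ v : vcvg v_ v -> cnormsq (v_ n) @[n --> \oo] --> cnormsq v.
Proof.
move=> h; rewrite cnormsqE; under eq_fun do rewrite cnormsqE.
by apply: cvg_sumr => i; have [h1 h2] := h i; apply: cvgD; apply: cvgM.
Qed.

Lemma cvg_rdot v_ v u_ u : vcvg v_ v -> vcvg u_ u ->
  rdot (v_ n) (u_ n) @[n --> \oo] --> rdot v u.
Proof.
move=> h1 h2; rewrite rdotE; under eq_fun do rewrite rdotE.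
apply: cvg_sumr => i; have [p1 p2] := h1 i; have [q1 q2] := h2 i.
by apply: cvgD; apply: cvgM.
Qed.

Lemma hbd_lim s (a_ : nat -> int -> cvec3) a A :
  (forall k, vcvg (a_ ^~ k) (a k)) -> (forall j, hbd s (a_ j) A) -> hbd s a A.
Proof.
move=> h hA n.
have c : hsum s (a_ j) n @[j --> \oo] --> hsum s a n.
  by apply: cvg_symsum => k; apply: cvgMr; exact: cvg_cnormsq.
by apply: (cvgr_to_le c); near=> j; exact: hA.
Unshelve. all: by end_near. Qed.

(** The tails are uniformly small by [pairing_tail], and the remaining finite sum converges term by
    term. *)
Lemma weak_lim s (a_ : nat -> int -> cvec3) a b A B :
  (forall k, vcvg (a_ ^~ k) (a k)) -> (forall j, hbd s (a_ j) A) -> hbd (- s) b B ->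
  pairing (a_ j) b @[j --> \oo] --> pairing a b.
Proof.
move=> h hA hB; have ha := hbd_lim h hA; have A0 := hbd_ge0 ha.
apply/cvgrPdist_le => e e0; have e3 : 0 < e / 3 by rewrite divr_gt0.
have [K hK] := pairing_tail hB A0 e3.
have T c : hbd s c A -> `|pairing c b - symsum K (fun k => rdot (c k) (b k))| <= e / 3.
  move=> hc.
  have cc : `|symsum n (fun k => rdot (c k) (b k)) - symsum K (fun k => rdot (c k) (b k))|
     @[n --> \oo] --> `|pairing c b - symsum K (fun k => rdot (c k) (b k))|.
    by apply: cvg_norm; apply: cvgB; [exact: (pairing_cvg hc hB)|apply: cvg_cst].
  apply: (cvgr_to_le cc); near=> n; apply: hK => //; near: n; exact: nbhs_infty_ge.
have cK : symsum K (fun k => rdot (a_ j k) (b k)) @[j --> \oo] -->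
    symsum K (fun k => rdot (a k) (b k)).
  apply: cvg_symsum => k; apply: cvg_rdot => // i; exact: ccvg_cst.
move/cvgrPdist_le: cK => /(_ _ e3) cK; near=> j.
have h1 := T _ ha; have h2 := T _ (hA j).
have h3 : `|symsum K (fun k => rdot (a k) (b k)) - symsum K (fun k => rdot (a_ j k) (b
  k))|
   <= e / 3 by near: j.
move: h1 h2 h3; rewrite !ler_norml => /andP[? ?] /andP[? ?] /andP[? ?].
by apply/andP; split; lra.
Unshelve. all: by end_near. Qed.

End Sobolev.

(** * Convolutions of Fourier coefficients *)

Section SobolevNorm.
Variable R : realType.
Local Notation cvec3 := 'rV[R[i]]_3.
Implicit Types (a b : int -> cvec3) (s : R).

(** The terms are nonnegative and every finite set of integers lies in a symmetric range, so the
    unordered sum is the supremum of the symmetric ones; the square root commutes with this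
    supremum. *)
Lemma sobolev_normE s a :
  sobolev_norm s a = ereal_sup (range (fun n => (Num.sqrt (hsum s a n))%:E)).
Proof.
have E : (\esum_(k in [set: int]) ((1 + k%:~R ^+ 2) `^ s * cnormsq (a k))%:E)%E =
    ereal_sup (range (fun n => (hsum s a n)%:E)).
  have hs n : (hsum s a n)%:E = (\sum_(k \in [set` sseq n])
      ((1 + k%:~R ^+ 2) `^ s * cnormsq (a k))%:E)%E.
    by rewrite -fsbig_seq ?sseq_uniq // sumEFin /hsum symsumE.
  apply/eqP; rewrite eq_le; apply/andP; split.
    apply: ge_ereal_sup => /= _ [X [fX _] <-].
    have /finite_seqP[r Xr] := fX.
    pose n := (\max_(k <- r) `|k|)%N.
    apply: (@le_trans _ _ (hsum s a n)%:E); last by apply: ereal_sup_ubound; exists n.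
    rewrite hs; apply: lee_fsum_nneg_subset => //; first exact: finite_seq.
      move=> k; rewrite Xr inE => /= Xk; rewrite inE /= mem_sseq.
      exact: (@leq_bigmax_seq _ _ xpredT (fun k : int => `|k|%N)).
    by move=> k _; rewrite lee_fin; exact: hterm_ge0.
  apply: ge_ereal_sup => /= _ [n _ <-]; rewrite hs; apply: ereal_sup_ubound.
  by exists [set` sseq n] => //; split => //; exact: finite_seq.
rewrite /sobolev_norm E; apply/eqP; rewrite eq_le; apply/andP; split.
  set L := ereal_sup (range (fun n => (Num.sqrt (hsum s a n))%:E)).
  have hL n : ((Num.sqrt (hsum s a n))%:E <= L)%E by apply: ereal_sup_ubound; exists n.
  have L0 : (0 <= L)%E by apply: le_trans (hL 0%N); rewrite lee_fin sqrtr_ge0.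
  move: L0 hL; case: L => [r||] //; last by move=> _ _; rewrite leey.
  rewrite lee_fin => r0 hL.
  have -> : r%:E = sqrte ((r ^+ 2)%:E) by rewrite /= sqrtr_sqr ger0_norm.
  rewrite lee_sqrt ?lee_fin ?sqr_ge0 //; apply: ge_ereal_sup => /= _ [n _ <-].
  have := hL n; rewrite !lee_fin => h.
  by rewrite -(@ler_sqrt _ (hsum s a n)) ?sqr_ge0 // sqrtr_sqr ger0_norm.
apply: ge_ereal_sup => /= _ [n _ <-].
have -> : (Num.sqrt (hsum s a n))%:E = sqrte (hsum s a n)%:E by [].
have h : ((hsum s a n)%:E <= ereal_sup (range (fun n => (hsum s a n)%:E)))%E.
  by apply: ereal_sup_ubound; exists n.
by rewrite lee_sqrt // (le_trans _ h) // lee_fin hsum_ge0.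
Qed.

Lemma sobolev_norm_ge0 s a : (0 <= sobolev_norm s a)%E.
Proof. exact: sqrte_ge0. Qed.

Lemma sobolev_norm_le s a A : 0 <= A -> hbd s a (A ^+ 2) -> (sobolev_norm s a <= A%:E)%E.
Proof.
move=> A0 h; rewrite sobolev_normE; apply: ge_ereal_sup => /= _ [n _ <-].
by rewrite lee_fin -(ger0_norm A0) -sqrtr_sqr ler_sqrt ?sqr_ge0.
Qed.

Lemma sobolev_norm_le_sqrt s a A : 0 <= A -> hbd s a A ->
  (sobolev_norm s a <= (Num.sqrt A)%:E)%E.
Proof. by move=> A0 h; apply: sobolev_norm_le; rewrite ?sqrtr_ge0 ?sqr_sqrtr. Qed.

Lemma sobolev_norm_hbd s a A : (sobolev_norm s a <= A%:E)%E -> hbd s a (A ^+ 2).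
Proof.
move=> h n.
have A0 : 0 <= A by rewrite -lee_fin; apply: le_trans h; exact: sobolev_norm_ge0.
have : ((Num.sqrt (hsum s a n))%:E <= A%:E)%E.
  by apply: le_trans h; rewrite sobolev_normE; apply: ereal_sup_ubound; exists n.
by rewrite lee_fin => h2; rewrite -(@ler_sqrt _ (hsum s a n)) ?sqr_ge0 // sqrtr_sqr
  ger0_norm.
Qed.

Lemma sobolev_norm_fin s a : (sobolev_norm s a < +oo)%E -> exists A, hbd s a A.
Proof.
move=> h; exists (fine (sobolev_norm s a) ^+ 2); apply: sobolev_norm_hbd.
by rewrite fineK // ge0_fin_numE // sobolev_norm_ge0.
Qed.

Lemma hbd_sobolev_norm_fin s a A : hbd s a A -> (sobolev_norm s a < +oo)%E.
Proof.
move=> h; apply: le_lt_trans (ltry (Num.sqrt A)).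
exact: sobolev_norm_le_sqrt (hbd_ge0 h) h.
Qed.

Lemma measurable_hsum d (T : measurableType d) (D : set T) s (c : T -> int -> cvec3) n :
  (forall k i, measurable_fun D (fun t => Re (c t k 0 i)) /\
     measurable_fun D (fun t => Im (c t k 0 i))) ->
  measurable_fun D (fun t => hsum s (c t) n).
Proof.
move=> h; rewrite /hsum.
under eq_fun do rewrite symsumE.
apply: measurable_sum => k; apply: measurable_funM => //.
under eq_fun do rewrite cnormsqE.
apply: measurable_sum => i; have [h1 h2] := h k i.
by apply: measurable_funD; apply: measurable_funX.
Qed.

Lemma measurable_sobolev_norm d (T : measurableType d) (D : set T) s
    (c : T -> int -> cvec3) :
  (forall k i, measurable_fun D (fun t => Re (c t k 0 i)) /\
     measurable_fun D (fun t => Im (c t k 0 i))) ->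
  measurable_fun D (fun t => sobolev_norm s (c t)).
Proof.
move=> h; apply: (emeasurable_fun_cvg (fun n t => (Num.sqrt (hsum s (c t) n))%:E)).
  move=> n; apply/measurable_EFinP.
  apply: (measurableT_comp (f := @Num.sqrt R)); last exact: measurable_hsum.
  by apply: continuous_measurable_fun => x; apply: sqrt_continuous.
move=> t _; rewrite sobolev_normE; apply: ereal_nondecreasing_cvgn.
move=> n m nm; rewrite lee_fin ler_sqrt ?hsum_ge0 //.
by apply: symsum_nd => // k; exact: hterm_ge0.
Qed.

(** [lim] returns the default [point] on divergent sequences, so measurability needs the set of
    convergence: it is the set where the upper and lower limits agree and are finite. There [lim] is
    the finite part of the upper limit, and off it [lim] is constant. *)
Lemma measurable_lim d (T : measurableType d) (D : set T) (h : nat -> T -> R) :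
  measurable D -> (forall n, measurable_fun D (h n)) ->
  measurable_fun D (fun t => lim (h n t @[n --> \oo])).
Proof.
move=> mD mh.
pose S t := limn_esup (fun n => (h n t)%:E); pose I t := limn_einf (fun n => (h n t)%:E).
have mS : measurable_fun D S.
  by apply: (@measurable_fun_limn_esup _ _ _ D (fun n t => (h n t)%:E)) => n;
    apply/measurable_EFinP.
have mI : measurable_fun D I.
  rewrite (_ : I = (fun t => - limn_esup (fun n => (- h n t)%:E))%E); last first.
    by apply/funext => t; rewrite /I /limn_einf; congr (- limn_esup _)%E.
  apply: measurableT_comp => //.
  apply: (@measurable_fun_limn_esup _ _ _ D (fun n t => (- h n t)%:E)) => n.
  by apply/measurable_EFinP; apply: measurableT_comp.
have cE t : (S t == I t) && (S t \is a fin_num) <-> cvgn (fun n => h n t).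
  split=> [/andP[/eqP SI Sf]|/cvg_ex[l hl]].
    pose u n := (h n t)%:E.
    have cu : u @ \oo --> S t.
      apply: (squeeze_cvge (f := einfs u) (h := esups u)).
      - apply: nearW => n; apply/andP; split; last by apply: ereal_sup_ubound; exists n
        => /=.
        by apply: ereal_inf_lbound; exists n => /=.
      - by rewrite SI /I limn_einf_lim; exact: is_cvg_einfs.
      - by rewrite /S limn_esup_lim; exact: is_cvg_esups.
    have := cu; rewrite -(fineK Sf) => /fine_cvg c.
    by apply/cvg_ex; exists (fine (S t)).
  have /cvg_limn_einf_sup[e1 e2] : (h n t)%:E @[n --> \oo] --> l%:E.
    by apply: cvg_EFin => //; apply: nearW.
  by rewrite /S /I e1 e2 eqxx.
rewrite (_ : (fun t => _) = (fun t => if (S t == I t) && (S t \is a fin_num)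
    then fine (S t) else point)).
  apply: measurable_fun_if => //.
  - apply: measurable_and; first exact: measurable_fun_eqe.
    apply: (measurable_fun_bool true) => /=.
    exact: emeasurable_fin_num.
  - apply: (measurable_funS mD) => //.
    exact: (measurableT_comp (f := @fine R)).
apply/funext => t; case: ifPn => [/cE c|/negP nc].
  have /cvg_limn_einf_sup[e1 e2] : (h n t)%:E @[n --> \oo] --> (lim (h n t @[n -->
    \oo]))%:E.
    by apply: cvg_EFin => //; apply: nearW.
  by rewrite /S e2.
by rewrite dvgP // => c; apply: nc; apply/cE.
Qed.

End SobolevNorm.

Section Bilinear.
Variable R : realType.
Local Notation cvec3 := 'rV[R[i]]_3.

Lemma crossp_amgm (u v : cvec3) i d : 0 < d ->
  2 * `|Re (crossp u v 0 i)| <= d * cnormsq u + cnormsq v / d /\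
  2 * `|Im (crossp u v 0 i)| <= d * cnormsq u + cnormsq v / d.
Proof.
move=> d0; rewrite !cnormsqE !sum3E.
have amgm (x y : R) : 2 * `|x * y| <= d * x ^+ 2 + y ^+ 2 / d.
  have e1 : 0 <= (d * x + y) ^+ 2 / d by rewrite divr_ge0 ?sqr_ge0 // ltW.
  have e2 : 0 <= (d * x - y) ^+ 2 / d by rewrite divr_ge0 ?sqr_ge0 // ltW.
  have E1 : (d * x + y) ^+ 2 / d = d * x ^+ 2 + 2 * (x * y) + y ^+ 2 / d.
    by field; rewrite gt_eqF.
  have E2 : (d * x - y) ^+ 2 / d = d * x ^+ 2 - 2 * (x * y) + y ^+ 2 / d.
    by field; rewrite gt_eqF.
  move: e1 e2; rewrite E1 E2.
  by case: (lerP 0 (x * y)) => h; rewrite ?(ger0_norm h) ?(ltr0_norm h); lra.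
have sq x : 0 <= x ^+ 2 / d by rewrite divr_ge0 ?sqr_ge0 // ltW.
have sq' x : 0 <= d * x ^+ 2 by rewrite mulr_ge0 ?sqr_ge0 // ltW.
have key (p q x y : R[i]) :
    2 * `|Re (p * y - q * x)| <= d * (Re p ^+ 2 + Im p ^+ 2) + d * (Re q ^+ 2 + Im q ^+ 2)
      + ((Re x ^+ 2 + Im x ^+ 2) / d + (Re y ^+ 2 + Im y ^+ 2) / d) /\
    2 * `|Im (p * y - q * x)| <= d * (Re p ^+ 2 + Im p ^+ 2) + d * (Re q ^+ 2 + Im q ^+ 2)
      + ((Re x ^+ 2 + Im x ^+ 2) / d + (Re y ^+ 2 + Im y ^+ 2) / d).
  case: p q x y => [p1 p2] [q1 q2] [x1 x2] [y1 y2] /=.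
  rewrite !mulrDr !mulrDl; split.
    have := ler_normD (p1 * y1 - p2 * y2) (- (q1 * x1 - q2 * x2)).
    have := ler_normB (p1 * y1) (p2 * y2); have := ler_normB (q1 * x1) (q2 * x2).
    rewrite normrN; move: (amgm p1 y1) (amgm p2 y2) (amgm q1 x1) (amgm q2 x2); lra.
  have := ler_normD (p1 * y2 + p2 * y1) (- (q1 * x2 + q2 * x1)).
  have := ler_normD (p1 * y2) (p2 * y1); have := ler_normD (q1 * x2) (q2 * x1).
  rewrite normrN; move: (amgm p1 y2) (amgm p2 y1) (amgm q1 x2) (amgm q2 x1); lra.
have sqs (z : R[i]) : 0 <= (Re z ^+ 2 + Im z ^+ 2) / d by rewrite mulrDl addr_ge0.
have sqs' (z : R[i]) : 0 <= d * (Re z ^+ 2 + Im z ^+ 2) by rewrite mulrDr addr_ge0.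
have [c0 c1 c2] := crosspE u v.
have : i = 0 \/ i = 1 \/ i = 2%:R.
  by case: i => [[|[|[|//]]]] hi; [left|right; left|right; right]; apply/val_inj.
rewrite !(mulrDr d (_ + _)) !(mulrDl (_ + _)) .
move: (sqs (u 0 0)) (sqs' (u 0 0)) (sqs (u 0 1)) (sqs' (u 0 1)) (sqs (u 0 2%:R)) (sqs'
  (u 0 2%:R)).
move: (sqs (v 0 0)) (sqs' (v 0 0)) (sqs (v 0 1)) (sqs' (v 0 1)) (sqs (v 0 2%:R)) (sqs'
  (v 0 2%:R)).
do 12 move=> ?; case=> [->|[->|->]]; rewrite ?c0 ?c1 ?c2.
- have := key (u 0 1) (u 0 2%:R) (v 0 1) (v 0 2%:R); lra.
- have := key (u 0 2%:R) (u 0 0) (v 0 2%:R) (v 0 0); lra.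
- have := key (u 0 0) (u 0 1) (v 0 0) (v 0 1); lra.
Qed.

(** Beyond |k| <= K the weight is at least K + 1. With the H^{1/2} weight for w this produces the
    rate 1 / (K + 1) of the later tail estimates. *)
Lemma symsum_tail_wt (P w : int -> R) n K : (K <= n)%N -> (forall k, 0 <= P k) ->
  (forall k, `|k%:~R : R| <= w k) ->
  symsum n P - symsum K P <= symsum n (fun k => w k * P k) / K.+1%:R.
Proof.
move=> Kn P0 hw.
pose Q k := if (`|k| <= K)%N then P k else 0.
have -> : symsum K P = symsum n Q.
  rewrite (symsum_widen Kn); last by move=> k; rewrite ltnNge /Q => /negPf ->.
  by apply: eq_symsum => k; rewrite /Q => ->.
rewrite -symsumB ler_pdivlMr ?ltr0n // mulrC -symsumZ; apply: ler_symsum => k _.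
have w0 : 0 <= w k by apply: le_trans (hw k).
rewrite /Q; case: ifPn => h; first by rewrite subrr mulr0 mulr_ge0.
rewrite subr0 ler_wpM2r //; apply: le_trans (hw k).
by rewrite -intr_norm -(abszE k) ler_nat ltnNge.
Qed.

(** The truncation level [nj j] moves with j. Tails that are small uniformly in j allow it to be
    replaced by a fixed K, at which j is sent to infinity, and K last. *)
Lemma double_lim (x : nat -> nat -> R) (nj : nat -> nat) (y : nat -> R) (L : R) :
  (forall K, x ^~ K @ \oo --> y K) -> y @ \oo --> L ->
  (forall K, \forall j \near \oo, (K <= nj j)%N) ->
  (forall e, 0 < e -> exists K0, forall K, (K0 <= K)%N -> forall j, (K <= nj j)%N ->
     `|x j (nj j) - x j K| <= e) ->
  x j (nj j) @[j --> \oo] --> L.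
Proof.
move=> xy yL hn hx; apply/cvgrPdist_le => e e0.
have e3 : 0 < e / 3 by rewrite divr_gt0.
have [K0 hK0] := hx _ e3.
move/cvgrPdist_le: yL => /(_ _ e3) [K1 _ hK1].
pose K := maxn K0 K1.
have h1 := hK1 K (leq_maxr _ _).
move/cvgrPdist_le: (xy K) => /(_ _ e3) cK; near=> j.
have h2 : `|y K - x j K| <= e / 3 by near: j.
have h3 : `|x j (nj j) - x j K| <= e / 3.
  apply: hK0; first exact: leq_maxl.
  by near: j; exact: hn.
move: h1 h2 h3; rewrite /= !ler_norml => /andP[? ?] /andP[? ?] /andP[? ?].
by apply/andP; split; lra.
Unshelve. all: by end_near. Qed.

Definition vlim (v_ : nat -> cvec3) : cvec3 :=
  \row_i (lim (Re (v_ n 0 i) @[n --> \oo]) +i* lim (Im (v_ n 0 i) @[n --> \oo])).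

(** Term of index k in the m-th Fourier coefficient of S x L S, where c are the coefficients of S
    and nu is the symbol of L. In the antisymmetrised expansion nu itself depends on m. *)
Definition cterm (nu : int -> R) (c : int -> cvec3) (m k : int) : cvec3 :=
  (nu k)%:C *: crossp (c (m - k)) (c k).
Definition conv nu c m : cvec3 := vlim (fun n => symsum n (cterm nu c m)).

Lemma cterm_amgm nu c m k i D d : `|nu k| <= D -> 0 < d ->
  `|Re (cterm nu c m k 0 i)| <= D / 2 * (d * cnormsq (c (m - k)) + cnormsq (c k) / d) /\
  `|Im (cterm nu c m k 0 i)| <= D / 2 * (d * cnormsq (c (m - k)) + cnormsq (c k) / d).
Proof.
move=> hD d0; have [h1 h2] := crossp_amgm (c (m - k)) (c k) i d0.
have D0 : 0 <= D by apply: le_trans hD.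
have RZ (x : R) (z : R[i]) : Re (x%:C * z) = x * Re z by case: z => p q /=; ring.
have IZ (x : R) (z : R[i]) : Im (x%:C * z) = x * Im z by case: z => p q /=; ring.
rewrite /cterm mxE RZ IZ !normrM -!mulrA.
by split; apply: ler_pM => //; rewrite ler_pdivlMl.
Qed.

Section Limit.
Variables (c : int -> cvec3) (D M : R) (m : int).

Definition cbound d k := D / 2 * (d * cnormsq (c (m - k)) + cnormsq (c k) / d).

Lemma symsum_cbound d n : symsum n (cbound d) =
  D / 2 * (d * symsum n (fun k => cnormsq (c (m - k))) + symsum n (fun k => cnormsq (c
    k)) / d).
Proof.
rewrite [X in _ = _ * (_ + X)]mulrC -!symsumZ -symsumD -symsumZ.
by apply: eq_symsum => k _; rewrite /cbound [_ / d]mulrC.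
Qed.

Lemma symsum_cnormsq n : symsum n (fun k => cnormsq (c k)) <= hsum 2^-1 c n.
Proof.
apply: ler_symsum => k _; rewrite -[leLHS]mul1r ler_wpM2r ?cnormsq_ge0 //.
exact: wt_half_ge1.
Qed.

End Limit.

(** The two factors are treated unequally: c (m - k) is only square summable, so its part is made
    small by d, while the part of c k decays like 1 / (K + 1) by the H^{1/2} bound, which beats the
    factor 1 / d. Only D and M enter, so K0 serves every symbol and every sequence at once. *)
Lemma cterm_tail D M m e : 0 <= D -> 0 < e -> exists K0, forall nu c,
  (forall k, `|nu k| <= D) -> forall n K, (K0 <= K <= n)%N ->
  hsum 2^-1 c n <= M -> symsum n (fun k => cnormsq (c (m - k))) <= M -> forall i,
  `|Re (symsum n (cterm nu c m) 0 i) - Re (symsum K (cterm nu c m) 0 i)| <= e /\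
  `|Im (symsum n (cterm nu c m) 0 i) - Im (symsum K (cterm nu c m) 0 i)| <= e.
Proof.
move=> D0 e0.
have [M0|M0] := ltrP M 0.
  (* A negative M contradicts the bound on [hsum]; afterwards M + 1 is positive and may be divided
     by. *)
  exists 0%N => nu c _ n K _ h; have := hsum_ge0 2^-1 c n.
  by move=> h2; have := lt_le_trans (le_lt_trans h M0) h2; rewrite ltxx.
pose d := e / ((D + 1) * (M + 1)).
have D1 : 0 < D + 1 by rewrite ltr_wpDl.
have M1 : 0 < M + 1 by rewrite ltr_wpDl.
have d0 : 0 < d by rewrite divr_gt0 // mulr_gt0.
have de : d * ((D + 1) * (M + 1)) = e by rewrite divfK // gt_eqF // mulr_gt0.
pose K0 := Num.bound (D * M / (d * e)).
exists K0 => nu c nuD n K /andP[K0K Kn] h1 h2 i.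
have hK : D * M / (d * e) < K.+1%:R.
  apply: (@lt_le_trans _ _ K0%:R); last by rewrite ler_nat leqW.
  by apply: archi_boundP; apply: divr_ge0; apply: mulr_ge0 => //; exact: ltW.
have tl : symsum n (cbound c D m d) - symsum K (cbound c D m d) <= e.
  rewrite !symsum_cbound -mulrBr opprD addrACA -mulrBr -mulrBl.
  have t1 : symsum n (fun k => cnormsq (c k)) - symsum K (fun k => cnormsq (c k)) <= M
    / K.+1%:R.
    apply: le_trans (symsum_tail_wt (w := wt 2^-1) Kn _ _) _.
    - by move=> k; exact: cnormsq_ge0.
    - by move=> k; exact: norm_le_wt_half.
    by rewrite ler_pM2r // invr_gt0.
  have t2 : symsum n (fun k => cnormsq (c (m - k))) - symsum K (fun k => cnormsq (c (m
    - k))) <= M.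
    apply: le_trans h2; rewrite gerBl; apply: symsum_ge0 => k; exact: cnormsq_ge0.
  have t3 : d * (symsum n (fun k => cnormsq (c (m - k))) - symsum K (fun k => cnormsq
    (c (m - k))))
     <= d * M by rewrite ler_pM2l.
  have t4 : (symsum n (fun k => cnormsq (c k)) - symsum K (fun k => cnormsq (c k))) / d
     <= M / K.+1%:R / d by rewrite ler_pM2r // invr_gt0.
  apply: (@le_trans _ _ (D / 2 * (d * M + M / K.+1%:R / d))).
    by rewrite ler_wpM2l ?divr_ge0 // lerD.
  have t5 : D * (d * M) <= e.
    rewrite -de mulrCA ler_pM2l //; apply: ler_pM => //; by rewrite lerDl.
  have t6 : D * (M / K.+1%:R / d) <= e.
    have -> : D * (M / K.+1%:R / d) = (D * M / (d * e)) * e / K.+1%:R.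
      by field; rewrite !gt_eqF ?ltr0n //= pnatr_eq0.
    by rewrite ler_pdivrMr ?ltr0n // mulrC ler_pM2l // ltW.
  move: t5 t6; move: (d * M) (M / K.+1%:R / d) => p q t5 t6.
  have -> : D / 2 * (p + q) = (D * p + D * q) / 2 by field.
  lra.
have hRe p : Re (symsum p (cterm nu c m) 0 i) = symsum p (fun k => Re (cterm nu c m k 0
  i)).
  by rewrite symsum_mxE raddf_symsum.
have hIm p : Im (symsum p (cterm nu c m) 0 i) = symsum p (fun k => Im (cterm nu c m k 0
  i)).
  by rewrite symsum_mxE raddf_symsum.
by rewrite !hRe !hIm; split; apply: le_trans tl; apply: symsum_tail_le => // k;
   have [] := cterm_amgm c m i (nuD k) d0.
Qed.

Lemma conv_cvg nu c D M m : (forall k, `|nu k| <= D) -> hbd 2^-1 c M ->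
  (forall n, symsum n (fun k => cnormsq (c (m - k))) <= M) ->
  vcvg (fun n => symsum n (cterm nu c m)) (conv nu c m).
Proof.
move=> nuD c1 c2; have D0 : 0 <= D by apply: le_trans (nuD 0).
have hG n : symsum n (cbound c D m 1) <= D / 2 * (M + M).
  rewrite symsum_cbound ler_wpM2l ?divr_ge0 // mul1r divr1 lerD //.
  by apply: le_trans (symsum_cnormsq _ _) (c1 n).
move=> i; rewrite /conv /vlim mxE; split => /=.
  under eq_fun do rewrite symsum_mxE raddf_symsum.
  apply: (@symsum_cvg _ _ (D / 2 * (M + M))) => n.
  apply: le_trans (hG n); apply: ler_symsum => k _.
  by have [] := cterm_amgm c m i (nuD k) ltr01.
under eq_fun do rewrite symsum_mxE raddf_symsum.
apply: (@symsum_cvg _ _ (D / 2 * (M + M))) => n.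
apply: le_trans (hG n); apply: ler_symsum => k _.
by have [] := cterm_amgm c m i (nuD k) ltr01.
Qed.

Lemma conv_lim (nj : nat -> nat) (c_ : nat -> int -> cvec3) c
    (nu_ : nat -> int -> R) nu D M m :
  (forall K, \forall j \near \oo, (K <= nj j)%N) ->
  (forall k, vcvg (c_ ^~ k) (c k)) ->
  (forall j k, `|nu_ j k| <= D) -> (forall k, nu_ ^~ k @ \oo --> nu k) ->
  (forall j, hsum 2^-1 (c_ j) (nj j) <= M) ->
  (forall j, symsum (nj j) (fun k => cnormsq (c_ j (m - k))) <= M) ->
  [/\ hbd 2^-1 c M, forall n, symsum n (fun k => cnormsq (c (m - k))) <= M &
  vcvg (fun j => symsum (nj j) (cterm (nu_ j) (c_ j) m)) (conv nu c m)].
Proof.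
move=> hn hc hD hnu h1 h2.
have nuD k : `|nu k| <= D.
  by apply: (cvgr_to_le (cvg_norm (hnu k))); near=> j; exact: hD.
have c1 : hbd 2^-1 c M.
  move=> n; have cc : hsum 2^-1 (c_ j) n @[j --> \oo] --> hsum 2^-1 c n.
    by apply: cvg_symsum => k; apply: cvgMr; exact: cvg_cnormsq.
  apply: (cvgr_to_le cc); near=> j; apply: le_trans (h1 j).
  apply: symsum_nd => [k|]; [exact: hterm_ge0 | by near: j; exact: hn].
have c2 n : symsum n (fun k => cnormsq (c (m - k))) <= M.
  have cc : symsum n (fun k => cnormsq (c_ j (m - k))) @[j --> \oo] -->
      symsum n (fun k => cnormsq (c (m - k))).
    by apply: cvg_symsum => k; exact: cvg_cnormsq.
  apply: (cvgr_to_le cc); near=> j; apply: le_trans (h2 j).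
  apply: symsum_nd => [k|]; [exact: cnormsq_ge0 | by near: j; exact: hn].
split => // i.
have cK K : vcvg (fun j => symsum K (cterm (nu_ j) (c_ j) m)) (symsum K (cterm nu c m)).
  apply: vcvg_symsum => k; apply: vcvgZ; first exact: ccvg_real.
  exact: vcvg_cross.
have tl e : 0 < e -> exists K0, forall K, (K0 <= K)%N -> forall j, (K <= nj j)%N ->
  `|Re (symsum (nj j) (cterm (nu_ j) (c_ j) m) 0 i) - Re (symsum K (cterm (nu_ j) (c_
    j) m) 0 i)| <= e /\
  `|Im (symsum (nj j) (cterm (nu_ j) (c_ j) m) 0 i) - Im (symsum K (cterm (nu_ j) (c_
    j) m) 0 i)| <= e.
  have D0 : 0 <= D by apply: le_trans (hD 0%N 0).
  move=> e0; have [K0 hK0] := cterm_tail M m D0 e0; exists K0 => K hK j hj.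
  by apply: hK0 => //; rewrite hK.
have [cv1 cv2] := conv_cvg nuD c1 c2 i.
split.
  apply: (double_lim (x := fun j K => Re (symsum K (cterm (nu_ j) (c_ j) m) 0 i)) _ cv1
    hn).
    by move=> K; have [] := cK K i.
  by move=> e /tl[K0 h]; exists K0 => K hK j hj; have [] := h K hK j hj.
apply: (double_lim (x := fun j K => Im (symsum K (cterm (nu_ j) (c_ j) m) 0 i)) _ cv2 hn).
  by move=> K; have [] := cK K i.
by move=> e /tl[K0 h]; exists K0 => K hK j hj; have [] := h K hK j hj.
Unshelve. all: by end_near. Qed.
End Bilinear.

(** * The lattice *)

Section Expi.
Variable R : realType.
Local Notation C := R[i].
Implicit Types x y : R.

Lemma expiD x y : expi (x + y) = expi x * expi y.
Proof.
by apply/eqP; rewrite eq_complex /= cosD sinD; apply/andP; split; apply/eqP; ring.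
Qed.

Lemma expi0 : expi 0 = 1 :> C.
Proof. by rewrite /expi cos0 sin0. Qed.

Lemma expi_conj x : (expi x)^* = expi (- x).
Proof. by rewrite /expi cosN sinN. Qed.

Lemma expi_mulN x : expi x * expi (- x) = 1.
Proof. by rewrite -expiD subrr expi0. Qed.

Lemma expi_neq0 x : expi x != 0.
Proof. by apply/eqP => h; have /eqP := expi_mulN x; rewrite h mul0r eq_sym oner_eq0. Qed.

Lemma expi_inv x : (expi x)^-1 = expi (- x).
Proof. by apply: (mulfI (expi_neq0 x)); rewrite expi_mulN mulfV // expi_neq0. Qed.

Lemma expi_nat x (k : nat) : expi x ^+ k = expi (k%:R * x).
Proof.
elim: k => [|k IH]; first by rewrite expr0 mul0r expi0.
by rewrite exprS IH -expiD -natr1 mulrDl mul1r addrC.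
Qed.

Lemma expi_int x (k : int) : expi x ^ k = expi (k%:~R * x).
Proof.
case: k => k; first by rewrite -exprnP expi_nat.
by rewrite NegzE -exprnN expi_nat expi_inv mulrNz mulNr.
Qed.

Lemma expi_normsq x : Re (expi x) ^+ 2 + Im (expi x) ^+ 2 = 1.
Proof. by rewrite /= cos2Dsin2. Qed.

Lemma expi_2pi : expi (2 * pi : R) = 1.
Proof. by rewrite mulr_natl /expi cos2pi sin2pi. Qed.

Lemma expi_neq1 x : 0 < x < 2 * pi -> expi x != 1.
Proof.
move=> /andP[x0 x2]; apply/eqP => /(congr1 (@complex.Re _)) /= h.
have : 0 < sin (x / 2).
  by apply: sin_gt0_pi; rewrite divr_gt0 //= ltr_pdivrMr // mulrC.
have : cos x = 1 - (sin (x / 2) ^+ 2) *+ 2.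
  have {1}-> : x = x / 2 + x / 2 by field.
  by rewrite cosD -!expr2 cos2sin2; ring.
rewrite h => h2 h3; have : 0 < sin (x / 2) ^+ 2 by rewrite exprn_gt0.
by move: h2; rewrite mulr2n; lra.
Qed.

End Expi.

Section Nodes.
Variables (R : realType) (n : nat).
Local Notation C := R[i].
Local Notation N := (n.*2.+1).
Local Notation G := 'I_n.*2.+1.

Definition om : C := expi (2 * pi / N%:R).

Lemma N_neq0 : N%:R != 0 :> R. Proof. by rewrite pnatr_eq0. Qed.

Lemma node_om (j : G) : node R j = om ^+ j.
Proof. by rewrite /node /om expi_nat; congr expi; ring. Qed.

Lemma om_N : om ^+ N = 1.
Proof. by rewrite /om expi_nat mulrCA mulfV ?N_neq0 // mulr1 expi_2pi. Qed.

Lemma om_mod k : om ^+ (k %% N) = om ^+ k.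
Proof. exact/expr_mod/om_N. Qed.

Lemma om_neq1 (k : nat) : (0 < k < N)%N -> om ^+ k != 1.
Proof.
move=> /andP[k0 kN]; rewrite /om expi_nat; apply: expi_neq1.
have pi0 := pi_gt0 R; have k0' : 0 < k%:R :> R by rewrite ltr0n.
apply/andP; split; first by rewrite !mulr_gt0 // invr_gt0 ltr0n.
by rewrite mulrCA gtr_pMr ?mulr_gt0 // ltr_pdivrMr ?ltr0n // mul1r ltr_nat.
Qed.

Definition chi (a b : G) : C := om ^+ (a * b).

Lemma chi0 k : chi 0 k = 1. Proof. by rewrite /chi mul0n expr0. Qed.
Lemma chiD a b k : chi (a + b) k = chi a k * chi b k.
Proof. by rewrite /chi /= -exprD -mulnDl -[RHS]om_mod -modnMml om_mod. Qed.
Lemma chiC a b : chi a b = chi b a. Proof. by rewrite /chi mulnC. Qed.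

Lemma chi_conj a k : (chi a k)^* = chi (- a) k.
Proof.
have e : chi a k * chi (- a) k = 1 by rewrite -chiD subrr chi0.
have e2 : chi a k * (chi a k)^* = 1.
  by rewrite /chi /om expi_nat expi_conj expi_mulN.
have h : chi a k != 0.
  by apply/eqP => h0; move/eqP: e; rewrite h0 mul0r eq_sym oner_eq0.
by apply: (mulfI h); rewrite e e2.
Qed.

Lemma chi_conjr a k : (chi a k)^* = chi a (- k).
Proof. by rewrite chiC chi_conj chiC. Qed.

Lemma chi_sum k : \sum_j chi j k = #|G|%:R *+ (k == 0).
Proof.
case: eqP => [->|/eqP k0].
  rewrite (eq_bigr (fun=> 1)) ?sumr_const ?mulr1n ?card_ord // => j _.
  by rewrite chiC chi0.
pose q := om ^+ k.
have -> : \sum_j chi j k = \sum_(j < N) q ^+ j.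
  by apply: eq_bigr => j _; rewrite /chi /q -exprM mulnC.
have q1 : q - 1 != 0.
  by rewrite subr_eq0; apply: om_neq1; rewrite lt0n k0 ltn_ord.
apply: (mulfI q1); rewrite mulr0n mulr0 -subrX1 /q -exprM mulnC exprM om_N.
by rewrite expr1n subrr.
Qed.

Definition zp (k : int) : G := (inZp 1 : G) *~ k.

Lemma zpD a b : zp (a + b) = zp a + zp b. Proof. exact: mulrzDr. Qed.
Lemma zpB a b : zp (a - b) = zp a - zp b. Proof. exact: mulrzBr. Qed.
Lemma zpN a : zp (- a) = - zp a. Proof. exact: mulrNz. Qed.
Lemma zp0 : zp 0 = 0. Proof. exact: mulr0z. Qed.
Lemma zp_nat (m : nat) : zp m%:Z = inZp m.
Proof.
rewrite /zp -pmulrn Zp_mulrn; apply: val_inj => /=.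
by rewrite -modnMml modn_mod modnMml mul1n.
Qed.

Lemma chi_zp j (k : int) : chi j (zp k) = node R j ^ k.
Proof.
have h (m : nat) : chi j (zp m%:Z) = node R j ^+ m.
  by rewrite zp_nat /chi node_om -exprM -om_mod /= modnMmr om_mod.
case: k => m; first by rewrite h.
rewrite NegzE zpN chiC -chi_conj chiC h node_om /om !expi_nat expi_conj.
by rewrite -exprnN expi_nat expi_inv.
Qed.

(** Since N = 2n + 1 is odd, the frequencies -n, ..., n form exactly one full set of residues modulo
    N. This is the bridge between sums over Z / N and symmetric sums over the integers. *)
Lemma symsum_zp (V : nmodType) (F : G -> V) :
  symsum n (fun k => F (zp k)) = \sum_k F k.
Proof.
rewrite [RHS](reindex_inj (@addIr G (- zp n%:Z))) /=.
apply: eq_bigr => j _; rewrite zpB zp_nat; congr (F (_ - _)).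
by apply: val_inj; rewrite /= modn_small.
Qed.

Lemma dft_vhat (f : G -> 'rV[R]_3) k : dft f k = vhat chi f (zp k).
Proof.
apply/rowP => i; rewrite !mxE summxE /hat card_ord; congr (_ * _).
apply: eq_bigr => j _; rewrite !mxE; congr (_ * _).
rewrite chi_zp; case: k => k; first by rewrite -!exprnP rmorphXn.
by rewrite NegzE -!exprnN fmorphV rmorphXn.
Qed.

(** The chord |z_k - z_l| depends on the difference of the indices only, because |z_k| = 1. At r = 0
    the inverse of zero is zero, so the diagonal excluded in [lattice_nabla] is covered by the same
    formula. *)
Definition kap (r : G) : R := 2 / N%:R * (Normc.normc (1 - node R r) ^+ 2)^-1.

Lemma normc_sqr (z : C) : Normc.normc z ^+ 2 = Re z ^+ 2 + Im z ^+ 2.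
Proof. by case: z => a b /=; rewrite sqr_sqrtr // addr_ge0 ?sqr_ge0. Qed.

Lemma kap_even r : kap (- r) = kap r.
Proof.
rewrite /kap !normc_sqr.
suff -> : node R (- r) = (node R r)^*.
  by case: (node R r) => a b; rewrite conjCE /=; congr (_ * _^-1); ring.
by have := chi_conj r (zp 1); rewrite !chi_zp !expr1z => <-.
Qed.

Lemma kap_ge0 r : 0 <= kap r.
Proof. by rewrite mulr_ge0 ?divr_ge0 // invr_ge0 sqr_ge0. Qed.

Lemma lattice_nablaE (f : G -> 'rV[R]_3) k : lattice_nabla f k = vlap kap f k.
Proof.
rewrite /lattice_nabla /vlap scaler_sumr big_mkcond.
rewrite (reindex_inj (@addrI G k)); apply: eq_bigr => r _.
case: eqP => [h|h].
  have -> : r = 0 by move/eqP: h; rewrite -subr_eq0 addrC addKr => /eqP.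
  by rewrite [~~ true]/= addr0 subrr scaler0.
rewrite [~~ false]/= scalerA; congr (_ *: _); rewrite /kap; congr (_ * _^-1).
have -> : node R (k + r) = node R k * node R r.
  by have := chiD k r (zp 1); rewrite !chi_zp !expr1z.
rewrite -{1}(mulr1 (node R k)) -mulrBr Normc.normcM exprMn.
by rewrite (normc_sqr (node R k)) [_ + _ ^+ 2](_ : _ = 1) ?mul1r //; exact: expi_normsq.
Qed.

(** Symbol of the lattice operator as an N-periodic function of an integer: the antisymmetrised
    torque evaluates it at m - k, which may leave the range [-n, n]. *)
Definition lam (k : int) : R := symb chi kap (zp k).

Lemma lamN k : lam (- k) = lam k.
Proof. by rewrite /lam zpN; apply: symb_even; [exact: chi0|exact: chiD|exact:
  chiC|exact: chi_conj]. Qed.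

Lemma lam_ge0 k : 0 <= lam k.
Proof. exact: (symb_ge0 chi0 chiD chi_conj kap_ge0). Qed.

Lemma lam0 : lam 0 = 0.
Proof. by rewrite /lam zp0 /symb big1 // => r _; rewrite chiC chi0 subrr mulr0. Qed.

Lemma lam_add_N k : lam (k + N%:Z) = lam k.
Proof.
rewrite /lam zpD zp_nat (_ : inZp N = 0 :> G) ?addr0 //.
by apply: val_inj; rewrite /= modnn.
Qed.

(** The second difference of 1 - cos(k theta) in k is (2 - 2 cos theta) cos(k theta), and 2 - 2 cos
    theta = |1 - z_r|^2 cancels the kernel exactly. What remains is the sum of a character over r !=
    0, known by orthogonality. *)
Lemma lam_diff2 k : lam (k + 1) - 2 * lam k + lam (k - 1) =
  2 / N%:R * (N%:R *+ (zp k == 0) - 1).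
Proof.
rewrite /lam /symb mulr_sumr -sumrB -big_split /=.
have e : \sum_(r : G) Re (chi r (zp k)) = N%:R *+ (zp k == 0).
  have := congr1 (@complex.Re _) (chi_sum (zp k)); rewrite raddf_sum => ->.
  by case: eqP => _; rewrite ?mulr1n ?mulr0n // card_ord -(rmorph_nat (real_complex R)).
rewrite -e (bigD1 (0 : G)) // [in RHS](bigD1 (0 : G)) //.
rewrite [X in X + _ = _](_ : _ = 0); last by rewrite !chi0 subrr !mulr0 subrr addr0.
rewrite add0r [Re (chi 0 _)](_ : _ = 1) ?chi0 // addrAC subrr add0r.
rewrite mulr_sumr; apply: eq_bigr => r /= r0.
have eD : chi r (zp k + zp 1) = chi r (zp k) * chi r (zp 1).
  by rewrite chiC chiD !(chiC _ r).
have eB : chi r (zp k - zp 1) = chi r (zp k) * (chi r (zp 1))^*.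
  by rewrite chiC chiD -chi_conj !(chiC _ r).
rewrite zpB zpD eD eB !chi_zp expr1z.
have nz : Normc.normc (1 - node R r) ^+ 2 != 0.
  rewrite sqrf_eq0; apply/eqP => /Normc.eq0_normc /eqP; rewrite subr_eq0 eq_sym.
  by rewrite node_om; apply/negP; apply: om_neq1; rewrite lt0n (r0 : r != 0 :> nat)
    ltn_ord.
rewrite /kap; move: nz; rewrite normc_sqr.
have : Re (node R r) ^+ 2 + Im (node R r) ^+ 2 = 1 by exact: expi_normsq.
move: (node R r) (node R r ^ k) => [a b] [p q]; rewrite conjCE /= => h.
have -> : (1 - a) ^+ 2 + (0 - b) ^+ 2 = 2 - 2 * a :> R by move: h; lra.
by move: N_neq0; move: (N%:R : R) => L L0 nz; field; rewrite nz L0.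
Qed.

Lemma zp_eq0 (k : nat) : (0 < k < N)%N -> zp k%:Z != 0.
Proof.
move=> /andP[k0 kN]; rewrite zp_nat; apply/eqP => /(congr1 val) /=.
by rewrite modn_small // => h; move: k0; rewrite h.
Qed.

(** Solution of the recursion [lam_diff2], whose right-hand side is -2 / N for 0 < k < N. The
    initial values are lam 0 = 0 and lam 1 = (N - 1) / N, the latter from the second difference at 0
    and evenness. The induction carries two consecutive values; k = N follows from periodicity. *)
Lemma lamE (k : nat) : (k <= N)%N -> lam k%:Z = k%:R * (N%:R - k%:R) / N%:R.
Proof.
suff H : (k < N)%N -> lam k%:Z = k%:R * (N%:R - k%:R) / N%:R /\
    lam k.+1%:Z = k.+1%:R * (N%:R - k.+1%:R) / N%:R.
  by rewrite leq_eqVlt => /orP[/eqP ->|/H[]//]; rewrite subrr mulr0 mul0r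
    -[X in lam X]add0r lam_add_N lam0.
elim: k => [_|k IH kN].
  split; first by rewrite lam0 !mul0r.
  have := lam_diff2 0; rewrite zp0 eqxx lam0 mulr0 subr0 add0r sub0r lamN mulr1n => h.
  have -> : lam 1 = 2^-1 * (lam 1 + lam 1) by field.
  by rewrite h; move: N_neq0; move: (N%:R) => L L0; field.
have [h1 h2] := IH (ltnW kN); split => //.
have := lam_diff2 k.+1%:Z; rewrite (negPf (zp_eq0 _)) ?ltnS //= ?kN // mulr0n.
have -> : k.+1%:Z + 1 = k.+2%:Z by lia.
have -> : k.+1%:Z - 1 = k%:Z by lia.
rewrite h1 h2 => /(canRL (addrK _)) /(canRL (subrK _)) ->.
rewrite -(natr1 k.+1) -(natr1 k); move: N_neq0; move: (N%:R) => L L0; by field.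
Qed.

Lemma zp_mod k : zp (k %% N%:Z)%Z = zp k.
Proof.
have H q r : zp (q * N%:Z + r) = zp r.
  have zN : zp N%:Z = 0 by rewrite zp_nat; apply: val_inj; rewrite /= modnn.
  have -> : zp (q * N%:Z + r) = zp N%:Z *~ q + zp r.
    by rewrite zpD; congr (_ + _); rewrite /zp -mulrzA mulrC.
  by rewrite zN mul0rz add0r.
by rewrite [in RHS](divz_eq k N%:Z) H.
Qed.

Lemma lam_small k : (`|k| <= n)%N -> `|k%:~R| / 2 <= lam k <= `|k%:~R|.
Proof.
move=> h; have -> : lam k = lam `|k|%N%:Z.
  by case: k h => k h //; rewrite NegzE lamN abszN.
have a0 : `|k%:~R| = `|k|%N%:R :> R by rewrite -intr_norm -abszE.
rewrite lamE; last by rewrite -addnn; lia.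
move: h; rewrite a0; move: `|k|%N => a h.
have hN : 2 * a%:R <= N%:R :> R by rewrite -natrM ler_nat; lia.
have ha : 0 <= a%:R :> R by rewrite ler0n.
have N0 : 0 < N%:R :> R by rewrite ltr0n.
move: hN N0; move: (N%:R : R) (a%:R : R) ha => L x x0 hL L0.
rewrite ler_pdivlMr // ler_pdivrMr //; apply/andP; split; nra.
Qed.

(** At a residue 0 <= r < N the increment is (N - 1 - 2 r) / N by [lamE]. Periodicity carries the
    bound to all integers, including those where the symbol folds back. *)
Lemma lam_lip1 k : `|lam (k + 1) - lam k| <= 1.
Proof.
have N0 : 0 < N%:R :> R by rewrite ltr0n.
have [r rN ek] : exists2 r : nat, (r < N)%N & zp k = zp r%:Z.
  exists `|(k %% N%:Z)%Z|%N; first by rewrite -ltz_nat abszE ger0_norm ?modz_ge0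
    ?ltz_pmod.
  by rewrite abszE ger0_norm ?modz_ge0 // zp_mod.
have -> : lam (k + 1) = lam r.+1%:Z by rewrite /lam zpD ek -zpD -addn1.
have -> : lam k = lam r%:Z by rewrite /lam ek.
rewrite !lamE //; last exact: ltnW.
have hr : r%:R + 1 <= N%:R :> R by rewrite natr1 ler_nat.
have r0 : 0 <= r%:R :> R by rewrite ler0n.
rewrite -natr1 -mulrBl normrM (gtr0_norm (x := _^-1)) ?invr_gt0 //.
rewrite ler_pdivrMr // mul1r; move: hr r0 N0; move: (N%:R : R) (r%:R : R) => L x h1 h2 h3.
by rewrite ler_norml; apply/andP; split; nra.
Qed.

Lemma lam_lip k m : `|lam (k + m) - lam k| <= `|m%:~R|.
Proof.
have H (a : nat) l : `|lam (l + a%:Z) - lam l| <= a%:R.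
  elim: a => [|a IH]; first by rewrite addr0 subrr normr0.
  have -> : lam (l + a.+1%:Z) - lam l = (lam (l + a%:Z + 1) - lam (l + a%:Z)) + (lam (l
    + a%:Z) - lam l).
    by rewrite addrA subrK; congr (lam _ - _); lia.
  by rewrite -natr1; apply: (le_trans (ler_normD _ _)); rewrite [leRHS]addrC lerD //
    lam_lip1.
case: m => a; first by rewrite -pmulrn normr_nat.
rewrite NegzE mulrNz normrN -pmulrn normr_nat distrC.
by have := H a.+1 (k - a.+1%:Z); rewrite subrK.
Qed.

Lemma lam_sym_le k m : `|lam k - lam (m - k)| <= `|m%:~R|.
Proof.
rewrite -(lamN (m - k)) opprB -normrN opprB.
by have := lam_lip k (- m); rewrite mulrNz normrN.
Qed.

Definition rep (a : G) : int := if (a <= n)%N then (a : nat)%:Z else (a : nat)%:Z - N%:Z.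

Lemma zp_rep a : zp (rep a) = a.
Proof.
have h : zp (a : nat)%:Z = a by rewrite zp_nat; apply: val_inj; rewrite /= modn_small.
rewrite /rep; case: ifP => _ //; rewrite zpB h zp_nat (_ : inZp N = 0) ?subr0 //.
by apply: val_inj; rewrite /= modnn.
Qed.

Lemma rep_small a : (`|rep a| <= n)%N.
Proof. by rewrite /rep; have := ltn_ord a; case: ifP => h h2; lia. Qed.

Lemma zp_inj k l : (`|k| <= n)%N -> (`|l| <= n)%N -> zp k = zp l -> k = l.
Proof.
wlog kl : k l / k <= l.
  move=> H hk hl e; have [h|/ltW h] := lerP k l; first exact: H.
  by apply/esym; apply: H.
move=> hk hl e; apply/eqP; rewrite eq_le kl /= leNgt; apply/negP => lt.
have := @zp_eq0 `|l - k|%N; rewrite (_ : `|l - k|%N%:Z = l - k); last by lia.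
by rewrite zpB e subrr eqxx => h; have : false by apply: h; lia.
Qed.

Lemma rep_zp k : (`|k| <= n)%N -> rep (zp k) = k.
Proof. by move=> h; apply: zp_inj; rewrite ?rep_small // zp_rep. Qed.

Lemma repN a : rep (- a) = - rep a.
Proof.
by apply: zp_inj; rewrite ?abszN ?rep_small // zpN !zp_rep.
Qed.

(** The real part only fixes the type: for an even multiplier and real data the sum is real. Such
    multipliers build the dual test field in [torque_hsum_le]. *)
Definition fmult (psi : G -> R) (f : G -> 'rV[R]_3) (j : G) : 'rV[R]_3 :=
  \row_i Re (\sum_k chi j k * (psi k)%:C * hat chi (fun j => f j 0 i) k).

Lemma vhat_fmult psi f k : (forall k, psi (- k) = psi k) ->
  vhat chi (fmult psi f) k = (psi k)%:C *: vhat chi f k.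
Proof.
move=> pe; apply/rowP => i; rewrite !mxE.
pose h := hat chi (fun j => f j 0 i).
have hJ l : (h l)^* = h (- l) by exact: (hat_conj chi0 chiD chiC chi_conj).
pose u j := \sum_k chi j k * (psi k)%:C * h k.
have uJ j : (u j)^* = u j.
  rewrite /u rmorph_sum (reindex_inj oppr_inj) /=; apply: eq_bigr => l _.
  rewrite rmorphM rmorphM /= conj_realC hJ opprK pe; congr (_ * _ * _).
  by rewrite chi_conjr opprK.
have uR j : (Re (u j))%:C = u j.
  have := uJ j; case: (u j) => a b; rewrite conjCE /=.
  move=> /eqP; rewrite eq_complex /= => /andP[_ /eqP e]; apply/eqP.
  by rewrite eq_complex /= eqxx /=; apply/eqP; lra.
have Nn0 : (#|G|%:R : C) != 0 by rewrite pnatr_eq0 card_ord.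
rewrite /hat.
under eq_bigr => j _ do rewrite mxE uR mulr_sumr.
rewrite exchange_big (bigD1 k) //= [X in _ * (_ + X)]big1; last first.
  move=> l lk; rewrite (eq_bigr (fun j => (psi l)%:C * h l * chi j (l - k))).
    by rewrite -mulr_sumr chi_sum subr_eq0 (negPf lk) mulr0n mulr0.
  move=> j _; rewrite chi_conj [chi j (l - k)]chiC chiD [chi (- k) j]chiC.
  have -> : chi j (- k) = chi (- j) k.
    by rewrite -chi_conjr chi_conj.
  by rewrite (chiC l); ring.
rewrite addr0 (eq_bigr (fun=> (psi k)%:C * h k)) => [|j _].
  by rewrite sumr_const -[_ *+ #|_|]mulr_natl mulKf // /h /hat.
have e : chi (- j) k * chi j k = 1 by rewrite -chiD addNr chi0.
transitivity (chi (- j) k * chi j k * ((psi k)%:C * h k)); last by rewrite e mul1r.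
by rewrite chi_conj; move: (h k) => z; ring.
Qed.

Section Field.
Variable s : G -> 'rV[R]_3.
Local Notation c := (dft s).

Definition energy : R := N%:R^-1 * \sum_j dotp (s j) (vlap kap s j).

Lemma nrm2E (v : 'rV[C]_3) : nrm2 v = cnormsq v.
Proof. by rewrite cnormsqE. Qed.

Lemma energyE : energy = symsum n (fun k => lam k * cnormsq (c k)).
Proof.
have e := vsymb_energy chi0 chiD chiC chi_conj chi_sum kap_even s.
rewrite /energy -[X in X%:R^-1]card_ord e -symsum_zp; apply: eq_symsum => k _.
by rewrite dft_vhat nrm2E.
Qed.

Lemma dft_neg k : dft s (- k) = map_mx Num.conj (dft s k).
Proof.
apply/rowP => i; rewrite !dft_vhat !mxE zpN.
by rewrite (hat_conj chi0 chiD chiC chi_conj).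
Qed.

Lemma dft_real : real_coefs (dft s).
Proof. by move=> k i; rewrite dft_neg mxE. Qed.

Hypothesis hs : forall j, sphere2 (s j).

(** Parseval for a field of unit vectors. The coefficients are N-periodic, so any window of N
    consecutive frequencies carries the whole mass. *)
Lemma dft_mass m : symsum n (fun k => cnormsq (c (m - k))) = 1.
Proof.
have -> : symsum n (fun k => cnormsq (c (m - k))) =
    \sum_k cnormsq (vhat chi s (zp m - k)).
  rewrite -(symsum_zp (fun k => cnormsq (vhat chi s (zp m - k)))).
  by apply: eq_symsum => k _; rewrite dft_vhat zpB.
rewrite (reindex_inj (inj_comp (addrI (zp m)) oppr_inj)) /=.
have := vhat_parseval chi0 chiD chiC chi_conj chi_sum s s.
rewrite (eq_bigr (fun=> 1)); last by move=> j _; rewrite sphere2_dotp.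
rewrite sumr_const mulVf; last by rewrite pnatr_eq0 card_ord.
move=> ->; apply: eq_bigr => k _.
rewrite subKr -rdot_self /rdot /dotp; congr (Re _).
by apply: eq_bigr => i _; rewrite !mxE.
Qed.

(** (1 + k^2)^{1/2} <= 1 + |k| <= 1 + 2 lam k for |k| <= n: the mass contributes the 1 and the
    energy the rest. *)
Lemma dft_hsum_le : hsum 2^-1 c n <= 1 + 2 * energy.
Proof.
rewrite -[X in X + _](dft_mass 0) energyE -symsumZ.
have -> : symsum n (fun k => cnormsq (c (0 - k))) = symsum n (fun k => cnormsq (c k)).
  rewrite -[RHS]symsumN; apply: eq_symsum => k _; by rewrite sub0r.
rewrite -symsumD; apply: ler_symsum => k hk; rewrite mulrA -{2}(mul1r (cnormsq _))
  -mulrDl.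
rewrite ler_wpM2r ?cnormsq_ge0 // (le_trans (wt_half_le R k)) // lerD2l.
by have /andP[] := lam_small hk; rewrite ler_pdivrMr // mulrC.
Qed.

Lemma energy_le_hsum : energy <= hsum 2^-1 c n.
Proof.
rewrite energyE; apply: ler_symsum => k hk.
rewrite ler_wpM2r ?cnormsq_ge0 // (le_trans _ (norm_le_wt_half R k)) //.
by have /andP[] := lam_small hk.
Qed.

Definition torque (ker : G -> R) : int -> 'rV[C]_3 :=
  dft (fun j => crossp (s j) (vlap ker s j)).

Lemma torqueE ker m : (forall r, ker (- r) = ker r) ->
  torque ker m = symsum n (cterm (fun k => symb chi ker (zp k)) c m).
Proof.
move=> ke; rewrite /torque dft_vhat (vhat_cross chi0 chiD chiC chi_conj chi_sum).
rewrite -symsum_zp; apply: eq_symsum => k _; rewrite /cterm.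
by rewrite (vhat_lap chi0 chiD chi_conj) // crosspZr !dft_vhat zpB.
Qed.

(** Substituting m - k for k exchanges the factors of the cross product and so changes its sign; the
    average of the two expressions carries half the difference of the symbols. *)
Lemma torque_symE ker m : (forall r, ker (- r) = ker r) ->
  torque ker m = symsum n (cterm (fun k =>
     2^-1 * (symb chi ker (zp k) - symb chi ker (zp (m - k)))) c m).
Proof.
move=> ke; pose mu := symb chi ker.
pose v := vhat chi s.
have e1 : torque ker m = \sum_k (mu k)%:C *: crossp (v (zp m - k)) (v k).
  rewrite (torqueE m ke) -(symsum_zp (fun k => (mu k)%:C *: crossp (v (zp m - k)) (v k))).
  by apply: eq_symsum => k _; rewrite /cterm !dft_vhat zpB.
have e2 : torque ker m = - \sum_k (mu (zp m - k))%:C *: crossp (v (zp m - k)) (v k).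
  rewrite e1 (reindex_inj (inj_comp (addrI (zp m)) oppr_inj)) -sumrN /=.
  by apply: eq_bigr => k _; rewrite subKr crosspC scalerN.
have -> : symsum n (cterm (fun k =>
     2^-1 * (symb chi ker (zp k) - symb chi ker (zp (m - k)))) c m) =
   (2^-1)%:C *: \sum_k ((mu k)%:C *: crossp (v (zp m - k)) (v k)
      - (mu (zp m - k))%:C *: crossp (v (zp m - k)) (v k)).
  rewrite scaler_sumr -symsum_zp; apply: eq_symsum => k _; rewrite /cterm.
  by rewrite !dft_vhat zpB -scalerBl scalerA rmorphM rmorphB.
rewrite sumrB -e1 -e2 -mulr2n -[torque _ _ *+ 2]scaler_nat scalerA.
rewrite -(rmorph_nat (real_complex R)) -rmorphM mulVf ?pnatr_eq0 //.
by rewrite rmorph1 scale1r.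
Qed.

(** Duality: the torque is tested against its own image under the multiplier 1 / w. With X its
    squared H^{-1/2} norm, [torque_le] reads 2 X <= X + [energy]: the first term because symb <= lam
    <= |k| <= w, the second because symb <= lam. *)
Lemma torque_hsum_le ker : (forall r, ker (- r) = ker r) -> (forall r, 0 <= ker r) ->
  (forall k, symb chi ker (zp k) <= lam k) ->
  hsum (- 2^-1) (torque ker) n <= energy.
Proof.
move=> ke k0 kl; set X := hsum _ _ _.
pose w a := wt (2^-1 : R) (rep a).
pose g := fun j => crossp (s j) (vlap ker s j).
have w0 a : 0 < w a by exact: wt_gt0.
have psie a : (w (- a))^-1 = (w a)^-1 by rewrite /w repN wt_opp.
have XE : X = \sum_a (w a)^-1 * cnormsq (vhat chi g a).
  rewrite -symsum_zp; apply: eq_symsum => k hk.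
  by rewrite wtN /w rep_zp // /torque dft_vhat.
have mul a : symb chi ker a <= w a.
  rewrite -(zp_rep a); apply: (le_trans (kl _)).
  have /andP[_ h] := lam_small (rep_small a); apply: (le_trans h).
  by rewrite /w zp_rep norm_le_wt_half.
have := torque_le chi0 chiD chiC chi_conj chi_sum ke k0 (fmult (fun a => (w a)^-1) g) hs.
rewrite (vhat_parseval chi0 chiD chiC chi_conj chi_sum).
have -> : \sum_k Re (dotp (vhat chi (fmult (fun a => (w a)^-1) g) k)
    (map_mx Num.conj (vhat chi g k))) = X.
  rewrite XE; apply: eq_bigr => a _; rewrite vhat_fmult //.
  rewrite -rdot_self -rdotZl /rdot /dotp.
  by under eq_bigr do rewrite [X in _ * X]mxE.
have h1 : \sum_k symb chi ker k * nrm2 (vhat chi (fmult (fun a => (w a)^-1) g) k) <= X.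
  rewrite XE; apply: ler_sum => a _; rewrite vhat_fmult // nrm2E cnormsqZ mulrA.
  rewrite ler_wpM2r ?cnormsq_ge0 // exprVn ler_pdivrMr ?exprn_gt0 //.
  by rewrite expr2 mulKf ?gt_eqF.
have h2 : \sum_k symb chi ker k * nrm2 (vhat chi s k) <= energy.
  rewrite energyE -symsum_zp; apply: ler_symsum => k _; rewrite nrm2E dft_vhat.
  by rewrite ler_wpM2r ?cnormsq_ge0.
have X0 : 0 <= X by exact: hsum_ge0.
by rewrite ger0_norm //; lra.
Qed.

End Field.
End Nodes.

(** * The lattice flow *)

Section HalfLine.
Variable R : realType.
Local Notation mu := (@lebesgue_measure R).

(** Two-sided derivative in the interior and right continuity at 0: the form in which the mean value
    theorem and integration by parts on [0, T] take it. *)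
Definition hderiv (f f' : R -> R) : Prop :=
  (forall t : R, 0 < t -> is_derive t (1 : R) f (f' t)) /\ f @ 0^'+ --> f 0.
Definition hcont (f : R -> R) : Prop :=
  (forall t : R, 0 < t -> {for t, continuous f}) /\ f @ 0^'+ --> f 0.

Lemma hderiv_hcont f f' : hderiv f f' -> hcont f.
Proof.
move=> [h1 h2]; split => // t t0; have d := h1 _ t0.
by apply/differentiable_continuous/derivable1_diffP.
Qed.

Lemma hcont_cst c : hcont (fun=> c).
Proof. by split => [t _|]; exact: cvg_cst. Qed.
Lemma hcontD f g : hcont f -> hcont g -> hcont (fun t => f t + g t).
Proof. by move=> [f1 f2] [g1 g2]; split => [t t0|]; [apply: cvgD; [exact: f1|exact:
  g1]|exact: cvgD]. Qed.
Lemma hcontM f g : hcont f -> hcont g -> hcont (fun t => f t * g t).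
Proof. by move=> [f1 f2] [g1 g2]; split => [t t0|]; [apply: cvgM; [exact: f1|exact:
  g1]|exact: cvgM]. Qed.
Lemma hcontN f : hcont f -> hcont (fun t => - f t).
Proof. by move=> [f1 f2]; split => [t t0|]; [apply: cvgN; exact: f1|exact: cvgN]. Qed.
Lemma hcont_sum (I : Type) (r : seq I) (f : I -> R -> R) :
  (forall i, hcont (f i)) -> hcont (fun t => \sum_(i <- r) f i t).
Proof.
move=> h; elim: r => [|a r IH].
  by under eq_fun do rewrite big_nil; exact: hcont_cst.
by under eq_fun do rewrite big_cons; exact: hcontD.
Qed.

Lemma hcont_within f (a b : R) : hcont f -> 0 <= a -> a < b -> {within `[a, b],
  continuous f}.
Proof.
move=> [f1 f2] a0 ab; apply/continuous_within_itvP => //; split.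
- by move=> t; rewrite in_itv /= => /andP[ta _]; apply: f1; exact: le_lt_trans ta.
- move: a0; rewrite le_eqVlt => /predU1P[<-//|a0].
  by apply: cvg_at_right_filter; exact: f1.
- by apply: cvg_at_left_filter; apply: f1; exact: le_lt_trans ab.
Qed.

Lemma hderiv_cst c : hderiv (fun=> c) (fun=> 0).
Proof. by split => [t _|]; [exact: is_derive_cst|exact: cvg_cst]. Qed.
Lemma hderivD f f' g g' : hderiv f f' -> hderiv g g' ->
  hderiv (fun t => f t + g t) (fun t => f' t + g' t).
Proof.
by move=> [f1 f2] [g1 g2]; split => [t t0|]; [apply: is_deriveD; [exact: f1|exact:
  g1]|exact: cvgD].
Qed.
Lemma hderivM f f' g g' : hderiv f f' -> hderiv g g' ->
  hderiv (fun t => f t * g t) (fun t => f t * g' t + g t * f' t).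
Proof.
by move=> [f1 f2] [g1 g2]; split => [t t0|]; [apply: is_deriveM; [exact: f1|exact:
  g1]|exact: cvgM].
Qed.
Lemma hderiv_sum (I : Type) (r : seq I) (f f' : I -> R -> R) :
  (forall i, hderiv (f i) (f' i)) ->
  hderiv (fun t => \sum_(i <- r) f i t) (fun t => \sum_(i <- r) f' i t).
Proof.
move=> h; elim: r => [|a r IH].
  under eq_fun do rewrite big_nil; under [X in hderiv _ X]eq_fun do rewrite big_nil.
  exact: hderiv_cst.
under eq_fun do rewrite big_cons; under [X in hderiv _ X]eq_fun do rewrite big_cons.
exact: hderivD.
Qed.
Lemma eq_hderiv f f' g g' : f =1 g -> f' =1 g' -> hderiv g g' -> hderiv f f'.
Proof. by move=> /funext -> /funext ->. Qed.
Lemma eq_hcont f g : f =1 g -> hcont g -> hcont f.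
Proof. by move=> /funext ->. Qed.
Lemma hderivZ c f f' : hderiv f f' -> hderiv (fun t => c * f t) (fun t => c * f' t).
Proof.
move=> h; have := hderivM (hderiv_cst c) h.
by under [X in hderiv _ X -> _]eq_fun do rewrite mulr0 addr0.
Qed.

Lemma hderiv_MVT f f' (a b : R) : hderiv f f' -> 0 <= a -> a <= b ->
  exists2 t : R, 0 <= t & f b - f a = f' t * (b - a).
Proof.
move=> h a0; rewrite le_eqVlt => /predU1P[<-|ab].
  by exists 0 => //; rewrite !subrr mulr0.
have cf := hcont_within (hderiv_hcont h) a0 ab.
have hd x : x \in `]a, b[ -> is_derive x 1 f (f' x).
  by rewrite in_itv /= => /andP[ax _]; apply: h.1; exact: le_lt_trans ax.
have [t] := @MVT _ f f' a b ab hd cf.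
rewrite in_itv /= => /andP[ta _] e; exists t => //.
by apply: le_trans (ltW ta).
Qed.

Lemma hderiv_lip f f' (L a b : R) : hderiv f f' -> (forall t : R, 0 <= t -> `|f' t| <=
  L) ->
  0 <= a -> 0 <= b -> `|f b - f a| <= L * `|b - a|.
Proof.
move=> h hL; wlog ab : a b / a <= b.
  move=> H a0 b0; case/orP: (le_total a b) => ab; first exact: (H a b).
  by rewrite distrC (distrC b); exact: (H b a).
move=> a0 b0; have [t t0 ->] := hderiv_MVT h a0 ab.
by rewrite normrM ler_wpM2r //; exact: hL.
Qed.

Lemma hderiv_eq0 f f' (t : R) : hderiv f f' -> (forall t : R, 0 <= t -> f' t = 0) ->
  0 <= t -> f t = f 0.
Proof.
move=> h h0 t0; apply/eqP; rewrite -subr_eq0 -normr_le0.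
apply: le_trans (hderiv_lip (L := 0) h _ (lexx 0) t0) _; last by rewrite mul0r.
by move=> s s0; rewrite h0 ?normr0.
Qed.

Lemma halfline_hderiv (u u' : R -> 'rV[R]_3) i : has_derivative_on_halfline u u' ->
  hderiv (fun t => u t 0 i) (fun t => u' t 0 i).
Proof.
move=> h.
have hi (t : R) : 0 <= t -> h^-1 * (u (t + h) 0 i - u t 0 i) @[h --> within [set h | 0
  <= t + h] 0^'] --> u' t 0 i.
  move=> t0; have := h t t0 => /(@cvg_comp _ _ _ _ (fun M : 'rV[R]_3 => M 0 i)).
  move=> /(_ _ (@coord_continuous _ _ _ 0 i (u' t))).
  apply: cvg_trans; apply: near_eq_cvg; apply: nearW => x /=.
  by rewrite !mxE.
split => [t t0|].
  have c : h^-1 *: (((fun t => u t 0 i) \o shift t) (h *: 1) - u t 0 i) @[h --> 0^']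
    --> u' t 0 i.
    have /cvgrPdist_lt c := hi t (ltW t0); apply/cvgrPdist_lt => e e0.
    have := c e e0; rewrite near_withinE => ce; near=> k.
    have kt : 0 <= t + k.
      have : `|k| < t by near: k; apply: dnbhs0_lt.
      by rewrite ltr_norml => /andP[? _]; lra.
    rewrite /= /shift /= [k%:A]mulr1 [k + t]addrC.
    by move: kt; near: k.
  split; first by apply/cvg_ex; exists (u' t 0 i).
  exact: cvg_lim c.
have c0 : h^-1 * (u h 0 i - u 0 0 i) @[h --> 0^'+] --> u' 0 0 i.
  have /cvgrPdist_lt c := hi 0 (lexx _); apply/cvgrPdist_lt => e e0.
  have := c e e0; rewrite near_withinE => ce.
  rewrite near_withinE; move: ce; rewrite near_withinE; apply: filterS => k ce0 k0.
  by have := ce0 (lt0r_neq0 k0); rewrite add0r; apply; rewrite /= add0r; exact: ltW.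
have cz : (h : R) @[h --> 0^'+] --> (0 : R) by apply: cvg_within_filter; exact: cvg_id.
(* Right continuity at 0 is recovered from the one-sided difference quotient: u x is u 0 plus x
   times a convergent quotient. *)
have cc : u 0 0 i + x * (x^-1 * (u x 0 i - u 0 0 i)) @[x --> 0^'+] --> u 0 0 i.
  rewrite -[X in _ --> X]addr0 -[X in _ + X](mul0r (u' 0 0 i)).
  by apply: cvgD; [exact: cvg_cst|exact: cvgM].
apply: cvg_trans cc; apply: near_eq_cvg.
near=> k.
have k0 : k != 0 by apply: lt0r_neq0; near: k; exact: nbhs_right_gt.
by rewrite /= mulVKf // addrC subrK.
Unshelve. all: by end_near. Qed.

Lemma test_function_ibp T eta f f' : 0 < T -> test_function T eta -> hderiv f f' ->
  hcont f' ->
  \int[mu]_(t in itime T) (derive1 eta t * f t) = - \int[mu]_(t in itime T) (eta t * f'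
    t).
Proof.
move=> T0 [sm [a [b [a0 bT hs]]]] hf cf'.
have eta0 t : t <= 0 \/ T <= t -> eta t = 0.
  move=> ht; apply/eqP; case: eqP => // /eqP /hs /andP[h1 h2]; exfalso.
  by case: ht => ht; [have := lt_le_trans a0 h1; rewrite ltNge ht | have := le_lt_trans
    h2 bT; rewrite ltNge ht].
have deta t : derivable eta t 1 by have := sm 0%N t.
have ddeta t : derivable (derive1 eta) t 1 by have := sm 1%N t.
have ceta : continuous eta by move=> t; apply/differentiable_continuous/derivable1_diffP.
have cdeta : continuous (derive1 eta) by move=> t;
  apply/differentiable_continuous/derivable1_diffP.
have W (g : R -> R) : continuous g -> {within `[0, T], continuous g}.
  by move=> cg; exact: continuous_subspaceT.
have oo (g : R -> R) : (forall t : R, 0 < t -> derivable g t 1) -> {within `[0, T],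
  continuous g} ->
    derivable_oo_LRcontinuous g 0 T.
  move=> dg /(continuous_within_itvP _ T0)[_ h1 h2]; split => //.
  by move=> t; rewrite in_itv /= => /andP[t0 _]; exact: dg.
have := @Rintegration_by_parts R eta f (derive1 eta) f' 0 T T0.
have e1 : eta 0 = 0 by apply: eta0; left.
have e2 : eta T = 0 by apply: eta0; right.
rewrite e1 e2.
rewrite !mul0r subrr sub0r /itime => ->; first by rewrite opprK.
- exact: W.
- apply: oo; last exact: W.
  by move=> t _.
- by [].
- exact: hcont_within.
- apply: oo; last exact: hcont_within (hderiv_hcont hf) _ _.
  by move=> t t0; have [] := hf.1 t t0.
- move=> t; rewrite in_itv /= => /andP[t0 _].
  by rewrite derive1E; have [_ ->] := hf.1 t t0.
Qed.

End HalfLine.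

Section LatticeFlow.
Variables (R : realType) (n : nat).
Local Notation G := 'I_n.*2.+1.
Local Notation C := R[i].
Variables (s0 : G -> 'rV[R]_3) (s : R -> G -> 'rV[R]_3).
Hypothesis sol : lattice_solution s0 s.

Definition velocity t (k : G) : 'rV[R]_3 := crossp (s t k) (vlap (@kap R n) (s t) k).

Lemma flow_sphere t k : 0 <= t -> sphere2 (s t k).
Proof. by have [h _ _] := sol; exact: h. Qed.

Lemma flow_init : s 0 = s0.
Proof. by have [_ _ h] := sol; apply/funext => k; exact: h. Qed.

Lemma flow_hderiv k i : hderiv (fun t => s t k 0 i) (fun t => velocity t k 0 i).
Proof.
have [_ h _] := sol; have := halfline_hderiv i (h k).
by under [X in hderiv _ X -> _]eq_fun do rewrite lattice_nablaE.
Qed.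

Lemma flow_hcont k i : hcont (fun t => s t k 0 i).
Proof. exact: hderiv_hcont (flow_hderiv k i). Qed.

Lemma vlap_hcont k i : hcont (fun t => vlap (@kap R n) (s t) k 0 i).
Proof.
under eq_fun do rewrite vlapE /lap.
apply: hcont_sum => r; apply: hcontM; first exact: hcont_cst.
by apply: hcontD; [|apply: hcontN]; exact: flow_hcont.
Qed.

Lemma velocity_hcont k i : hcont (fun t => velocity t k 0 i).
Proof.
under eq_fun do rewrite mxE.
by apply: hcontD; [|apply: hcontN]; apply: hcontM; (exact: flow_hcont || exact:
  vlap_hcont).
Qed.

Lemma dft_ReE (f : G -> 'rV[R]_3) k i : Re (dft f k 0 i) =
  \sum_j Re ((n.*2.+1%:R)^-1 * (node R j)^* ^ k) * f j 0 i.
Proof.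
have RM (x : R) (z : C) : Re (z * x%:C) = Re z * x by case: z => p q /=; ring.
rewrite mxE summxE mulr_sumr raddf_sum; apply: eq_bigr => j _ /=.
by rewrite !mxE mulrA -RM.
Qed.

Lemma dft_ImE (f : G -> 'rV[R]_3) k i : Im (dft f k 0 i) =
  \sum_j Im ((n.*2.+1%:R)^-1 * (node R j)^* ^ k) * f j 0 i.
Proof.
have IM (x : R) (z : C) : Im (z * x%:C) = Im z * x by case: z => p q /=; ring.
rewrite mxE summxE mulr_sumr raddf_sum; apply: eq_bigr => j _ /=.
by rewrite !mxE mulrA -IM.
Qed.

Lemma dft_hderiv k i :
  hderiv (fun t => Re (dft (s t) k 0 i)) (fun t => Re (dft (velocity t) k 0 i)) /\
  hderiv (fun t => Im (dft (s t) k 0 i)) (fun t => Im (dft (velocity t) k 0 i)).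
Proof.
split.
  apply: (eq_hderiv (fun t => dft_ReE (s t) k i) (fun t => dft_ReE (velocity t) k i)).
  by apply: hderiv_sum => j; exact/hderivZ/flow_hderiv.
apply: (eq_hderiv (fun t => dft_ImE (s t) k i) (fun t => dft_ImE (velocity t) k i)).
by apply: hderiv_sum => j; exact/hderivZ/flow_hderiv.
Qed.

Lemma dft_velocity_hcont k i :
  hcont (fun t => Re (dft (velocity t) k 0 i)) /\ hcont (fun t => Im (dft (velocity t)
    k 0 i)).
Proof.
split.
  apply: (eq_hcont (fun t => dft_ReE (velocity t) k i)).
  by apply: hcont_sum => j; apply: hcontM; [exact: hcont_cst|exact: velocity_hcont].
apply: (eq_hcont (fun t => dft_ImE (velocity t) k i)).
by apply: hcont_sum => j; apply: hcontM; [exact: hcont_cst|exact: velocity_hcont].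
Qed.

(** By symmetry of the operator the derivative of the energy is twice the mean of the velocity
    against |nabla|_N s, and the velocity s x |nabla|_N s is orthogonal to its second factor. *)
Lemma flow_energy t : 0 <= t -> energy (s t) = energy s0.
Proof.
move=> t0; rewrite -flow_init.
have hl k i : hderiv (fun t => vlap (@kap R n) (s t) k 0 i)
    (fun t => vlap (@kap R n) (velocity t) k 0 i).
  under eq_fun do rewrite vlapE /lap; under [X in hderiv _ X]eq_fun do rewrite vlapE /lap.
  apply: hderiv_sum => r; apply: hderivZ; apply: hderivD; first exact: flow_hderiv.
  have := hderivZ (-1) (flow_hderiv (k + r) i).
  under eq_fun do rewrite mulN1r; by under [X in hderiv _ X]eq_fun do rewrite mulN1r.
pose e' t := n.*2.+1%:R^-1 * \sum_(k : G) \sum_(i < 3)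
  (s t k 0 i * vlap (@kap R n) (velocity t) k 0 i + vlap (@kap R n) (s t) k 0 i *
    velocity t k 0 i).
have he : hderiv (fun t => energy (s t)) e'.
  rewrite /energy /dotp; apply: hderivZ; apply: hderiv_sum => k; apply: hderiv_sum => i.
  by apply: hderivM; [exact: flow_hderiv|exact: hl].
apply: (hderiv_eq0 he) => // {t t0} t t0; rewrite /e'.
under eq_bigr do rewrite big_split /=.
rewrite big_split /= -/(dotp _ _).
have -> : \sum_(k : G) \sum_(i < 3) s t k 0 i * vlap (@kap R n) (velocity t) k 0 i =
   \sum_k dotp (velocity t k) (vlap (@kap R n) (s t) k).
  exact: (vlap_sym (@kap_even R n)).
have z k : dotp (velocity t k) (vlap (@kap R n) (s t) k) = 0 by exact: dotp_cross_self.
rewrite big1 => [|k _]; last exact: z.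
rewrite add0r big1 ?mulr0 // => k _.
by rewrite -[RHS](z k) dotpC.
Qed.

End LatticeFlow.

(** * Convergence of the lattice symbols and of their Yosida approximations *)

Section LamLimit.
Variable R : realType.

Lemma lam_abs n k : @lam R n k = @lam R n `|k|%N%:Z.
Proof. by case: k => k //; rewrite NegzE lamN abszN. Qed.

(** By [lamE] the gap |k| - lam k equals k^2 / N as soon as |k| <= n. *)
Lemma cvg_lam (nj : nat -> nat) k : (forall K, \forall j \near \oo, (K <= nj j)%N) ->
  @lam R (nj j) k @[j --> \oo] --> `|k%:~R : R|.
Proof.
move=> hn; apply/cvgrPdist_le => e e0.
pose K := maxn `|k| (Num.bound (`|k%:~R| ^+ 2 / e)).
near=> j; have hK : (K <= nj j)%N by near: j; exact: hn.
have k1 : (`|k| <= nj j)%N by apply: leq_trans hK; exact: leq_maxl.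
have k2 : `|k%:~R| ^+ 2 / e <= (nj j).*2.+1%:R :> R.
  apply: (@le_trans _ _ (Num.bound (`|k%:~R : R| ^+ 2 / e))%:R).
    by apply/ltW/archi_boundP; rewrite divr_ge0 ?sqr_ge0 // ltW.
  rewrite ler_nat; apply: (leq_trans (leq_trans (leq_maxr _ _) hK)).
  by rewrite -addnn; lia.
rewrite lam_abs; have a0 : `|k%:~R| = `|k|%N%:R :> R by rewrite -intr_norm -abszE.
rewrite lamE; last by rewrite -addnn; lia.
rewrite a0 in k2 *; have N0 : 0 < (nj j).*2.+1%:R :> R by rewrite ltr0n.
have -> : `|k|%N%:R - `|k|%N%:R * ((nj j).*2.+1%:R - `|k|%N%:R) / (nj j).*2.+1%:R =
    `|k|%N%:R ^+ 2 / (nj j).*2.+1%:R :> R by field; rewrite gt_eqF.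
rewrite ger0_norm ?divr_ge0 ?sqr_ge0 // ler_pdivrMr // mulrC.
by move: k2; rewrite ler_pdivrMr.
Unshelve. all: by end_near. Qed.

Definition yos (B x : R) : R := B * x / (B + x).

Lemma yos_ge0 (B x : R) : 0 < B -> 0 <= x -> 0 <= yos B x.
Proof. by move=> B0 x0; rewrite divr_ge0 ?mulr_ge0 ?addr_ge0 // ltW. Qed.

Lemma yos_le (B x : R) : 0 < B -> 0 <= x -> yos B x <= x /\ yos B x <= B.
Proof.
move=> B0 x0; have d : 0 < B + x by rewrite ltr_pwDl.
by rewrite /yos !ler_pdivrMr //; split; nra.
Qed.

(** The difference quotient is the product of B / (B + x) and B / (B + y), both at most 1.
    Consequently the regularised symbols at k and m - k differ by at most |m| for every B. *)
Lemma yos_lip (B x y : R) : 0 < B -> 0 <= x -> 0 <= y -> `|yos B x - yos B y| <= `|x - y|.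
Proof.
move=> B0 x0 y0; have dx : 0 < B + x by rewrite ltr_pwDl.
have dy : 0 < B + y by rewrite ltr_pwDl.
have -> : yos B x - yos B y = (B / (B + x)) * (B / (B + y)) * (x - y).
  by rewrite /yos; field; rewrite !gt_eqF.
have H z : 0 <= z -> 0 < B + z -> 0 <= B / (B + z) <= 1.
  by move=> z0 dz; rewrite divr_ge0 ?(ltW B0) ?(ltW dz) //= ler_pdivrMr // mul1r lerDl.
have /andP[x1 x2] := H _ x0 dx; have /andP[y1 y2] := H _ y0 dy.
rewrite normrM -[leRHS]mul1r ler_wpM2r // ger0_norm; [exact: mulr_ile1|exact: mulr_ge0].
Qed.

Lemma cvg_yos (B : R) (x_ : nat -> R) (x : R) : 0 < B -> 0 <= x -> x_ @ \oo --> x ->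
  yos B (x_ j) @[j --> \oo] --> yos B x.
Proof.
move=> B0 x0 h; apply: cvgM; first exact: cvgMr.
apply: cvgV; first by rewrite gt_eqF // ltr_pwDl.
by apply: cvgD => //; exact: cvg_cst.
Qed.

Lemma cvg_yos_infty (x : R) : 0 <= x -> yos p.+1%:R x @[p --> \oo] --> x.
Proof.
move=> x0; apply/cvgrPdist_le => e e0; near=> p.
have P0 : 0 < p.+1%:R :> R by rewrite ltr0n.
have dx : 0 < p.+1%:R + x by rewrite ltr_pwDl.
have -> : x - yos p.+1%:R x = x ^+ 2 / (p.+1%:R + x).
  by rewrite /yos; move: dx; move: (p.+1%:R : R) => P dx; field; rewrite gt_eqF.
rewrite ger0_norm ?divr_ge0 ?sqr_ge0 ?(ltW dx) // ler_pdivrMr //.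
have : x ^+ 2 / e <= p.+1%:R.
  apply: (@le_trans _ _ (Num.bound (x ^+ 2 / e))%:R).
    by apply/ltW/archi_boundP; rewrite divr_ge0 ?sqr_ge0 // ltW.
  by rewrite ler_nat; apply: leqW; near: p; exact: nbhs_infty_ge.
rewrite ler_pdivrMr // => h; nra.
Unshelve. all: by end_near. Qed.

End LamLimit.

(** * Compactness in time *)

Section Compactness.
Variable R : realType.

(* A cluster point in a product of segments replaces the diagonal argument:
   it is approached, infinitely often, simultaneously on a grid of times and on
   the first few components. *)
Lemma lipschitz_subsequence (f : nat -> nat -> R -> R) (C L : nat -> R) (T : R) :
  0 < T -> (forall n m t, `|f n m t| <= C m) ->
  (forall n m s t, `|f n m t - f n m s| <= L m * `|t - s|) ->
  exists (sigma : nat -> nat) (F : nat -> R -> R),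
    [/\ {homo sigma : i j / (i < j)%N},
     forall m s t, `|F m t - F m s| <= L m * `|t - s| &
     forall m e, 0 < e -> exists J, forall j, (J <= j)%N -> forall t, 0 <= t <= T ->
       `|f (sigma j) m t - F m t| <= e].
Proof.
move=> T0 hC hL.
pose P := @prod_topology (nat * R)%type (fun=> (R : topologicalType)).
pose g n : P := fun i : nat * R => f n i.1 i.2.
pose A := [set h : P | forall i, `[- C i.1, C i.1]%classic (h i)].
have cA : compact A.
  apply: (@tychonoff _ (fun=> R) (fun i : nat * R => `[- C i.1, C i.1]%classic)) => i.
  exact: segment_compact.
have [F [_ cF]] : A `&` cluster (g n @[n --> \oo]) !=set0.
  apply: cA; exists 0%N => // n _ i /=; rewrite in_itv /= -ler_norml; exact: hC.
have near1 i (e : R) : 0 < e -> nbhs F [set h : P | `|h i - F i| < e].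
  move=> e0; have nb : nbhs (F i : R) (ball (F i : R) e) by exact: nbhsx_ballx.
  have h0 : nbhs F [set h : P | ball (F i : R) e (h i)].
    exact: (@proj_continuous _ (fun=> R) i F _ nb).
  apply: (@filterS P (nbhs F) _ [set h : P | ball (F i : R) e (h i)]) => // h.
  by rewrite /= -ball_normE /= distrC.
have meet m0 (B : set P) : nbhs F B ->
    exists2 n, (m0 < n)%N & B (g n).
  move=> hB; have := cF (g @` [set n | (m0 < n)%N]) B.
  case=> //.
    by exists m0.+1 => // n /= hn; exists n.
  by move=> _ [[n hn <-] Bn]; exists n.
(* Grid of step T / (j + 1); the index type ['I_j.+2] includes both end points 0 and T. At stage j
   the components m <= j are matched with F on this grid up to 1 / (j + 1). *)
pose tq j q : R := T * q%:R / j.+1%:R.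
have pickE j m0 : exists n, (m0 < n)%N /\
    forall (m : 'I_j.+1) (q : 'I_j.+2), `|f n m (tq j q) - F (m : nat, tq j q)| <
      j.+1%:R^-1.
  have [|n h1 h2] := meet m0 [set h : P | forall (m : 'I_j.+1) (q : 'I_j.+2),
       `|h (m : nat, tq j q) - F (m : nat, tq j q)| < j.+1%:R^-1].
    have PF : Filter (nbhs F) by exact: nbhs_filter.
    have all n (Q : 'I_n -> set P) : (forall q, nbhs F (Q q)) -> nbhs F [set h | forall
      q, Q q h].
      by move=> hQ; exact: (@filter_forall P _ Q (nbhs F) PF hQ).
    apply: (all _ (fun (m : 'I_j.+1) => [set h : P | forall q : 'I_j.+2,
       `|h (m : nat, tq j q) - F (m : nat, tq j q)| < j.+1%:R^-1])) => m.
    apply: (all _ (fun (q : 'I_j.+2) => [set h : P |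
       `|h (m : nat, tq j q) - F (m : nat, tq j q)| < j.+1%:R^-1])) => q.
    apply: (near1 (m : nat, tq j q)).
    by rewrite invr_gt0 ltr0n.
  by exists n.
have [pick hpick] : {p : nat -> nat -> nat | forall j m0, (m0 < p j m0)%N /\
    forall (m : 'I_j.+1) (q : 'I_j.+2), `|f (p j m0) m (tq j q) - F (m : nat, tq j q)|
      < j.+1%:R^-1}.
  pose p j m0 := xget 0%N [set n | (m0 < n)%N /\
    forall (m : 'I_j.+1) (q : 'I_j.+2), `|f n m (tq j q) - F (m : nat, tq j q)| <
      j.+1%:R^-1].
  exists p => j m0; exact: (@xgetPex _ 0%N _ (pickE j m0)).
(* Each pick starts beyond the previous index, which makes the subsequence strictly increasing. *)
pose sigma := fix s j := if j is j'.+1 then pick j'.+1 (s j') else pick 0%N 0%N.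
have sE j : exists m0, sigma j = pick j m0 by case: j => [|j]; [exists 0%N|exists
  (sigma j)].
have FL m s t : `|F (m, t) - F (m, s)| <= L m * `|t - s|.
  apply/ler_addgt0Pr => e e0; have e2 : 0 < e / 2 by rewrite divr_gt0.
  have [|n _ /= [h1 h2]] := meet 0%N [set h : P | `|h (m, t) - F (m, t)| < e / 2 /\ `|h
    (m, s) - F (m, s)| < e / 2].
    by apply: filterI; exact: near1.
  have := hL n m s t; move: h1 h2; rewrite /g /= => h1 h2 h3.
  have -> : F (m, t) - F (m, s) = (f n m t - f n m s) - (f n m t - F (m, t)) + (f n m s
    - F (m, s)) by ring.
  apply: (le_trans (ler_normD _ _)).
  have := ler_normB (f n m t - f n m s) (f n m t - F (m, t)); lra.
exists sigma, (fun m t => F (m, t)); split => //.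
  apply: homo_ltn; first exact: ltn_trans.
  by move=> j; have [] := hpick j.+1 (sigma j).
move=> m e e0.
(* A time t is within T / (j + 1) of the grid point on its left, so the total error is at most 2 |L
   m| T / (j + 1) + 1 / (j + 1); m <= J puts component m among those matched at stage j. *)
pose J := maxn m (Num.bound ((2 * `|L m| * T + 1) / e)).
exists J => j Jj t /andP[t0 tT].
have j0 : 0 < j.+1%:R :> R by rewrite ltr0n.
have [m0 ->] := sE j; have [_ hp] := hpick j m0.
have mj : (m < j.+1)%N by rewrite ltnS; apply: leq_trans Jj; exact: leq_maxl.
have x0 : 0 <= t * j.+1%:R / T by rewrite divr_ge0 ?mulr_ge0 // ltW.
pose q := Num.truncn (t * j.+1%:R / T).
have /andP[q1 q2] : q%:R <= t * j.+1%:R / T < q.+1%:R by exact: truncn_itv.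
have qj : (q < j.+2)%N.
  rewrite ltnS -(@ler_nat R); apply: (le_trans q1); rewrite ler_pdivrMr // mulrC.
  by rewrite ler_pM2l.
have := hp (Ordinal mj) (Ordinal qj); rewrite /=; set u := tq j q => hu.
have ut : `|t - u| <= T / j.+1%:R.
  have -> : t - u = (t * j.+1%:R - T * q%:R) / j.+1%:R.
    by rewrite /u /tq; move: j0; move: (j.+1%:R : R) => p1 j0; field; rewrite gt_eqF.
  move: q1 q2; rewrite ler_pdivlMr // ltr_pdivrMr // => q1 q2.
  have q3 : t * j.+1%:R < T * q%:R + T.
    by apply: (lt_le_trans q2); rewrite -natr1 mulrDl mulrC mul1r.
  rewrite mulrC in q1.
  rewrite normrM (@gtr0_norm _ (_^-1)) ?invr_gt0 // ler_pM2r ?invr_gt0 //.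
  by rewrite ger0_norm ?subr_ge0 //; lra.
have hb : (2 * `|L m| * T + 1) / j.+1%:R <= e.
  rewrite ler_pdivrMr // [leRHS]mulrC -ler_pdivrMr //.
  apply: (@le_trans _ _ (Num.bound ((2 * `|L m| * T + 1) / e))%:R).
    by apply/ltW/archi_boundP; rewrite divr_ge0 ?(ltW e0) // addr_ge0 ?mulr_ge0 ?(ltW T0).
  by rewrite ler_nat; apply: leqW; apply: leq_trans Jj; exact: leq_maxr.
have h1 : `|f (pick j m0) m t - f (pick j m0) m u| <= `|L m| * (T / j.+1%:R).
  apply: (le_trans (hL _ _ _ _)); apply: (@le_trans _ _ (`|L m| * `|t - u|)).
    by rewrite ler_wpM2r // ler_norm.
  by rewrite ler_wpM2l.
have h2 : `|F (m, t) - F (m, u)| <= `|L m| * (T / j.+1%:R).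
  apply: (le_trans (FL _ _ _)); apply: (@le_trans _ _ (`|L m| * `|t - u|)).
    by rewrite ler_wpM2r // ler_norm.
  by rewrite ler_wpM2l.
have E : (2 * `|L m| * T + 1) / j.+1%:R = 2 * (`|L m| * (T / j.+1%:R)) + j.+1%:R^-1.
  by rewrite mulrDl mul1r -!mulrA.
rewrite E in hb.
have -> : f (pick j m0) m t - F (m, t) = (f (pick j m0) m t - f (pick j m0) m u)
   + (f (pick j m0) m u - F (m, u)) - (F (m, t) - F (m, u)) by ring.
apply: (le_trans (ler_normB _ _)).
have := ler_normD (f (pick j m0) m t - f (pick j m0) m u) (f (pick j m0) m u - F (m, u)).
have aux (a b c d X r e' : R) : a <= X -> b <= X -> 2 * X + r <= e' -> c < r -> d <= a
  + c ->
    d + b <= e' by lra.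
exact: aux h1 h2 hb hu.
Qed.

End Compactness.

(** * Fourier analysis on the circle *)

Section Circle.
Variable R : realType.
Local Notation mu := (@lebesgue_measure R).
Local Notation circ := (@circle R).
Local Notation C := R[i].
Implicit Types (f g h : R -> R) (a : int -> C).

Lemma twopi_gt0 : 0 < 2 * pi :> R.
Proof. by rewrite mulr_gt0 // pi_gt0. Qed.

Lemma circle_measurable : measurable (circ : set (measurableTypeR R)).
Proof. exact: measurable_itv. Qed.
Hint Resolve circle_measurable : core.

Lemma circle_mass : mu circ = (2 * pi)%:E.
Proof. by rewrite /circle lebesgue_measure_itv /= lte_fin twopi_gt0 oppr0 adde0. Qed.

Definition circ_int f : Prop := mu.-integrable circ (EFin \o f).

Lemma circ_int_cont f : continuous f -> circ_int f.
Proof.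
by move=> cf; apply: continuous_compact_integrable; [exact: segment_compact|exact:
  continuous_subspaceT].
Qed.

Lemma circ_intD f g : circ_int f -> circ_int g -> circ_int (fun x => f x + g x).
Proof. by move=> hf hg; have := integrableD circle_measurable hf hg. Qed.

Lemma circ_intZ (c : R) f : circ_int f -> circ_int (fun x => c * f x).
Proof. by move=> hf; have := integrableZl circle_measurable c hf. Qed.

Lemma circ_int_le f g : measurable_fun circ f -> circ_int g ->
  (forall x, `|f x| <= g x) -> circ_int f.
Proof.
move=> mf hg h; apply: (le_integrable circle_measurable _ _ hg).
  exact/measurable_EFinP.
by move=> x _ /=; rewrite lee_fin; apply: (le_trans (h x)); exact: ler_norm.
Qed.

Lemma circ_int_sum (I : Type) (r : seq I) (f_ : I -> R -> R) :
  (forall i, circ_int (f_ i)) -> circ_int (fun x => \sum_(i <- r) f_ i x).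
Proof.
move=> hf; elim: r => [|i r IH].
  by apply: circ_int_cont => x; rewrite (_ : (fun x => _) = fun=> 0); [exact:
    cvg_cst|apply/funext => y; rewrite big_nil].
have := circ_intD (hf i) IH; congr circ_int; apply/funext => x; by rewrite big_cons.
Qed.

Lemma circ_int_of_sum (I : Type) (r : seq I) (f_ : I -> R -> R) :
  (forall i, circ_int (f_ i)) ->
  \int[mu]_(x in circ) (\sum_(i <- r) f_ i x) = \sum_(i <- r) \int[mu]_(x in circ) f_ i x.
Proof.
move=> hf; elim: r => [|i r IH].
  rewrite big_nil (_ : (fun x => _) = fun=> 0); last by apply/funext => y; rewrite
    big_nil.
  by rewrite Rintegral_cst // mul0r.
rewrite big_cons -IH -RintegralD //; [|exact: hf|exact: circ_int_sum].
by apply: eq_Rintegral => x _; rewrite big_cons.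
Qed.

Lemma circ_int_of_symsum n (f_ : int -> R -> R) : (forall i, circ_int (f_ i)) ->
  \int[mu]_(x in circ) (symsum n (f_ ^~ x)) = symsum n (fun k => \int[mu]_(x in circ)
    f_ k x).
Proof.
move=> hf; rewrite symsumE -circ_int_of_sum //.
by apply: eq_Rintegral => x _; rewrite symsumE.
Qed.

Lemma circ_FTC (F f : R -> R) :
  (forall x : R, 0 <= x <= 2 * pi -> is_derive x (1 : R) F (f x)) ->
  continuous f -> \int[mu]_(x in circ) f x = F (2 * pi) - F 0.
Proof.
move=> dF cf; have dd (x : R) : 0 <= x <= 2 * pi -> derivable F x 1 by move=> /dF [].
have cF (x : R) : 0 <= x <= 2 * pi -> {for x, continuous F}.
  by move=> /dd h; apply: differentiable_continuous; apply/derivable1_diffP.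
have p0 := ltW twopi_gt0.
rewrite /Rintegral (@continuous_FTC2 _ f F 0 (2 * pi)) ?twopi_gt0 //.
- exact: continuous_subspaceT.
- split=> [x||].
  + by rewrite in_itv /= => /andP[/ltW h1 /ltW h2]; apply: dd; rewrite h1 h2.
  + by apply: cvg_at_right_filter; apply: cF; rewrite lexx p0.
  + by apply: cvg_at_left_filter; apply: cF; rewrite lexx p0.
- by move=> x; rewrite in_itv /= => /andP[/ltW h1 /ltW h2]; rewrite derive1E;
     have [] := dF x _; rewrite ?h1 ?h2.
Qed.

(** [ec] and [es] are the real and imaginary parts of e^{-ikx}, thus cos(k x) and - sin(k x). They
    reduce complex Fourier integrals to real ones. *)
Definition ec (k : int) (x : R) : R := Re (expi x ^ (- k)).
Definition es (k : int) (x : R) : R := Im (expi x ^ (- k)).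

Lemma ecE k x : ec k x = cos (k%:~R * x).
Proof. by rewrite /ec expi_int mulrNz mulNr /= cosN. Qed.

Lemma esE k x : es k x = - sin (k%:~R * x).
Proof. by rewrite /es expi_int mulrNz mulNr /= sinN. Qed.

Lemma lin_derive (k x : R) : is_derive x (1 : R) (fun y => k * y) k.
Proof.
have := @is_deriveZ R R R id k x 1 1 _; rewrite /GRing.scale /= mulr1; exact.
Qed.

Lemma ec_derive k x : is_derive x (1 : R) (ec k) (k%:~R * es k x).
Proof.
have -> : ec k = cos \o (fun y => k%:~R * y) by apply/funext => y; rewrite ecE.
have -> : k%:~R * es k x = - sin (k%:~R * x) * k%:~R by rewrite esE mulrC.
by apply: is_derive1_comp; exact: lin_derive.
Qed.

Lemma es_derive k x : is_derive x (1 : R) (es k) (- k%:~R * ec k x).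
Proof.
have -> : es k = (fun y => - (sin \o (fun y => k%:~R * y)) y) by apply/funext => y;
  rewrite esE.
have -> : - k%:~R * ec k x = - (cos (k%:~R * x) * k%:~R) by rewrite ecE mulrC mulrN.
by apply: is_deriveN; apply: is_derive1_comp; exact: lin_derive.
Qed.

Lemma is_derive_continuous f f' : (forall x : R, is_derive x (1 : R) f (f' x)) ->
  continuous f.
Proof.
move=> df x; apply: differentiable_continuous; apply/derivable1_diffP; by have [] := df x.
Qed.

Lemma ec_cont k : continuous (ec k).
Proof. exact: is_derive_continuous (ec_derive k). Qed.

Lemma es_cont k : continuous (es k).
Proof. exact: is_derive_continuous (es_derive k). Qed.

Lemma ec_le1 k x : `|ec k x| <= 1.
Proof. by rewrite ecE ler_norml cos_geN1 cos_le1. Qed.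

Lemma es_le1 k x : `|es k x| <= 1.
Proof. by rewrite esE normrN ler_norml sin_geN1 sin_le1. Qed.

Lemma int_ec k : \int[mu]_(x in circ) ec k x = (2 * pi) *+ (k == 0).
Proof.
have [->|k0] := eqVneq k 0.
  rewrite (_ : (fun x => _) = fun=> 1); last by apply/funext => x; rewrite ecE mul0r cos0.
  by rewrite Rintegral_cst // [X in fine X]circle_mass mul1r.
have kR : k%:~R != 0 :> R by rewrite intr_eq0.
have d (x : R) : is_derive x (1 : R) (fun x => - (k%:~R)^-1 * es k x) (ec k x).
  have := is_deriveZ (- (k%:~R)^-1) (es_derive k x); rewrite /GRing.scale /=.
  by rewrite mulrA mulrNN mulVf // mul1r.
by rewrite (circ_FTC (fun x _ => d x) (@ec_cont k)) /es expi_2pi expi0 subrr mulr0n.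
Qed.

Lemma int_es k : \int[mu]_(x in circ) es k x = 0.
Proof.
have [->|k0] := eqVneq k 0.
  rewrite (_ : (fun x => _) = fun=> 0); last by apply/funext => x; rewrite esE mul0r
    sin0 oppr0.
  by rewrite Rintegral_cst // mul0r.
have kR : k%:~R != 0 :> R by rewrite intr_eq0.
have d (x : R) : is_derive x (1 : R) (fun x => (k%:~R)^-1 * ec k x) (es k x).
  have := is_deriveZ ((k%:~R)^-1) (ec_derive k x); rewrite /GRing.scale /=.
  by rewrite mulrA mulVf // mul1r.
by rewrite (circ_FTC (fun x _ => d x) (@es_cont k)) /ec expi_2pi expi0 subrr.
Qed.

Definition fhat f : int -> C := fun k =>
  ((2 * pi)^-1)%:C * cintegral circ (fun x => (f x)%:C * expi x ^ (- k)).

Lemma fourierE (u : R -> 'rV[R]_3) k i : fourier u k 0 i = fhat (fun x => u x 0 i) k.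
Proof. by rewrite mxE. Qed.

Lemma fhat_Re f k : Re (fhat f k) = (2 * pi)^-1 * \int[mu]_(x in circ) (f x * ec k x).
Proof.
rewrite /fhat /cintegral /= mul0r subr0; congr (_ * _).
by apply: eq_Rintegral => x _; rewrite /ec; case: (expi x ^ _) => u v /=; rewrite mul0r
  subr0.
Qed.

Lemma fhat_Im f k : Im (fhat f k) = (2 * pi)^-1 * \int[mu]_(x in circ) (f x * es k x).
Proof.
rewrite /fhat /cintegral /= mul0r addr0; congr (_ * _).
by apply: eq_Rintegral => x _; rewrite /es; case: (expi x ^ _) => u v /=; rewrite mul0r
  addr0.
Qed.

Lemma complex_eq (z w : C) : Re z = Re w -> Im z = Im w -> z = w.
Proof. by case: z w => [a b] [c d] /= -> ->. Qed.

Definition L2 f : Prop :=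
  measurable_fun circ f /\ circ_int (fun x => f x ^+ 2).

Definition ip f g : R := \int[mu]_(x in circ) (f x * g x).

Lemma L2_cont f : continuous f -> L2 f.
Proof.
move=> cf; split; first by apply: measurable_funTS; exact: continuous_measurable_fun.
by apply: circ_int_cont => x; apply: (@cvgM _ _ _ _ f f) => //; exact: cf.
Qed.

Lemma measurable_circM f g : measurable_fun circ f -> measurable_fun circ g ->
  measurable_fun circ (fun x => f x * g x).
Proof. by move=> *; exact: measurable_funM. Qed.

Lemma circ_intM f g : L2 f -> L2 g -> circ_int (fun x => f x * g x).
Proof.
move=> [mf hf] [mg hg]; apply: (circ_int_le _ (circ_intD hf hg)).
  exact: measurable_circM.
move=> x; rewrite normrM -(real_normK (num_real (f x))) -(real_normK (num_real (g x))).
by nra.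
Qed.

Lemma L2D f g : L2 f -> L2 g -> L2 (fun x => f x + g x).
Proof.
move=> [mf hf] [mg hg]; split; first exact: measurable_funD.
apply: (circ_int_le _ (circ_intZ 2 (circ_intD hf hg))).
  by apply: measurable_funX; exact: measurable_funD.
by move=> x; rewrite ger0_norm ?sqr_ge0 //; have := sqr_ge0 (f x - g x); move: (f x) (g
  x) => p q; nra.
Qed.

Lemma L2_mul (b f : R -> R) (B : R) : measurable_fun circ b -> (forall x, `|b x| <= B)
  -> L2 f ->
  L2 (fun x => b x * f x).
Proof.
move=> mb hb [mf hf]; split; first exact: measurable_circM.
apply: (circ_int_le _ (circ_intZ (B ^+ 2) hf)).
  by apply: measurable_funX; exact: measurable_circM.
move=> x; rewrite ger0_norm ?sqr_ge0 // exprMn ler_wpM2r ?sqr_ge0 //.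
by rewrite -(real_normK (num_real (b x))); have := hb x; have := normr_ge0 (b x); nra.
Qed.

Lemma L2Z (c : R) f : L2 f -> L2 (fun x => c * f x).
Proof. by apply: (@L2_mul (fun=> c) f `|c|) => //; exact: measurable_cst. Qed.

Lemma L2B f g : L2 f -> L2 g -> L2 (fun x => f x - g x).
Proof.
move=> hf /(L2Z (-1)) hg; have := L2D hf hg; congr L2; apply/funext => x; by rewrite
  mulN1r.
Qed.

Lemma ipC f g : ip f g = ip g f.
Proof. by apply: eq_Rintegral => x _; rewrite mulrC. Qed.

Lemma ipDr f g h : L2 f -> L2 g -> L2 h -> ip f (fun x => g x + h x) = ip f g + ip f h.
Proof.
move=> hf hg hh; rewrite /ip -RintegralD //; [|exact: circ_intM|exact: circ_intM].
by apply: eq_Rintegral => x _; rewrite mulrDr.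
Qed.

Lemma ipZr (c : R) f g : L2 f -> L2 g -> ip f (fun x => c * g x) = c * ip f g.
Proof.
move=> hf hg; rewrite /ip -RintegralZl //; last exact: circ_intM.
by apply: eq_Rintegral => x _; rewrite mulrCA.
Qed.

Lemma eq_ip f f' g g' : f =1 f' -> g =1 g' -> ip f g = ip f' g'.
Proof. by move=> /funext -> /funext ->. Qed.

Lemma ipBr f g h : L2 f -> L2 g -> L2 h -> ip f (fun x => g x - h x) = ip f g - ip f h.
Proof.
move=> hf hg hh; rewrite -[in RHS]mulN1r -ipZr // -ipDr //; last exact: L2Z.
by apply: eq_ip => // x; rewrite mulN1r.
Qed.

Lemma ip_ge0 f : 0 <= ip f f.
Proof. by apply: Rintegral_ge0 => x _; rewrite -expr2 sqr_ge0. Qed.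

Lemma ip_sub f g : L2 f -> L2 g ->
  ip (fun x => f x - g x) (fun x => f x - g x) = ip f f - 2 * ip f g + ip g g.
Proof.
move=> hf hg; have hfg := L2B hf hg.
rewrite ipBr // ipC ipBr // (ipC (fun x => f x - g x) g) ipBr // (ipC g f); ring.
Qed.

Lemma ipZZ (c d : R) f g : L2 f -> L2 g ->
  ip (fun x => c * f x) (fun x => d * g x) = c * d * ip f g.
Proof.
move=> hf hg; rewrite ipZr //; last exact: L2Z.
by rewrite ipC ipZr // (ipC g) mulrA (mulrC d).
Qed.

Lemma ip_amgm f g (d : R) : L2 f -> L2 g -> 0 < d -> 2 * `|ip f g| <= d * ip f f + ip g
  g / d.
Proof.
move=> hf hg d0.
have h (s : R) : s ^+ 2 = 1 -> 0 <= d * ip f f - 2 * s * ip f g + ip g g / d.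
  move=> s2; have := ip_ge0 (fun x => d * f x - s * g x).
  rewrite ip_sub; try exact: L2Z.
  rewrite !ipZZ // => {}h.
  have -> : d * ip f f - 2 * s * ip f g + ip g g / d =
    (d * d * ip f f - 2 * (d * s * ip f g) + s * s * ip g g) / d.
    rewrite -(expr2 s) s2 mul1r; field; by rewrite gt_eqF.
  by rewrite divr_ge0 // ltW.
have h1 := h 1 (expr1n _ _); have := h (-1); rewrite sqrrN expr1n => /(_ erefl) h2.
have [p|p] := ltP 0 (ip f g); [rewrite gtr0_norm //|rewrite ler0_norm //]; lra.
Qed.

Lemma ip_symsumr f n (g_ : int -> R -> R) : L2 f -> (forall k, L2 (g_ k)) ->
  ip f (fun x => symsum n (g_ ^~ x)) = symsum n (fun k => ip f (g_ k)).
Proof.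
move=> hf hg; rewrite -[RHS](@circ_int_of_symsum n (fun k x => f x * g_ k x)).
  by apply: eq_Rintegral => x _; rewrite mulr_symsumr.
by move=> k; exact: circ_intM.
Qed.

Lemma L2_ec k : L2 (ec k). Proof. exact/L2_cont/ec_cont. Qed.
Lemma L2_es k : L2 (es k). Proof. exact/L2_cont/es_cont. Qed.
Hint Resolve L2_ec L2_es : core.

Lemma fhatRe f k : Re (fhat f k) = (2 * pi)^-1 * ip f (ec k).
Proof. exact: fhat_Re. Qed.
Lemma fhatIm f k : Im (fhat f k) = (2 * pi)^-1 * ip f (es k).
Proof. exact: fhat_Im. Qed.

Lemma fhat_conj f k : L2 f -> fhat f (- k) = (fhat f k)^*.
Proof.
move=> hf; apply: complex_eq; rewrite ?cRe_conj ?cIm_conj ?fhatRe ?fhatIm.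
  by congr (_ * _); apply: eq_ip => // x; rewrite !ecE mulrNz mulNr cosN.
rewrite -[RHS]mulrN; congr (_ * _); rewrite -[RHS]mulN1r -ipZr //.
by apply: eq_ip => // x; rewrite !esE mulrNz mulNr sinN mulN1r.
Qed.

Lemma fhatB f g k : L2 f -> L2 g -> fhat (fun x => f x - g x) k = fhat f k - fhat g k.
Proof.
move=> hf hg; apply: complex_eq.
  transitivity (Re (fhat f k) - Re (fhat g k)); last by case: (fhat f k) (fhat g k) =>
    [? ?] [? ?].
  by rewrite !fhatRe ipC ipBr // mulrBr !(ipC (ec k)).
transitivity (Im (fhat f k) - Im (fhat g k)); last by case: (fhat f k) (fhat g k) => [?
  ?] [? ?].
by rewrite !fhatIm ipC ipBr // mulrBr !(ipC (es k)).
Qed.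

(** Truncated Fourier series with coefficients a. Under [conj_sym a] the sum is real and taking the
    real part only changes the type ([rtp_real]). *)
Definition rtp (J : nat) a (x : R) : R := Re (symsum J (fun k => a k * expi x ^ k)).

Lemma rtpE J a x : rtp J a x = symsum J (fun k => Re (a k) * ec k x + Im (a k) * es k x).
Proof.
rewrite /rtp raddf_symsum; apply: eq_symsum => k _.
rewrite ecE esE expi_int; case: (a k) => u v /=; ring.
Qed.

Lemma L2_term a k : L2 (fun x => Re (a k) * ec k x + Im (a k) * es k x).
Proof. by apply: L2D; exact: L2Z. Qed.

Lemma cont_symsum J (f_ : int -> R -> R) : (forall k, continuous (f_ k)) ->
  continuous (fun x => symsum J (f_ ^~ x)).
Proof.
move=> hf x; rewrite (_ : (fun x => _) = (fun x => \sum_(k <- sseq J) f_ k x)); last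
  first.
  by apply/funext => y; rewrite symsumE.
elim: (sseq J) => [|k s IH].
  by rewrite (_ : (fun x => _) = fun=> 0); [exact: cvg_cst|apply/funext => y; rewrite
    big_nil].
rewrite (_ : (fun x => _) = (fun x => f_ k x + \sum_(k <- s) f_ k x)); last first.
  by apply/funext => y; rewrite big_cons.
by apply: (@continuousD _ _ _ (f_ k) (fun x => \sum_(k <- s) f_ k x)) => //; exact: hf.
Qed.

Lemma rtp_cont J a : continuous (rtp J a).
Proof.
have -> : rtp J a = fun x => symsum J (fun k => Re (a k) * ec k x + Im (a k) * es k x).
  by apply/funext => x; exact: rtpE.
apply: (@cont_symsum J (fun k x => Re (a k) * ec k x + Im (a k) * es k x)) => k x.
have h1 : (fun x => Re (a k) * ec k x) @ x --> Re (a k) * ec k x.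
  by apply: cvgM; [exact: cvg_cst|exact: ec_cont].
have h2 : (fun x => Im (a k) * es k x) @ x --> Im (a k) * es k x.
  by apply: cvgM; [exact: cvg_cst|exact: es_cont].
exact: (cvgD h1 h2).
Qed.

Lemma L2_rtp J a : L2 (rtp J a).
Proof. exact/L2_cont/rtp_cont. Qed.

Definition cdot (z w : C) : R := Re z * Re w + Im z * Im w.
Definition csq (z : C) : R := Re z ^+ 2 + Im z ^+ 2.

Lemma ip_rtp f J a : L2 f -> ip f (rtp J a) = 2 * pi * symsum J (fun k => cdot (a k)
  (fhat f k)).
Proof.
move=> hf; rewrite (eq_ip (f' := f) (g' := fun x => symsum J (fun k => Re (a k) * ec k
  x + Im (a k) * es k x))) //.
  rewrite (ip_symsumr J (g_ := fun k x => Re (a k) * ec k x + Im (a k) * es k x)) //;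
    last exact: L2_term.
  rewrite -symsumZ; apply: eq_symsum => k _.
  rewrite ipDr; try exact: L2Z; last by []. 
  rewrite !ipZr // /cdot fhatRe fhatIm.
  by move: (lt0r_neq0 twopi_gt0); move: (2 * pi : R) => p p0; field.
by move=> x; exact: rtpE.
Qed.

Definition conj_sym a : Prop := forall k, a (- k) = (a k)^*.

Lemma rtp_real J a x : conj_sym a -> (rtp J a x)%:C = symsum J (fun k => a k * expi x ^
  k).
Proof.
move=> ha; rewrite /rtp; set S := symsum _ _; suff : S^* = S.
  by move/(congr1 Im); rewrite cIm_conj => h; apply: complex_eq => //=; lra.
rewrite /S raddf_symsum -symsumN; apply: eq_symsum => k _.
transitivity ((a (- k))^* * (expi x ^ (- k))^* ); first exact: rmorphM.
by rewrite ha conjCK !expi_int expi_conj mulrNz mulNr opprK.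
Qed.

Lemma fhat_rtp J a m : conj_sym a ->
  fhat (rtp J a) m = if (`|m| <= J)%N then a m else 0.
Proof.
move=> ha.
have key x : (rtp J a x)%:C * expi x ^ (- m) = symsum J (fun k => a k * expi x ^ (- (m
  - k))).
  rewrite rtp_real // mulr_symsuml; apply: eq_symsum => k _.
  by rewrite -mulrA -expfzDr ?expi_neq0 // opprB.
have pi0 : 2 * pi != 0 :> R by rewrite mulf_neq0 // gt_eqF ?pi_gt0.
have E (z : C) : symsum J (fun k => if k == m then z else 0) = if (`|m| <= J)%N then z
  else 0.
  case: ifPn => hm; first by rewrite (symsum_single hm) ?eqxx // => k /negbTE ->.
  rewrite (@eq_symsum _ _ _ (fun=> 0)).
    by rewrite symsumE big1.
  by move=> k hk; case: eqVneq => // e; rewrite e (negbTE hm) in hk.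
rewrite -E; apply: complex_eq.
  rewrite fhatRe /ip (@eq_Rintegral _ _ R mu circ (fun x => symsum J (fun k => Re (a k)
    * ec (m - k) x - Im (a k) * es (m - k) x))).
    rewrite circ_int_of_symsum; last first.
      move=> k; apply: circ_intD; last rewrite (_ : (fun x => _) = fun x => - Im (a k)
        * es (m - k) x).
      - exact/circ_intZ/circ_int_cont/ec_cont.
      - exact/circ_intZ/circ_int_cont/es_cont.
      - by apply/funext => x; rewrite mulNr.
    rewrite -symsumZ raddf_symsum; apply: eq_symsum => k _.
    rewrite RintegralB //; try exact/circ_intZ/circ_int_cont/ec_cont; try
      exact/circ_intZ/circ_int_cont/es_cont.
    rewrite !RintegralZl //; try exact/circ_int_cont/ec_cont; try
      exact/circ_int_cont/es_cont.
    rewrite int_ec int_es mulr0 subr0 subr_eq0 eq_sym.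
    by case: eqVneq => [->|_]; rewrite ?mulr1n ?mulr0n; [rewrite mulrCA mulVf //
      mulr1|rewrite !mulr0].
  move=> x _; transitivity (Re ((rtp J a x)%:C * expi x ^ (- m))).
    by rewrite /ec; case: (expi x ^ _) => u v /=; rewrite mul0r subr0.
  rewrite key raddf_symsum; apply: eq_symsum => k _.
  by rewrite /ec /es; case: (a k) => u v; case: (expi x ^ _).
rewrite fhatIm /ip (@eq_Rintegral _ _ R mu circ (fun x => symsum J (fun k => Re (a k) *
  es (m - k) x + Im (a k) * ec (m - k) x))).
  rewrite circ_int_of_symsum; last first.
    move=> k; apply: circ_intD.
    - exact/circ_intZ/circ_int_cont/es_cont.
    - exact/circ_intZ/circ_int_cont/ec_cont.
  rewrite -symsumZ raddf_symsum; apply: eq_symsum => k _.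
  rewrite RintegralD //; try exact/circ_intZ/circ_int_cont/ec_cont; try
    exact/circ_intZ/circ_int_cont/es_cont.
  rewrite !RintegralZl //; try exact/circ_int_cont/ec_cont; try
    exact/circ_int_cont/es_cont.
  rewrite int_ec int_es mulr0 add0r subr_eq0 eq_sym.
  by case: eqVneq => [->|_]; rewrite ?mulr1n ?mulr0n; [rewrite mulrCA mulVf //
    mulr1|rewrite !mulr0].
move=> x _; transitivity (Im ((rtp J a x)%:C * expi x ^ (- m))).
  by rewrite /es; case: (expi x ^ _) => u v /=; rewrite mul0r addr0.
rewrite key raddf_symsum; apply: eq_symsum => k _.
by rewrite /ec /es; case: (a k) => u v; case: (expi x ^ _).
Qed.

Lemma rtp_parseval J K a b : (J <= K)%N -> conj_sym a -> conj_sym b ->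
  ip (rtp K b) (rtp J a) = 2 * pi * symsum J (fun k => cdot (a k) (b k)).
Proof.
move=> JK ha hb; rewrite ip_rtp; last exact: L2_rtp.
congr (_ * _); apply: eq_symsum => k hk.
by rewrite fhat_rtp // (leq_trans hk JK).
Qed.

Lemma fhat_bessel f J : L2 f ->
  2 * pi * symsum J (fun k => csq (fhat f k)) <= ip f f.
Proof.
move=> hf; have cs : conj_sym (fhat f) by move=> k; exact: fhat_conj.
have := ip_ge0 (fun x => f x - rtp J (fhat f) x).
rewrite ip_sub //; last exact: L2_rtp.
rewrite ip_rtp // rtp_parseval //.
have -> : symsum J (fun k => cdot (fhat f k) (fhat f k)) = symsum J (fun k => csq (fhat
  f k)) by [].
lra.
Qed.

Lemma csq_fhat_le f k : L2 f -> 2 * pi * csq (fhat f k) <= ip f f.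
Proof.
move=> hf; apply: le_trans (fhat_bessel `|k| hf); rewrite ler_pM2l ?twopi_gt0 //.
by apply: (@symsum_term _ _ (fun k => csq (fhat f k))) => // l; rewrite addr_ge0 ?sqr_ge0.
Qed.

Lemma ip_rtp_diff J K a : (K <= J)%N -> conj_sym a ->
  ip (fun x => rtp J a x - rtp K a x) (fun x => rtp J a x - rtp K a x) =
  2 * pi * (symsum J (fun k => csq (a k)) - symsum K (fun k => csq (a k))).
Proof.
move=> KJ ha; rewrite ip_sub; try exact: L2_rtp.
rewrite !rtp_parseval //.
have e n : symsum n (fun k => cdot (a k) (a k)) = symsum n (fun k => csq (a k)) by [].
rewrite !e; ring.
Qed.

End Circle.

(** * Reconstruction of a function from its Fourier coefficients *)

Section RieszFischer.
Variable R : realType.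
Local Notation mu := (@lebesgue_measure R).
Local Notation circ := (@circle R).
Local Notation C := R[i].
Implicit Types (f g h : R -> R) (a b : int -> C).
Let circ_measurable : measurable (circ : set (measurableTypeR R)) := @circle_measurable R.
Hint Resolve circ_measurable : core.

Lemma ae_mono (P Q : R -> Prop) : (forall x, P x -> Q x) ->
  {ae mu, forall x, P x} -> {ae mu, forall x, Q x}.
Proof. by move=> h; apply: (@filterS _ _ (ae_filter_ringOfSetsType mu)). Qed.

Lemma circ_intE f : circ_int f ->
  (\int[mu]_(x in circ) (f x)%:E)%E = (\int[mu]_(x in circ) f x)%:E.
Proof. by move=> hf; rewrite fineK //; exact: integrable_fin_num. Qed.

Lemma circ_int_cst (c : R) : circ_int (fun=> c).
Proof. exact/circ_int_cont/cst_continuous. Qed.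

Lemma ge0_circ_int f (A : R) : measurable_fun circ f -> (forall x, 0 <= f x) ->
  (\int[mu]_(x in circ) (f x)%:E <= A%:E)%E ->
  circ_int f /\ \int[mu]_(x in circ) f x <= A.
Proof.
move=> mf f0 hA.
have hf : circ_int f.
  apply/integrableP; split; first exact/measurable_EFinP.
  have -> : (\int[mu]_(x in circ) `|(EFin \o f) x| = \int[mu]_(x in circ) (f x)%:E)%E.
    by apply: eq_integral => x _ /=; rewrite ger0_norm.
  by apply: le_lt_trans hA _; exact: ltry.
by split => //; rewrite -lee_fin -circ_intE.
Qed.

Lemma ae_int_eq (f g : R -> \bar R) : measurable_fun circ f -> measurable_fun circ g ->
  {ae mu, forall x, circ x -> f x = g x} ->
  (\int[mu]_(x in circ) f x = \int[mu]_(x in circ) g x)%E.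
Proof. by move=> mf mg h; exact: ae_eq_integral. Qed.

(** The sum of the absolute values has integral at most 2 A by monotone convergence, hence is finite
    almost everywhere, and absolute convergence implies convergence. *)
Lemma L1_series_ae (d : nat -> R -> R) (A : R) : 0 <= A ->
  (forall j, circ_int (d j)) ->
  (forall j, \int[mu]_(x in circ) `|d j x| <= A / 2 ^+ j) ->
  {ae mu, forall x, circ x -> cvgn (series (d ^~ x))}.
Proof.
move=> A0 hd hA.
have hn j : circ_int (fun x => `|d j x|).
  by have := integrable_norm (hd j); congr circ_int.
have md j : measurable_fun circ (fun x => (`|d j x|)%:E).
  by have /measurable_int := hn j.
pose F x := (\sum_(0 <= j <oo) (`|d j x|)%:E)%E.
have mF : measurable_fun circ F by exact: ge0_emeasurable_sum.
have F0 x : (0 <= F x)%E by apply: nneseries_ge0 => n _ _; rewrite lee_fin.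
have iF : (\int[mu]_(x in circ) F x <= (2 * A)%:E)%E.
  rewrite integral_nneseries //.
  apply: le_trans (epsilon_trick0 xpredT (_ : 0 <= 2 * A)); last by rewrite mulr_ge0.
  apply: lee_nneseries => [j _ _|j _]; first by apply: integral_ge0 => x _; rewrite
    lee_fin.
  rewrite circ_intE // lee_fin; apply: le_trans (hA j) _.
  rewrite natrX exprS invfM (mulrC 2) -!mulrA (mulrA 2) divff ?mul1r //.
have : mu.-integrable circ F.
  apply/integrableP; split=> //.
  have -> : (\int[mu]_(x in circ) `|F x| = \int[mu]_(x in circ) F x)%E.
    by apply: eq_integral => x _ /=; rewrite gee0_abs.
  by apply: le_lt_trans iF _; exact: ltry.
move=> /(integrable_ae (@circle_measurable R)); apply: filterS => x hx cx.
have {hx} := hx cx; have := F0 x; case E : (F x) => [r| |] // r0 _.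
apply: normed_cvg; apply: nondecreasing_is_cvgn.
  by apply: nondecreasing_series => // i _ _ /=.
exists r => _ [n _ <-]; rewrite /= -lee_fin -E /series /= -sumEFin.
by apply: nneseries_lim_ge => i _ _; rewrite lee_fin.
Qed.

Definition dist2 f g : R := ip (fun x => f x - g x) (fun x => f x - g x).

Lemma dist2E f g : dist2 f g = \int[mu]_(x in circ) ((f x - g x) ^+ 2).
Proof. by apply: eq_Rintegral => x _; rewrite expr2. Qed.

Lemma dist2C f g : dist2 f g = dist2 g f.
Proof. by rewrite !dist2E; apply: eq_Rintegral => x _; rewrite -sqrrN opprB. Qed.

Lemma dist2_ge0 f g : 0 <= dist2 f g.
Proof. exact: ip_ge0. Qed.

Lemma dist2_tri f g h : L2 f -> L2 g -> L2 h -> dist2 f h <= 2 * (dist2 f g + dist2 g h).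
Proof.
move=> hf hg hh; rewrite !dist2E.
have [_ h1] := L2B hf hg; have [_ h2] := L2B hg hh; have [_ h3] := L2B hf hh.
rewrite -RintegralD // -RintegralZl //; last exact: circ_intD.
apply: le_Rintegral => //; first exact/circ_intZ/circ_intD.
move=> x _; have := sqr_ge0 ((f x - g x) - (g x - h x)); move: (f x) (g x) (h x) => p q r.
nra.
Qed.

(* The rate 1 / (K + 1) is the one that a bound in H^{1/2} provides. *)
Definition repr f a (M : R) : Prop :=
  [/\ conj_sym a, L2 f & forall K, dist2 f (rtp K a) <= 2 * pi * M / K.+1%:R].

(** Bessel's inequality for the single frequency k, applied to f minus a truncation at a level
    beyond |k|: the k-th coefficient of this difference is fhat f k - a k, and its norm tends to 0
    with the level. *)
Lemma repr_fhat f a M k : repr f a M -> fhat f k = a k.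
Proof.
move=> [ha hf hM].
have hz : csq (fhat f k - a k) = 0.
  apply/eqP; rewrite eq_le addr_ge0 ?sqr_ge0 // andbT.
  apply/ler_addgt0Pr => e e0; rewrite add0r.
  pose K := (maxn `|k| (Num.bound (M / e)))%N.
  have := csq_fhat_le k (L2B hf (L2_rtp K a)); rewrite fhatB //; last exact: L2_rtp.
  rewrite fhat_rtp // leq_maxl => h1.
  have := le_trans h1 (hM K); rewrite -(mulrA (2 * pi) M) ler_pM2l ?twopi_gt0 // => h2.
  apply: le_trans h2 _; rewrite ler_pdivrMr ?ltr0n // mulrC -ler_pdivrMr //.
  apply: (@le_trans _ _ (Num.bound (M / e))%:R).
    have [h|h] := lerP 0 (M / e); first by apply/ltW/archi_boundP.
    by apply: le_trans (ltW h) _.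
  by rewrite ler_nat; apply: leqW; exact: leq_maxr.
apply/eqP; rewrite -subr_eq0; apply/eqP; apply: complex_eq => /=.
all: move: hz; rewrite /csq => /eqP; rewrite paddr_eq0 ?sqr_ge0 // !sqrf_eq0 =>
  /andP[/eqP h1 /eqP h2] //.
Qed.

Lemma dist2_rtp K a b : conj_sym a -> conj_sym b ->
  dist2 (rtp K a) (rtp K b) = 2 * pi * symsum K (fun k => csq (a k - b k)).
Proof.
move=> ha hb; rewrite /dist2 ip_sub; try exact: L2_rtp.
rewrite !rtp_parseval //.
have -> : symsum K (fun k => csq (a k - b k)) = symsum K (fun k => cdot (a k) (a k))
    - 2 * symsum K (fun k => cdot (b k) (a k)) + symsum K (fun k => cdot (b k) (b k));
      last by ring.
rewrite -symsumZ -symsumB -symsumD; apply: eq_symsum => k _.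
by rewrite /cdot /csq; case: (a k) (b k) => [? ?] [? ?] /=; ring.
Qed.

(** The high frequencies of each function cost 1 / (K + 1), the low ones finitely many coefficient
    differences. This is how convergence of coefficients under an H^{1/2} bound becomes strong
    convergence in L^2. *)
Lemma repr_dist f g a b M M' K : repr f a M -> repr g b M' ->
  dist2 f g <= 4 * (2 * pi * M / K.+1%:R) + 4 * (2 * pi * M' / K.+1%:R)
   + 4 * (2 * pi) * symsum K (fun k => csq (a k - b k)).
Proof.
move=> [ha hf hM] [hb hg hM'].
have h1 := dist2_tri hf (L2_rtp K a) hg.
have h2 := dist2_tri (L2_rtp K a) (L2_rtp K b) hg.
have h3 := hM K; have := hM' K; rewrite dist2C => h4.
rewrite dist2_rtp // in h2.
have := dist2_ge0 f (rtp K a).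
move: h1 h2 h3 h4; rewrite -[4 * (2 * pi) * _]mulrA.
move: (2 * pi * symsum _ _) (2 * pi * M / _) (2 * pi * M' / _) => x y z.
lra.
Qed.

Lemma repr_L2 f a M : repr f a M -> L2 f. Proof. by case. Qed.

Lemma repr_cvg f a M (g_ : nat -> R -> R) (b_ : nat -> int -> C) M' :
  repr f a M -> (forall j, repr (g_ j) (b_ j) M') -> (forall k, ccvg (b_ ^~ k) (a k)) ->
  dist2 f (g_ j) @[j --> \oo] --> (0 : R).
Proof.
move=> hf hg hb.
have M0 : 0 <= M.
  have [_ _ /(_ 0%N)] := hf; rewrite divr1 => h.
  by have := le_trans (dist2_ge0 _ _) h; rewrite pmulr_rge0 ?twopi_gt0.
have M0' : 0 <= M'.
  have [_ _ /(_ 0%N)] := hg 0%N; rewrite divr1 => h.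
  by have := le_trans (dist2_ge0 _ _) h; rewrite pmulr_rge0 ?twopi_gt0.
apply/cvgrPdist_le => e e0; rewrite /=.
pose D := 8 * (2 * pi) * (M + M').
have D0 : 0 <= D by rewrite mulr_ge0 ?addr_ge0 // mulr_ge0 // ltW // twopi_gt0.
pose K := Num.bound (D / e).
have hK : 4 * (2 * pi * M / K.+1%:R) + 4 * (2 * pi * M' / K.+1%:R) <= e / 2.
  have -> : 4 * (2 * pi * M / K.+1%:R) + 4 * (2 * pi * M' / K.+1%:R) = (D / 2) / K.+1%:R.
    have : K.+1%:R != 0 :> R by rewrite pnatr_eq0.
    by rewrite /D; move: (K.+1%:R : R) => p p0; field.
  rewrite ler_pdivrMr ?ltr0n //.
  have : D / e <= K.+1%:R.
    apply: (@le_trans _ _ K%:R); last by rewrite ler_nat.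
    by apply/ltW/archi_boundP; rewrite divr_ge0 // ltW.
  rewrite ler_pdivrMr //; lra.
have c0 : symsum K (fun k => csq (a k - b_ j k)) @[j --> \oo] --> symsum K (fun k =>
  csq (a k - a k)).
  apply: cvg_symsum => k; have [c1 c2] := ccvgD (ccvg_cst (a k)) (ccvgN (hb k)).
  by rewrite /csq; apply: cvgD; rewrite expr2; under eq_fun do rewrite expr2; exact: cvgM.
have z0 : symsum K (fun k => csq (a k - a k)) = 0.
  by rewrite symsumE big1 // => k _; rewrite subrr /csq /= expr0n /= addr0.
rewrite z0 in c0.
have c1 : 4 * (2 * pi) * symsum K (fun k => csq (a k - b_ j k)) @[j --> \oo] --> 4 * (2
  * pi) * (0 : R).
  by apply: cvgM c0; exact: cvg_cst.
have e2 : 0 < e / 2 by rewrite divr_gt0.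
move/cvgrPdist_le : c1 => /(_ _ e2); rewrite mulr0; apply: filterS => j hj.
rewrite sub0r normrN ger0_norm ?dist2_ge0 //.
apply: le_trans (repr_dist K hf (hg j)) _.
have aux (p q x e' : R) : p + q <= e' / 2 -> `|0 - x| <= e' / 2 -> p + q + x <= e'.
  by rewrite sub0r normrN; have := ler_norm x; lra.
exact: aux hK hj.
Qed.

(** Truncation at 4^j rather than at j: with the rate 1 / (K + 1) for squared distances, the
    increments have L^2 norm of order 2^{-j}, hence are summable, and the sequence converges almost
    everywhere. *)
Definition lim_rtp a (x : R) : R := lim (rtp (4 ^ j) a x @[j --> \oo]).

Lemma measurable_rtp_circ J a : measurable_fun circ (rtp J a).
Proof. by have [] := L2_rtp J a. Qed.

Lemma measurable_lim_rtp a : measurable_fun circ (lim_rtp a).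
Proof. by apply: measurable_lim => [|n]; [exact: circle_measurable|exact:
  measurable_rtp_circ]. Qed.

Section Tail.
Variables (a : int -> C) (M : R).
Hypothesis ha : conj_sym a.
Hypothesis hM : forall K J, (K <= J)%N ->
  symsum J (fun k => csq (a k)) - symsum K (fun k => csq (a k)) <= M / K.+1%:R.

Let M0 : 0 <= M.
Proof. by have := hM (leqnn 0); rewrite subrr divr1. Qed.

Lemma dist2_rtp_le K J : (K <= J)%N -> dist2 (rtp J a) (rtp K a) <= 2 * pi * M / K.+1%:R.
Proof.
by move=> KJ; rewrite /dist2 ip_rtp_diff // -(mulrA (2 * pi) M) ler_pM2l ?twopi_gt0 //;
  exact: hM.
Qed.

Lemma lim_rtp_ae :
  {ae mu, forall x, circ x -> (rtp (4 ^ j) a x @[j --> \oo] --> lim_rtp a x)}.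
Proof.
pose d j x := rtp (4 ^ j.+1) a x - rtp (4 ^ j) a x.
have Ld j : L2 (d j) by apply: L2B; exact: L2_rtp.
have cont j : continuous (d j).
  by move=> x; apply: cvgB; exact: rtp_cont.
have [A A0 hA] : exists2 A : R, 0 <= A & forall j, \int[mu]_(x in circ) `|d j x| <= A /
  2 ^+ j.
  exists (2 * pi * (1 + M)); first by rewrite mulr_ge0 ?addr_ge0 // ltW // twopi_gt0.
  move=> j; have [_ L1] := Ld j.
  have ic : circ_int (fun=> (2 ^+ j)^-1 : R) by exact: circ_int_cst.
  (* The inequality y <= 2^{-j} + 2^j y^2 replaces Cauchy-Schwarz: the integral of the squared
     increment is of order 4^{-j}, so both terms integrate to order 2^{-j}. *)
  apply: (@le_trans _ _ (\int[mu]_(x in circ) ((2 ^+ j)^-1 + 2 ^+ j * d j x ^+ 2))).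
    apply: le_Rintegral => //.
    - by apply: circ_int_cont => x; apply: cvg_norm; exact: cont.
    - by apply: circ_intD => //; exact: circ_intZ.
    move=> x _; have p0 : 0 < 2 ^+ j :> R by rewrite exprn_gt0.
    rewrite -(real_normK (num_real (d j x))).
    have := sqr_ge0 (2 ^+ j * `|d j x| - 1); have := normr_ge0 (d j x).
    move: (`|d j x|) => y y0 h; rewrite -subr_ge0.
    have -> : (2 ^+ j)^-1 + 2 ^+ j * y ^+ 2 - y = ((2 ^+ j * y - 1) ^+ 2 + 2 ^+ j * y)
      / 2 ^+ j.
      by field; rewrite gt_eqF.
    by apply: divr_ge0; [apply: addr_ge0 => //; apply: mulr_ge0 => //|]; exact: ltW.
  rewrite RintegralD //; last exact: circ_intZ.
  rewrite Rintegral_cst // [X in fine X]circle_mass /= RintegralZl //.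
  have := @dist2_rtp_le (4 ^ j) (4 ^ j.+1); rewrite leq_exp2l // leqnSn => /(_ isT).
  rewrite dist2E => h.
  have h' : \int[mu]_(x in circ) (d j x ^+ 2) <= 2 * pi * M / 4 ^+ j.
    apply: le_trans h _; apply: ler_wpM2l; first by rewrite mulr_ge0 // ltW // twopi_gt0.
    by rewrite -natrX lef_pV2 ?posrE ?ltr0n ?expn_gt0 // ler_nat leqW.
  have E : 2 ^+ j * (2 * pi * M / 4 ^+ j) = 2 * pi * M / 2 ^+ j.
    have -> : 4 ^+ j = 2 ^+ j * 2 ^+ j :> R by rewrite -exprMn -natrM.
    by field; rewrite expf_neq0 // pnatr_eq0.
  have p0 : 0 < 2 ^+ j :> R by rewrite exprn_gt0.
  have := ler_wpM2l (ltW p0) h'; rewrite E => {}h'.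
  rewrite (mulrDr (2 * pi)) mulr1 mulrDl (mulrC _ (2 * pi)) lerD2l; exact: h'.
have := L1_series_ae A0 (fun j => circ_int_cont (cont j)) hA.
apply: ae_mono => x hx cx; have {}hx := hx cx.
have E : (fun j => rtp (4 ^ j) a x) = (fun j => rtp (4 ^ 0) a x + series (d ^~ x) j).
  by apply/funext => j; rewrite [LHS](eq_sum_telescope (fun j => rtp (4 ^ j) a x)).
apply/cvg_ex; exists (rtp (4 ^ 0) a x + lim (series (d ^~ x) @ \oo)).
by rewrite E; apply: cvgD hx; exact: cvg_cst.
Qed.

(** Fatou's lemma along the truncations at 4^(j + K), all above level K, where [dist2_rtp_le] bounds
    the distance to the K-th truncation. The lower limit is the squared distance to [lim_rtp] only
    almost everywhere, which is enough under the integral. *)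
Lemma lim_rtp_repr : repr (lim_rtp a) a M.
Proof.
have key K : circ_int (fun x => (lim_rtp a x - rtp K a x) ^+ 2) /\
    \int[mu]_(x in circ) ((lim_rtp a x - rtp K a x) ^+ 2) <= 2 * pi * M / K.+1%:R.
  pose f j x := ((rtp (4 ^ (j + K)) a x - rtp K a x) ^+ 2)%:E.
  have mf j : measurable_fun circ (f j).
    by apply/measurable_EFinP/measurable_funX; apply: measurable_funB; exact:
      measurable_rtp_circ.
  have f0 j x : circ x -> (0 <= f j x)%E by rewrite lee_fin sqr_ge0.
  have mS : measurable_fun circ (fun x => (lim_rtp a x - rtp K a x) ^+ 2).
    by apply/measurable_funX/measurable_funB; [exact: measurable_lim_rtp|exact:
      measurable_rtp_circ].
  apply: ge0_circ_int => [//|x|]; first exact: sqr_ge0.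
  have ft := fatou mu (@circle_measurable R) mf f0.
  apply: (@le_trans _ _ (\int[mu]_(x in circ) limn_einf (f ^~ x))%E); last first.
    apply: le_trans ft _; rewrite limn_einf_lim; apply: lime_le; first exact:
      is_cvg_einfs.
    apply: nearW => n; apply: (@le_trans _ _ (\int[mu]_(x in circ) f n x)%E).
      by apply: ereal_inf_lbound; exists n => /=.
    rewrite /f circ_intE; last by have [] := L2B (L2_rtp (4 ^ (n + K)) a) (L2_rtp K a).
    rewrite lee_fin -dist2E; apply: dist2_rtp_le.
    by apply: ltnW; apply: (leq_ltn_trans (leq_addl n K)); exact: ltn_expl.
  have ae : {ae mu, forall x, circ x -> ((lim_rtp a x - rtp K a x) ^+ 2)%:E = limn_einf
    (f ^~ x)}.
    have := lim_rtp_ae; apply: ae_mono => x hx cx; have {}hx := hx cx.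
    apply/esym; apply: (cvg_limn_einf_sup _).1; apply: cvg_EFin; first exact: nearW.
    rewrite /comp /f /=; rewrite expr2; under eq_fun do rewrite expr2.
    have c : rtp (4 ^ (j + K)) a x @[j --> \oo] --> lim_rtp a x.
      exact: (cvg_comp (fun j => j + K)%N (fun j => rtp (4 ^ j) a x) (cvg_addnr K) hx).
    by apply: cvgM; (apply: cvgB; [exact: c|exact: cvg_cst]).
  rewrite (ae_int_eq _ _ ae) //; first exact/measurable_EFinP.
  have -> : (fun x => limn_einf (f ^~ x)) = (fun x => - limn_esup (fun j => - f j x))%E.
    by apply/funext => x; rewrite -[X in (- limn_esup X)%E]/(-%E \o (f ^~ x))
      limn_esupN oppeK.
  apply: measurableT_comp => //; apply: measurable_fun_limn_esup => n.
  by apply: measurableT_comp => //; exact: mf.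
split => [//||K]; last by rewrite dist2E; exact: (key K).2.
have := key 0%N; move=> [h _].
have h1 : L2 (fun x => lim_rtp a x - rtp 0 a x).
  by split => //; apply: measurable_funB; [exact: measurable_lim_rtp|exact:
    measurable_rtp_circ].
have := L2D h1 (L2_rtp 0 a); congr L2; apply/funext => x; by rewrite subrK.
Qed.

End Tail.

Lemma repr_ae f g a M : {ae mu, forall x, circ x -> f x = g x} -> measurable_fun circ g ->
  repr f a M -> repr g a M.
Proof.
move=> hae mg [ha hf hM]; have [mf if2] := hf.
have ig2 : L2 g.
  split=> //; apply: (ge0_circ_int (A := \int[mu]_(x in circ) (f x ^+ 2)) _ _ _).1.
  - exact: measurable_funX.
  - by move=> x; exact: sqr_ge0.
  rewrite -circ_intE // (@ae_int_eq (fun x => (g x ^+ 2)%:E) (fun x => (f x ^+ 2)%:E)) //.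
  - by apply/measurable_EFinP; exact: measurable_funX.
  - by apply/measurable_EFinP; exact: measurable_funX.
  - by move: hae; apply: ae_mono => x hx cx; rewrite hx.
split=> // K; apply: le_trans (hM K); rewrite !dist2E.
have [_ h1] := L2B hf (L2_rtp K a); have [_ h2] := L2B ig2 (L2_rtp K a).
rewrite -lee_fin -!circ_intE //.
rewrite (@ae_int_eq (fun x => ((g x - rtp K a x) ^+ 2)%:E) (fun x => ((f x - rtp K a x)
  ^+ 2)%:E)) //.
- by case/integrableP: h2.
- by case/integrableP: h1.
- by move: hae; apply: ae_mono => x hx cx; rewrite hx.
Qed.

End RieszFischer.

(** * The sphere constraint *)

Section SphereConstraint.
Variable R : realType.
Local Notation mu := (@lebesgue_measure R).
Local Notation circ := (@circle R).
Local Notation C := R[i].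
Let circ_measurable : measurable (circ : set (measurableTypeR R)) := @circle_measurable R.
Hint Resolve circ_measurable : core.

(** The primitive starts at -1 and is used with b = 2 pi + 1, so that it has a two-sided derivative
    at every point of [0, 2 pi], end points included. *)
Lemma antiderivative (f : R -> R) (b : R) : continuous f ->
  exists Q : R -> R, forall x : R, -1 < x < b -> is_derive x (1 : R) Q (f x).
Proof.
move=> cf; exists (fun x => \int[mu]_(t in `[-1, x]) f t) => x /andP[h1 h2].
have ii : mu.-integrable `[-1, b] (EFin \o f).
  by apply: continuous_compact_integrable; [exact: segment_compact|exact:
    continuous_subspaceT].
have [d1 d2] := continuous_FTC1_closed h2 ii h1 (cf x).
by rewrite -d2 derive1E; apply: DeriveDef.
Qed.

Lemma cos_ge (a : R) : 1 - cos a <= `|a|.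
Proof.
wlog a0 : a / 0 <= a.
  move=> H; have [/H //|h] := leP 0 a.
  by rewrite -cosN -normrN; apply: H; rewrite oppr_ge0 ltW.
have d (x : R) : x \in `]0, a[ -> is_derive x (1 : R) cos (- sin x).
  by move=> _; exact: is_derive_cos.
have cc : {within `[0, a], continuous cos} by apply: continuous_subspaceT; exact:
  continuous_cos.
have [c _] := MVT_segment a0 d cc; rewrite cos0 subr0 => h.
rewrite ger0_norm //.
have := sin_geN1 c; have := sin_le1 c => h1 h2; nra.
Qed.

Variable n : nat.
Local Notation N := (n.*2.+1).
Local Notation G := 'I_n.*2.+1.

Lemma lattice_parseval (b : int -> C) :
  \sum_(j : G) csq (symsum n (fun k => node R j ^ k * b k)) =
  N%:R * symsum n (fun k => csq (b k)).
Proof.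
pose B (a : G) : C := b (rep a).
have zE (j : G) : symsum n (fun k => node R j ^ k * b k) = \sum_a chi R j a * B a.
  rewrite -symsum_zp; apply: eq_symsum => k hk.
  by rewrite chi_zp /B rep_zp.
have bE : symsum n (fun k => csq (b k)) = \sum_a csq (B a).
  by rewrite -symsum_zp; apply: eq_symsum => k hk; rewrite /B rep_zp.
have csqE (z : C) : (csq z)%:C = z * z^* .
  by rewrite conjCE; case: z => x y; apply: complex_eq; rewrite /csq /=; ring.
rewrite bE; apply: (@complexI R); rewrite rmorphM raddf_sum /=.
rewrite (eq_bigr (fun j => \sum_a \sum_c (B a * (B c)^*) * chi R j (a - c))); last first.
  move=> j _; rewrite csqE zE rmorph_sum big_distrl /=; apply: eq_bigr => a _.
  rewrite big_distrr /=; apply: eq_bigr => c _.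
  rewrite rmorphM /= chi_conjr -mulrA [B a * _ * _]mulrC. 
  rewrite (chiC R j (a - c)) chiD -!(chiC R j); ring.
rewrite exchange_big /= raddf_sum /= big_distrr /=; apply: eq_bigr => a _.
rewrite exchange_big /= (bigD1 a) //= [X in _ + X]big1 ?addr0.
  rewrite -big_distrr /= chi_sum subrr eqxx card_ord csqE mulr1n rmorph_nat; ring.
move=> c ca; rewrite -big_distrr /= chi_sum subr_eq0 eq_sym (negbTE ca) mulr0n mulr0 //.
Qed.

Lemma interpE (f : G -> 'rV[R]_3) x i : interp f x 0 i = rtp n (fun k => dft f k 0 i) x.
Proof.
rewrite /interp mxE symsum_mxE /rtp; congr (Re _); apply: eq_symsum => k _.
by rewrite !mxE mulrC.
Qed.

Lemma dft_conj_sym (f : G -> 'rV[R]_3) i : conj_sym (fun k => dft f k 0 i).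
Proof. by move=> k; exact: dft_real. Qed.

Lemma interp_node (f : G -> 'rV[R]_3) (j : G) i :
  (f j 0 i)%:C = symsum n (fun k => node R j ^ k * dft f k 0 i).
Proof.
rewrite (hat_inv (@chiD R n) (@chiC R n) (@chi_conj R n) (@chi_sum R n) (fun j => f j 0
  i) j).
by rewrite -symsum_zp; apply: eq_symsum => k _; rewrite chi_zp dft_vhat mxE.
Qed.

Section Field.
Variable s : G -> 'rV[R]_3.
Hypothesis hs : forall j, sphere2 (s j).
Local Notation u := (interp s).
Local Notation xj j := (2 * pi * (j : nat)%:R / N%:R : R).

Lemma node_shift (j : G) y k : expi (xj j + y) ^ k = node R j ^ k * expi y ^ k.
Proof. by rewrite expiD expfzMl. Qed.

(** At the nodes, the interpolation shifted by y minus the data has coefficients (e^{iky} - 1) c_k,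
    and |e^{iky} - 1|^2 = 2 (1 - cos(k y)) <= 2 |k| y <= 4 y lam k. Parseval on the lattice supplies
    the factor N. *)
Lemma shift_energy y : 0 <= y ->
  \sum_(j : G) \sum_(i < 3) (u (xj j + y) 0 i - s j 0 i) ^+ 2 <= 4 * N%:R * y * energy s.
Proof.
move=> y0; rewrite exchange_big /= energyE.
have E i : \sum_(j : G) (u (xj j + y) 0 i - s j 0 i) ^+ 2 =
    N%:R * symsum n (fun k => csq (dft s k 0 i) * csq (expi y ^ k - 1)).
  have hm k : csq (dft s k 0 i) * csq (expi y ^ k - 1) = csq ((expi y ^ k - 1) * dft s
    k 0 i).
    by rewrite /csq; case: (_ - 1) => a b; case: (dft _ _ _ _) => c d /=; ring.
  rewrite (eq_symsum (fun k _ => hm k)) -lattice_parseval; apply: eq_bigr => j _.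
  have -> : symsum n (fun k => node R j ^ k * ((expi y ^ k - 1) * dft s k 0 i)) =
     (u (xj j + y) 0 i - s j 0 i)%:C.
    rewrite rmorphB /= interp_node interpE rtp_real; last exact: dft_conj_sym.
    apply/eqP; rewrite eq_sym subr_eq -symsumD; apply/eqP; apply: eq_symsum => k _.
    by rewrite node_shift; move: (dft _ _ _ _) (node R j ^ k) (expi y ^ k) => p1 p2 p3;
      ring.
  by rewrite /csq /=; ring.
rewrite (eq_bigr _ (fun i _ => E i)) -big_distrr /= -!mulrA mulrCA ler_pM2l ?ltr0n //.
rewrite (eq_bigr (fun i => \sum_(k <- sseq n) csq (dft s k 0 i) * csq (expi y ^ k -
  1))); last first.
  by move=> i _; rewrite symsumE.
rewrite exchange_big /= -symsumE -symsumZ -symsumZ; apply: ler_symsum => k hk.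
rewrite -big_distrl /= -[\sum_(i < 3) _]/(\sum_(i < 3) csq (dft s k 0 i)).
have -> : \sum_(i < 3) csq (dft s k 0 i) = cnormsq (dft s k) by rewrite cnormsqE.
have -> : 4 * (y * (lam R n k * cnormsq (dft s k))) = cnormsq (dft s k) * (4 * y * lam
  R n k) by ring.
apply: ler_wpM2l; first exact: cnormsq_ge0.
have /andP[h1 _] := lam_small R hk.
have -> : csq (expi y ^ k - 1) = 2 * (1 - cos (k%:~R * y)).
  rewrite expi_int /csq /=; have := cos2Dsin2 (k%:~R * y : R); rewrite subr0.
  move: (cos _) (sin _) => c d h; have : c ^+ 2 + d ^+ 2 = 1 by []. nra.
have := cos_ge (k%:~R * y); rewrite normrM (ger0_norm y0) => h2.
nra.
Qed.

(** The circle is folded onto one cell of length h = 2 pi / N. A value at a shifted node is a unit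
    vector s plus a displacement w; its defect |w|^2 + 2 w . s is at most d + (1 + 1/d) |w|^2 by
    AM-GM, and [shift_energy] bounds the sum of the |w|^2. *)
Lemma sphere_defect_le (d : R) : 0 < d ->
  \int[mu]_(x in circ) `|\sum_(i < 3) u x 0 i ^+ 2 - 1| <=
  2 * pi * (d + (1 + d^-1) * (4 * (2 * pi / N%:R) * energy s)).
Proof.
move=> d0.
pose q x := \sum_(i < 3) u x 0 i ^+ 2 - 1.
have cu i : continuous (fun x => u x 0 i).
  have -> : (fun x => u x 0 i) = rtp n (fun k => dft s k 0 i) by apply/funext => x;
    exact: interpE.
  exact: rtp_cont.
have cq : continuous (fun x => `|q x|).
  move=> x; apply: cvg_norm; apply: cvgB; last exact: cvg_cst.
  have -> : (fun x => \sum_(i < 3) u x 0 i ^+ 2) =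
     (fun x => u x 0 0 * u x 0 0 + u x 0 1 * u x 0 1 + u x 0 2%:R * u x 0 2%:R).
    by apply/funext => z; rewrite sum3E !expr2.
  have -> : \sum_(i < 3) u x 0 i ^+ 2 = u x 0 0 * u x 0 0 + u x 0 1 * u x 0 1 + u x 0
    2%:R * u x 0 2%:R.
    by rewrite sum3E !expr2.
  by apply: cvgD; [apply: cvgD|]; apply: cvgM; exact: cu.
have [Q dQ] := antiderivative (2 * pi + 1) cq.
have p0 : 0 < 2 * pi :> R := twopi_gt0 R.
have dQ' (x : R) : 0 <= x <= 2 * pi -> is_derive x (1 : R) Q `|q x|.
  by move=> /andP[h1 h2]; apply: dQ; rewrite (lt_le_trans _ h1) ?ltrN10 //=
    (le_lt_trans h2) // ltrDl.
have -> := circ_FTC dQ' cq.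
have N0 : 0 < N%:R :> R by rewrite ltr0n.
pose h : R := 2 * pi / N%:R.
have h0 : 0 < h by rewrite divr_gt0.
have hx (j : nat) : 2 * pi * j%:R / N%:R = h * j%:R by rewrite /h mulrAC.
have hN : h * N%:R = 2 * pi by rewrite /h divfK // gt_eqF.
(* F' is the sum of the defects at the nodes shifted by y. Telescoping gives Q (2 pi) - Q 0 = F h -
   F 0, and the mean value theorem then puts a single shift y in place of the integral over the
   cell. *)
pose F y := \sum_(j < N) (Q (h * (j : nat)%:R + y)).
have tele : Q (2 * pi) - Q 0 = F h - F 0.
  rewrite /F -sumrB -hN -[in Q 0](mulr0 h) -(mulr0n 1) -(telescope_sumr (fun j => Q (h
    * j%:R))) // big_mkord.
  by apply: eq_bigr => j _; rewrite addr0 -natr1 mulrDr mulr1.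
have rng (j : 'I_N) y : 0 <= y <= h -> -1 < h * (j : nat)%:R + y < 2 * pi + 1.
  move=> /andP[y0 yh]; have j0 : 0 <= h * (j : nat)%:R by rewrite mulr_ge0 // ltW.
  have : h * (j : nat).+1%:R <= 2 * pi by rewrite -hN ler_pM2l // ler_nat.
  rewrite -natr1 mulrDr mulr1; lra.
have dF (y : R) : 0 <= y <= h -> is_derive y (1 : R) F (\sum_(j < N) `|q (h * (j :
  nat)%:R + y)|).
  move=> hy.
  have -> : F = \sum_(j < N) (fun y => Q (h * (j : nat)%:R + y)).
    by apply/funext => z; rewrite fct_sumE.
  apply: is_derive_sum => j.
  have := @is_derive1_comp _ Q (fun y => h * (j : nat)%:R + y) y _ 1 (dQ _ (rng j y hy)).
  rewrite mulr1; apply.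
  have := @is_deriveD _ _ _ (cst (h * (j : nat)%:R)) id y 1 0 1 _ _; rewrite add0r; exact.
have dF' (y : R) : y \in `]0, h[ -> is_derive y (1 : R) F (\sum_(j < N) `|q (h * (j :
  nat)%:R + y)|).
  by rewrite in_itv /= => /andP[/ltW ? /ltW ?]; apply: dF; apply/andP.
have cF : {within `[0, h], continuous F}.
  apply: derivable_within_continuous => y; rewrite in_itv /= => hy.
  by have [] := dF y hy.
have [y] := MVT_segment (ltW h0) dF' cF; rewrite in_itv /= => /andP[y0 yh].
rewrite tele => ->; rewrite subr0.
have key : \sum_(j < N) `|q (h * (j : nat)%:R + y)| <= N%:R * d + (1 + d^-1) * (4 *
  N%:R * h * energy s).
  have E0 : 0 <= energy s.
    by rewrite energyE; apply: symsum_ge0 => k; rewrite mulr_ge0 ?lam_ge0 ?cnormsq_ge0.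
  apply: (@le_trans _ _ (\sum_(j < N) (d + (1 + d^-1) * \sum_(i < 3) (u (xj j + y) 0 i
    - s j 0 i) ^+ 2))).
    apply: ler_sum => j _; rewrite -hx; set z := xj j + y.
    have sj := sphere2_dotp (hs j).
    have -> : q z = dotp (u z - s j) (u z - s j) + 2 * dotp (u z - s j) (s j).
      rewrite /q; have -> : \sum_(i < 3) u z 0 i ^+ 2 = dotp (u z) (u z).
        by rewrite /dotp; apply: eq_bigr => i _; rewrite expr2.
      by rewrite !dotpBl !dotpBr sj (dotpC (s j)); ring.
    have -> : \sum_(i < 3) (u z 0 i - s j 0 i) ^+ 2 = dotp (u z - s j) (u z - s j).
      by rewrite /dotp; apply: eq_bigr => i _; rewrite !mxE expr2.
    set w := u z - s j.
    have := dotp_amgm (d^-1 *: w) (s j); rewrite !dotpZl !dotpZr sj => hh.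
    have w0 := dotp_ge0 w.
    apply: le_trans (ler_normD _ _) _; rewrite (ger0_norm w0) normrM.
    have dd0 : d^-1 * d = 1 by rewrite mulVf // gt_eqF.
    have d1 : 0 < d^-1 by rewrite invr_gt0.
    move: hh; rewrite !normrM !(gtr0_norm d1) => hh.
    have := ler_wpM2l (ltW d0) hh; rewrite mulrDr mulr1 (mulrA d 2) (mulrC d 2) -(mulrA
      2 d).
    rewrite !(mulrA d d^-1) (mulrC d) dd0 !mul1r (@ger0_norm _ 2) // => h3.
    move: h3; move: (`|dotp w (s j)|) (dotp w w) => t r; lra.
  rewrite big_split /= sumr_const card_ord -[d *+ _]mulr_natl lerD2l -big_distrr /=.
  rewrite ler_wpM2l //; first by rewrite addr_ge0 // invr_ge0 ltW.
  apply: le_trans (shift_energy y0) _; rewrite ler_wpM2r // ler_wpM2l //.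
have := ler_wpM2r (ltW h0) key => /le_trans; apply.
have -> : (N%:R * d + (1 + d^-1) * (4 * N%:R * h * energy s)) * h =
  (h * N%:R) * (d + (1 + d^-1) * (4 * h * energy s)) by ring.
by rewrite hN.
Qed.

End Field.

(** [dft] is N-periodic in k; the Fourier coefficients of the interpolation are its values for |k|
    <= n, extended by 0 ([fourier_interp]). *)
Definition tdft (f : G -> 'rV[R]_3) (k : int) : 'rV[C]_3 :=
  if (`|k| <= n)%N then dft f k else 0.

Lemma hsum_tdft (s : G -> 'rV[R]_3) r m : hsum r (tdft s) m <= hsum r (dft s) n.
Proof. exact: hsum_trunc. Qed.

Lemma tail_hbd (c : int -> 'rV[C]_3) (M : R) i : hbd 2^-1 c M -> forall K J, (K <= J)%N ->
  symsum J (fun k => csq (c k 0 i)) - symsum K (fun k => csq (c k 0 i)) <= M / K.+1%:R.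
Proof.
move=> hc K J KJ; have h0 k : 0 <= csq (c k 0 i) by rewrite addr_ge0 ?sqr_ge0.
apply: le_trans (symsum_tail_wt KJ h0 (norm_le_wt_half R)) _.
rewrite ler_pM2r ?invr_gt0 ?ltr0n //; apply: le_trans (hc J).
apply: ler_symsum => k _; apply: ler_wpM2l; first exact: wt_ge0.
exact: sqr_coord_le.
Qed.

Lemma interp_repr (s : G -> 'rV[R]_3) (M : R) i : hbd 2^-1 (tdft s) M ->
  repr (fun x => interp s x 0 i) (fun k => tdft s k 0 i) M.
Proof.
move=> hM; have cs : conj_sym (fun k => tdft s k 0 i).
  move=> k; rewrite /tdft abszN; case: ifP => _; first exact: dft_real.
  by rewrite mxE rmorph0.
have E J : (n <= J)%N -> (fun x => interp s x 0 i) = rtp J (fun k => tdft s k 0 i).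
  move=> nJ; apply/funext => x; rewrite interpE /rtp; congr (Re _).
  rewrite [RHS](symsum_widen nJ); first by apply: eq_symsum => k hk; rewrite /tdft hk.
  by move=> k hk; rewrite /tdft leqNgt hk /= mxE mul0r.
split => //; first by rewrite (E n) //; exact: L2_rtp.
move=> K; rewrite (E (maxn n K)) ?leq_maxl //; apply: dist2_rtp_le => //; last exact:
  leq_maxr.
exact: tail_hbd.
Qed.

Lemma fourier_interp (s : G -> 'rV[R]_3) : fourier (interp s) = tdft s.
Proof.
apply/funext => k; apply/rowP => i; rewrite fourierE.
have -> : (fun x => interp s x 0 i) = rtp n (fun k => dft s k 0 i).
  by apply/funext => x; exact: interpE.
rewrite fhat_rtp; last exact: dft_conj_sym.
by rewrite /tdft; case: ifP; rewrite ?mxE.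
Qed.

End SphereConstraint.

Section SphereLimit.
Variable R : realType.
Local Notation mu := (@lebesgue_measure R).
Local Notation circ := (@circle R).
Local Notation C := R[i].
Let circ_measurable : measurable (circ : set (measurableTypeR R)) := @circle_measurable R.
Hint Resolve circ_measurable : core.

(** The defect of S is at most that of the interpolation u_j plus d |S|^2 + (1 + 1/d) |S - u_j|^2.
    At fixed d, j tends to infinity by strong L^2 convergence and [sphere_defect_le]; then d tends
    to 0. Weak convergence alone would not preserve the constraint. *)
Lemma sphere_ae (nj : nat -> nat) (s_ : forall j, 'I_(nj j).*2.+1 -> 'rV[R]_3)
    (c : int -> 'rV[C]_3) (S : 'I_3 -> R -> R) (E M M' : R) :
  (forall K, \forall j \near \oo, (K <= nj j)%N) ->
  (forall j k, sphere2 (s_ j k)) -> (forall j, energy (s_ j) <= E) ->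
  (forall i, repr (S i) (fun k => c k 0 i) M) ->
  (forall j, hbd 2^-1 (tdft (s_ j)) M') ->
  (forall k, vcvg (fun j => tdft (s_ j) k) (c k)) ->
  {ae mu, forall x, circ x -> \sum_(i < 3) S i x ^+ 2 = 1}.
Proof.
move=> hnj hs hE hS hM' hc.
pose u j i x := interp (s_ j) x 0 i.
have hu j i : repr (u j i) (fun k => tdft (s_ j) k 0 i) M' by exact: interp_repr.
have LS i : L2 (S i) := repr_L2 (hS i).
have Lu j i : L2 (u j i) := repr_L2 (hu j i).
have hD i : dist2 (S i) (u j i) @[j --> \oo] --> (0 : R).
  by apply: (repr_cvg (hS i) (fun j => hu j i)) => k; exact: hc.
pose q x := \sum_(i < 3) S i x ^+ 2 - 1.
have intsq (f : 'I_3 -> R -> R) : (forall i, L2 (f i)) -> circ_int (fun x => \sum_(i <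
  3) f i x ^+ 2).
  by move=> hf; apply: (@circ_int_sum _ _ _ (fun i x => f i x ^+ 2)) => i; have [] :=
    hf i.
have iq : circ_int q.
  have := circ_intD (intsq _ LS) (circ_int_cst (-1 : R)); exact.
have inorm (f : R -> R) : circ_int f -> circ_int (fun x => `|f x|).
  by move=> /integrable_norm.
pose X := \int[mu]_(x in circ) `|q x|.
pose A := \int[mu]_(x in circ) (\sum_(i < 3) S i x ^+ 2).
have A0 : 0 <= A by apply: Rintegral_ge0 => x _; apply: sumr_ge0 => i _; exact: sqr_ge0.
have p0 : 0 < 2 * pi :> R := twopi_gt0 R.
have bound (d : R) j : 0 < d -> X <= d * (A + 2 * pi) + (1 + d^-1) * (\sum_(i < 3)
  dist2 (S i) (u j i) +
    2 * pi * (4 * (2 * pi) * E) / (nj j).+1%:R).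
  move=> d0; have d1 : 0 < d^-1 by rewrite invr_gt0.
  pose r x := \sum_(i < 3) u j i x ^+ 2 - 1.
  have ir : circ_int r by have := circ_intD (intsq _ (Lu j)) (circ_int_cst (-1 : R));
    exact.
  pose w x := \sum_(i < 3) (S i x - u j i x) ^+ 2.
  have iw : circ_int w by apply: (intsq (fun i x => S i x - u j i x)) => i; exact: L2B.
  have h1 : X <= \int[mu]_(x in circ) (`|r x| + (d * \sum_(i < 3) S i x ^+ 2 + (1 +
    d^-1) * w x)).
    apply: le_Rintegral => //; first exact: inorm.
      apply: circ_intD; first exact: inorm.
      by apply: circ_intD; apply: circ_intZ => //; exact: intsq.
    move=> x _.
    have -> : q x = r x + \sum_(i < 3) (S i x ^+ 2 - u j i x ^+ 2).
      by rewrite /q /r sumrB; ring.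
    apply: le_trans (ler_normD _ _) _; rewrite lerD2l.
    apply: le_trans (ler_norm_sum _ _ _) _.
    rewrite /w !big_distrr -big_split /=; apply: ler_sum => i _.
    move: (S i x) (u j i x) => y z.
    (* Expanding around the limit y, not around the interpolation z, leaves d |S|^2 as the only term
       that does not tend to 0, and its integral does not depend on j. *)
    have -> : y ^+ 2 - z ^+ 2 = 2 * y * (y - z) - (y - z) ^+ 2 by ring.
    have -> : (1 + d^-1) * (y - z) ^+ 2 = (y - z) ^+ 2 + d^-1 * (y - z) ^+ 2 by ring.
    have w0 := sqr_ge0 (y - z).
    have hp := mulr_ge0 (ltW d1) (sqr_ge0 (d * y + (y - z))).
    have hm := mulr_ge0 (ltW d1) (sqr_ge0 (d * y - (y - z))).
    have ep : d^-1 * (d * y + (y - z)) ^+ 2 = d * y ^+ 2 + 2 * y * (y - z) + d^-1 * (y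
      - z) ^+ 2.
      by field; rewrite gt_eqF.
    have em : d^-1 * (d * y - (y - z)) ^+ 2 = d * y ^+ 2 - 2 * y * (y - z) + d^-1 * (y
      - z) ^+ 2.
      by field; rewrite gt_eqF.
    move: hp hm w0; rewrite ep em.
    move: (d * y ^+ 2) (2 * y * (y - z)) ((y - z) ^+ 2) (d^-1 * _) => a b e g hp hm w0.
    by rewrite ler_norml; apply/andP; split; lra.
  have e1 : \int[mu]_(x in circ) w x = \sum_(i < 3) dist2 (S i) (u j i).
    rewrite (@circ_int_of_sum _ _ _ (fun i x => (S i x - u j i x) ^+ 2)); last first.
      by move=> i; have [] := L2B (LS i) (Lu j i).
    by apply: eq_bigr => i _; rewrite dist2E.
  have h2 : \int[mu]_(x in circ) `|r x| <= 2 * pi * (d + (1 + d^-1) * (4 * (2 * pi) * E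
    / (nj j).+1%:R)).
    apply: le_trans (sphere_defect_le (hs j) d0) _.
    rewrite ler_pM2l // lerD2l ler_pM2l; last by rewrite addr_gt0.
    have E0 : 0 <= energy (s_ j).
      by rewrite energyE; apply: symsum_ge0 => k; rewrite mulr_ge0 ?lam_ge0 ?cnormsq_ge0.
    have -> : 4 * (2 * pi) * E / (nj j).+1%:R = (4 * (2 * pi / (nj j).+1%:R)) * E by ring.
    apply: ler_pM => //; first by rewrite mulr_ge0 // divr_ge0 // ltW.
    rewrite ler_pM2l // ler_pM2l // lef_pV2 ?posrE ?ltr0n // ler_nat ltnS -addnn;
      exact: leq_addr.
  apply: le_trans h1 _.
  rewrite RintegralD //; [|exact: inorm|by apply: circ_intD; apply: circ_intZ => //;
    exact: intsq].
  rewrite RintegralD //; [|by apply: circ_intZ; exact: intsq|exact: circ_intZ].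
  rewrite !RintegralZl //; last exact: intsq.
  rewrite e1 -/A; apply: le_trans (lerD h2 (lexx _)) _; rewrite le_eqVlt; apply/orP;
    left; apply/eqP.
  by move: (\sum_(i < 3) _) ((nj j).+1%:R^-1) (d^-1) => a b e; ring.
have X0 : X <= 0.
  have step (d : R) : 0 < d -> X <= d * (A + 2 * pi).
    move=> d0.
    have c1 : \sum_(i < 3) dist2 (S i) (u j i) @[j --> \oo] --> \sum_(i < 3) (0 : R).
      by apply: (@cvg_sumr R 'I_3 _ (fun j i => dist2 (S i) (u j i)) (fun=> 0)).
    have c2 : ((nj j).+1%:R)^-1 @[j --> \oo] --> (0 : R).
      apply/cvgrPdist_le => e e0; apply: filterS (hnj (Num.bound e^-1)) => j hj.
      rewrite sub0r normrN ger0_norm // invf_ple ?posrE ?ltr0n //.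
      apply/ltW/(lt_le_trans (archi_boundP _)); first by rewrite invr_ge0 ltW.
      by rewrite ler_nat (leq_trans hj).
    have c3 : d * (A + 2 * pi) + (1 + d^-1) * (\sum_(i < 3) dist2 (S i) (u j i) +
    2 * pi * (4 * (2 * pi) * E) / (nj j).+1%:R) @[j --> \oo] -->
      d * (A + 2 * pi) + (1 + d^-1) * (\sum_(i < 3) (0 : R) + 2 * pi * (4 * (2 * pi) *
        E) * 0).
      apply: cvgD; first exact: cvg_cst.
      apply: cvgM; first exact: cvg_cst.
      by apply: cvgD => //; apply: cvgM => //; exact: cvg_cst.
    move: c3; rewrite big1 // mulr0 addr0 mulr0 addr0 => c3.
    apply: (cvgr_to_ge c3); apply: nearW => j; exact: bound.
  apply/ler_addgt0Pr => e e0; rewrite add0r.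
  have AA : 0 < A + 2 * pi by rewrite ltr_wpDl.
  have := step (e / (A + 2 * pi)) (divr_gt0 e0 AA).
  by rewrite divfK // gt_eqF.
have XE : (\int[mu]_(x in circ) `|(q x)%:E| = 0)%E.
  have -> : (\int[mu]_(x in circ) `|(q x)%:E| = \int[mu]_(x in circ) (`|q x|)%:E)%E by [].
  rewrite circ_intE; last exact: inorm.
  by congr EFin; apply/eqP; rewrite eq_le X0 /=; apply: Rintegral_ge0.
have mq : measurable_fun circ (EFin \o q) by case/integrableP: iq.
have := (ae_eq_integral_abs mu circ_measurable mq).1 XE.
apply: ae_mono => x hx cx; have := hx cx => -[] /eqP; rewrite /q subr_eq0 => /eqP //.
Qed.

End SphereLimit.

(** * Products with a sphere-valued map *)

Section Shift.
Variable R : realType.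
Implicit Types F G : int -> R.

Lemma symsum_shift_le G n k : (forall l, 0 <= G l) ->
  symsum n (fun l => G (k - l)) <= symsum (n + `|k|) G.
Proof.
move=> G0; rewrite !symsumE -(big_map (fun l => k - l) xpredT).
set s1 := map _ _; set s2 := sseq _.
have u1 : uniq s1 by rewrite map_inj_uniq ?sseq_uniq // => x y /addrI /oppr_inj.
have sub x : x \in s1 -> x \in s2.
  by move=> /mapP[y]; rewrite !mem_sseq => hy ->; lia.
have u2 : uniq s2 by exact: sseq_uniq.
clearbody s2; clearbody s1.
rewrite [leRHS](bigID (mem s1)) /= -[leLHS]addr0; apply: lerD; last exact: sumr_ge0.
rewrite -[leRHS]big_filter (perm_big [seq i <- s2 | i \in s1]) //.
apply: uniq_perm => //; first by rewrite filter_uniq.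
by move=> x; rewrite mem_filter; case h : (x \in s1) => //=; rewrite sub.
Qed.

Lemma cvg_symsum_shift0 G (L : R) k : (forall l, 0 <= G l) ->
  (fun n => symsum n G) @ \oo --> L -> (fun n => symsum n (fun l => G (k - l))) @ \oo
    --> L.
Proof.
move=> G0 h; pose H n := symsum n (fun l => G (k - l)).
have lo n : symsum n G <= H (n + `|k|)%N.
  have := @symsum_shift_le (fun l => G (k - l)) n k (fun l => G0 _).
  by congr (_ <= _); apply: eq_symsum => l _; rewrite opprB addrC subrK.
have c : (fun n => H (n + `|k|)%N) @ \oo --> L.
  apply: (@squeeze_cvgr _ _ _ _ (fun n => symsum n G) (fun n => symsum (n + `|k| +
    `|k|) G)) => //.
    by apply: nearW => n; rewrite lo symsum_shift_le.
  apply: (cvg_comp (fun n => n + `|k| + `|k|)%N (fun n => symsum n G) _ h).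
  under eq_fun do rewrite -addnA; exact: cvg_addnr.
by rewrite -(cvg_shiftn `|k|).
Qed.

(** Absolute convergence makes symmetric sums insensitive to recentring; the signed case is a
    difference of two nonnegative ones. In [test_sum_lim] it exchanges truncation of S for
    truncation of phi. *)
Lemma cvg_symsum_shift F (A L : R) k : (forall n, symsum n (fun l => `|F l|) <= A) ->
  (fun n => symsum n F) @ \oo --> L -> (fun n => symsum n (fun l => F (k - l))) @ \oo
    --> L.
Proof.
move=> hA hL.
have /cvg_ex [L' hL'] : cvgn (fun n => symsum n (fun l => `|F l|)).
  by apply: (@symsum_cvg _ _ A) => n; rewrite (eq_symsum (G := fun l => `|F l|)) // =>
    l _; rewrite normr_id.
have h1 := cvg_symsum_shift0 k (fun l => normr_ge0 (F l)) hL'.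
have h2 : (fun n => symsum n (fun l => F l + `|F l|)) @ \oo --> L + L'.
  under eq_fun do rewrite symsumD; exact: cvgD.
have h3 := cvg_symsum_shift0 k _ h2.
have {}h3 : (fun n => symsum n (fun l => F (k - l) + `|F (k - l)|)) @ \oo --> L + L'.
  by apply: h3 => l; rewrite addrC -lerBlDr sub0r -normrN ler_norm.
have -> : L = L + L' - L' by rewrite addrK.
have -> : (fun n => symsum n (fun l => F (k - l))) =
  fun n => symsum n (fun l => F (k - l) + `|F (k - l)|) - symsum n (fun l => `|F (k -
    l)|).
  by apply/funext => n; rewrite symsumD addrK.
exact: cvgB.
Qed.

End Shift.

Section Products.
Variable R : realType.
Local Notation mu := (@lebesgue_measure R).
Local Notation circ := (@circle R).
Local Notation C := R[i].
Local Notation cvec3 := 'rV[R[i]]_3.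
Implicit Types (f g S : R -> R) (a : int -> C).

Lemma fhat_rtpM f J a k : L2 f -> conj_sym a ->
  fhat (fun x => rtp J a x * f x) k = symsum J (fun l => a l * fhat f (k - l)).
Proof.
move=> hf ha.
have key x : (rtp J a x)%:C * expi x ^ (- k) = symsum J (fun l => a l * expi x ^ (- (k
  - l))).
  rewrite rtp_real // mulr_symsuml; apply: eq_symsum => l _.
  by rewrite -mulrA -expfzDr ?expi_neq0 // opprB.
apply: complex_eq.
  rewrite fhatRe raddf_symsum.
  have -> : ip (fun x => rtp J a x * f x) (ec k) =
    ip f (fun x => symsum J (fun l => Re (a l) * ec (k - l) x - Im (a l) * es (k - l) x)).
    apply: eq_Rintegral => x _; rewrite mulrAC mulrC; congr (_ * _).
    transitivity (Re ((rtp J a x)%:C * expi x ^ (- k))).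
      by rewrite /ec; case: (expi x ^ _) => u v /=; ring.
    rewrite key raddf_symsum; apply: eq_symsum => l _.
    by rewrite /ec /es; case: (a l) => u v; case: (expi x ^ _).
  rewrite (ip_symsumr J (g_ := fun l x => Re (a l) * ec (k - l) x - Im (a l) * es (k -
    l) x)) //; last first.
    by move=> l; apply: L2B; apply: L2Z; [exact: L2_ec|exact: L2_es].
  rewrite -symsumZ; apply: eq_symsum => l _.
  rewrite ipBr //; [|exact/L2Z/L2_ec|exact/L2Z/L2_es].
  rewrite !ipZr //; [|exact: L2_es|exact: L2_ec].
  have := fhatRe f (k - l); have := fhatIm f (k - l).
  by case: (fhat f (k - l)) (a l) => [p q] [u v] /= -> ->; ring.
rewrite fhatIm raddf_symsum.
have -> : ip (fun x => rtp J a x * f x) (es k) =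
  ip f (fun x => symsum J (fun l => Re (a l) * es (k - l) x + Im (a l) * ec (k - l) x)).
  apply: eq_Rintegral => x _; rewrite mulrAC mulrC; congr (_ * _).
  transitivity (Im ((rtp J a x)%:C * expi x ^ (- k))).
    by rewrite /es; case: (expi x ^ _) => u v /=; ring.
  rewrite key raddf_symsum; apply: eq_symsum => l _.
  by rewrite /ec /es; case: (a l) => u v; case: (expi x ^ _).
rewrite (ip_symsumr J (g_ := fun l x => Re (a l) * es (k - l) x + Im (a l) * ec (k - l)
  x)) //; last first.
  by move=> l; apply: L2D; apply: L2Z; [exact: L2_es|exact: L2_ec].
rewrite -symsumZ; apply: eq_symsum => l _.
rewrite ipDr //; [|exact/L2Z/L2_es|exact/L2Z/L2_ec].
rewrite !ipZr //; [|exact: L2_ec|exact: L2_es].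
have := fhatRe f (k - l); have := fhatIm f (k - l).
by case: (fhat f (k - l)) (a l) => [p q] [u v] /= -> ->; ring.
Qed.

(** Truncations of S converge in L^2 at the rate of [repr], so their products with f converge when
    tested against the bounded functions [ec] and [es]. The bound on S makes the product S f itself
    square integrable. *)
Lemma fhat_prod_lim f S a M k : L2 f -> repr S a M -> (forall x, `|S x| <= 1) ->
  ccvg (fun L => symsum L (fun l => a l * fhat f (k - l))) (fhat (fun x => S x * f x) k).
Proof.
move=> hf hS bS; have [ha LS hM] := hS; have [mS _] := LS.
have LSf : L2 (fun x => S x * f x) by exact: L2_mul bS hf.
have bounded J : exists B : R, forall x, `|rtp J a x| <= B.
  exists (symsum J (fun l => `|Re (a l)| + `|Im (a l)|)) => x.
  rewrite rtpE; apply: le_trans (ler_norm_symsum _ _) _; apply: ler_symsum => l _.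
  apply: le_trans (ler_normD _ _) _; rewrite !normrM.
  by apply: lerD; rewrite ler_piMr // ?ec_le1 ?es_le1.
have LPf J : L2 (fun x => rtp J a x * f x).
  by have [B hB] := bounded J; apply: (L2_mul _ hB hf); exact: measurable_rtp_circ.
have key (e_ : R -> R) J (d : R) : (forall x, `|e_ x| <= 1) -> measurable_fun circ e_
  -> 0 < d ->
  2 * `|ip (fun x => S x * f x) e_ - ip (fun x => rtp J a x * f x) e_| <=
    d * ip f f + (2 * pi * M / J.+1%:R) / d.
  move=> he me d0.
  have Le : L2 (fun x => (S x - rtp J a x) * e_ x).
    have := L2_mul me he (L2B LS (L2_rtp J a)); congr L2; apply/funext => x; by rewrite
      mulrC.
  have Le1 : L2 e_.
    have := L2_mul me he (L2_ec R 0); congr L2; apply/funext => x; by rewrite ecE mul0r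
      cos0 mulr1.
  have -> : ip (fun x => S x * f x) e_ - ip (fun x => rtp J a x * f x) e_ =
     ip f (fun x => (S x - rtp J a x) * e_ x).
    have mc := @circle_measurable R.
    rewrite /ip -RintegralB //; [|exact: circ_intM|exact: circ_intM].
    by apply: eq_Rintegral => x _; ring.
  apply: le_trans (ip_amgm hf Le d0) _; rewrite lerD2l ler_pM2r ?invr_gt0 //.
  apply: le_trans (hM J); rewrite dist2E; apply: le_Rintegral.
  - exact: (@circle_measurable R).
  - exact: circ_intM.
  - by have [_] := L2B LS (L2_rtp J a).
  move=> x _; rewrite -expr2 exprMn ler_piMr ?sqr_ge0 //.
  by rewrite -(real_normK (num_real (e_ x))) expr_le1.
have lim (e_ : R -> R) : (forall x, `|e_ x| <= 1) -> measurable_fun circ e_ ->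
   ip (fun x => rtp J a x * f x) e_ @[J --> \oo] --> ip (fun x => S x * f x) e_.
  move=> he me; apply/cvgrPdist_le => e e0.
  have F0 := ip_ge0 f.
  pose d := e / (ip f f + 1).
  have d0 : 0 < d by rewrite divr_gt0 // ltr_wpDl.
  have hd : d * ip f f <= e by rewrite /d mulrAC ler_pdivrMr ?ltr_wpDl // ler_pM2l //
    lerDl.
  pose K := Num.bound (2 * pi * `|M| / d / e).
  exists K => // J /= KJ.
  have h2 : (2 * pi * M / J.+1%:R) / d <= e.
    rewrite [leLHS]mulrAC ler_pdivrMr ?ltr0n // [leRHS]mulrC -ler_pdivrMr //.
    apply: (@le_trans _ _ (2 * pi * `|M| / d / e)).
      by rewrite !ler_pM2r ?invr_gt0 // ler_pM2l ?twopi_gt0 // ler_norm.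
    apply/ltW; apply: (lt_le_trans (archi_boundP _)).
      by rewrite !mulr_ge0 ?invr_ge0 ?pi_ge0 // ltW.
    by rewrite ler_nat (leq_trans KJ).
  have aux (x p q e' : R) : 2 * x <= p + q -> p <= e' -> q <= e' -> x <= e' by lra.
  exact: aux (key e_ J d he me d0) hd h2.
have mec : measurable_fun circ (ec k) by have [] := L2_ec R k.
have mes : measurable_fun circ (es k) by have [] := L2_es R k.
split.
  under eq_fun do rewrite -fhat_rtpM // fhatRe.
  rewrite fhatRe; apply: cvgM; first exact: cvg_cst.
  by apply: lim => // x; exact: ec_le1.
under eq_fun do rewrite -fhat_rtpM // fhatIm.
rewrite fhatIm; apply: cvgM; first exact: cvg_cst.
by apply: lim => // x; exact: es_le1.
Qed.

Lemma csqM (z w : C) : csq (z * w) = csq z * csq w.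
Proof. by case: z w => [a b] [c d]; rewrite /csq /=; ring. Qed.

Lemma csqB_le (z w : C) : csq (z - w) <= 2 * (csq z + csq w).
Proof.
case: z w => [a b] [c d]; rewrite /csq /=.
have := sqr_ge0 (a + c); have := sqr_ge0 (b + d); nra.
Qed.

Lemma csq_ge0 (z : C) : 0 <= csq z. Proof. by rewrite addr_ge0 ?sqr_ge0. Qed.

Lemma cnormsq_csq (v : cvec3) : cnormsq v = \sum_(i < 3) csq (v 0 i).
Proof. by rewrite cnormsqE. Qed.

Lemma cnormsq_cross_le (u v : cvec3) : cnormsq (crossp u v) <= 2 * (cnormsq u * cnormsq
  v).
Proof.
have [e0 e1 e2] := crosspE u v.
rewrite !cnormsq_csq !sum3E e0 e1 e2.
have := csqB_le (u 0 1 * v 0 2%:R) (u 0 2%:R * v 0 1).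
have := csqB_le (u 0 2%:R * v 0 0) (u 0 0 * v 0 2%:R).
have := csqB_le (u 0 0 * v 0 1) (u 0 1 * v 0 0).
rewrite !csqM.
have := mulr_ge0 (csq_ge0 (u 0 0)) (csq_ge0 (v 0 0)).
have := mulr_ge0 (csq_ge0 (u 0 1)) (csq_ge0 (v 0 1)).
have := mulr_ge0 (csq_ge0 (u 0 2%:R)) (csq_ge0 (v 0 2%:R)).
move: (csq (_ - _)) (csq (_ - _)) (csq (_ - _)) => x y z.
move: (csq (u 0 0)) (csq (u 0 1)) (csq (u 0 2%:R)) (csq (v 0 0)) (csq (v 0 1)) (csq (v
  0 2%:R)).
move=> a b c d e f h1 h2 h3 h4 h5 h6; nra.
Qed.

Lemma crossE (u v : 'rV[R]_3) i :
  cross u v 0 i = v 0 (i + 2%:R) * u 0 (i + 1) - v 0 (i + 1) * u 0 (i + 2%:R).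
Proof. by rewrite mxE mulrC (mulrC (u 0 (i + 2%:R))). Qed.

Lemma crosspCE (u v : cvec3) i :
  crossp u v 0 i = v 0 (i + 2%:R) * u 0 (i + 1) - v 0 (i + 1) * u 0 (i + 2%:R).
Proof. by rewrite mxE mulrC (mulrC (u 0 (i + 2%:R))). Qed.

Lemma cross_norm_le (u v : 'rV[R]_3) : dotp v v = 1 -> dotp (cross u v) (cross u v) <=
  dotp u u.
Proof.
have [e0 e1 e2] := crosspE u v.
rewrite -[cross u v]/(crossp u v) /dotp !sum3E e0 e1 e2.
move: (u 0 0) (u 0 1) (u 0 2%:R) (v 0 0) (v 0 1) (v 0 2%:R) => a b c d e f h.
have -> : a * a + b * b + c * c = (a * a + b * b + c * c) * (d * d + e * e + f * f) by
  rewrite h mulr1.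
have := sqr_ge0 (a * d + b * e + c * f); nra.
Qed.

Section Field.
Variables (S : R -> 'rV[R]_3) (c : int -> cvec3) (M : R).
Hypothesis hS : forall i, repr (fun x => S x 0 i) (fun k => c k 0 i) M.
Hypothesis hs : forall x, sphere2 (S x).
Hypothesis hM : hbd 2^-1 c M.
Let mc : measurable (circ : set (measurableTypeR R)) := @circle_measurable R.
Hint Resolve mc : core.

Lemma coord_le1 x i : `|S x 0 i| <= 1.
Proof.
rewrite -(@expr_le1 _ 2) // real_normK ?num_real // -(hs x).
by rewrite (bigD1 i) //= lerDl; apply: sumr_ge0 => j _; exact: sqr_ge0.
Qed.

Let LS i : L2 (fun x => S x 0 i) := repr_L2 (hS i).

Lemma coefs_real : real_coefs c.
Proof. by move=> k i; have [h _ _] := hS i; exact: h. Qed.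

Lemma coefs_fourier : fourier S = c.
Proof. by apply/funext => k; apply/rowP => i; rewrite fourierE; exact: (repr_fhat k (hS
  i)). Qed.

Lemma fourier_cross (phi : R -> 'rV[R]_3) k i : (forall i, L2 (fun x => phi x 0 i)) ->
  fourier (fun x => cross (phi x) (S x)) k 0 i =
  fhat (fun x => S x 0 (i + 2%:R) * phi x 0 (i + 1)) k -
  fhat (fun x => S x 0 (i + 1) * phi x 0 (i + 2%:R)) k.
Proof.
move=> hphi; rewrite fourierE.
have -> : (fun x => cross (phi x) (S x) 0 i) = (fun x => S x 0 (i + 2%:R) * phi x 0 (i
  + 1)
   - S x 0 (i + 1) * phi x 0 (i + 2%:R)) by apply/funext => x; exact: crossE.
apply: fhatB.
- by apply: (@L2_mul _ _ _ 1) => // [|x]; [have [] := LS (i + 2%:R)|exact: coord_le1].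
- by apply: (@L2_mul _ _ _ 1) => // [|x]; [have [] := LS (i + 1)|exact: coord_le1].
Qed.

Section Test.
Variable phi : R -> 'rV[R]_3.
Hypothesis hphi : forall i, L2 (fun x => phi x 0 i).
Local Notation f := (fourier phi).
Local Notation w := (fourier (fun x => cross (phi x) (S x))).

Lemma cross_coefs_lim k :
  vcvg (fun L => symsum L (fun l => crossp (f (k - l)) (c l))) (w k).
Proof.
move=> i; rewrite fourier_cross //.
have h1 := fhat_prod_lim k (hphi (i + 1)) (hS (i + 2%:R)) (fun x => coord_le1 x _).
have h2 := fhat_prod_lim k (hphi (i + 2%:R)) (hS (i + 1)) (fun x => coord_le1 x _).
have := ccvgD h1 (ccvgN h2).
congr (ccvg _ _); apply/funext => L; rewrite symsum_mxE -mulN1r mulr_symsumr -symsumD.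
by apply: eq_symsum => l _; rewrite crosspCE !fourierE mulN1r.
Qed.

(** Coefficients of P_K phi x S, with P_K the Fourier truncation ([test_sum_fourier]). It is phi
    that is truncated: S stays on the sphere, so |P_K phi x S| <= |P_K phi| pointwise, and
    [hbd_test_sum] holds uniformly in K. *)
Definition test_sum K (k : int) : cvec3 := symsum K (fun m => crossp (f m) (c (k - m))).

Definition mass : R := (2 * pi)^-1 * \sum_(i < 3) ip (fun x => phi x 0 i) (fun x => phi
  x 0 i).

Lemma hbd_fourier0 : hbd 0 f mass.
Proof.
move=> n; rewrite /mass ler_pdivlMl ?twopi_gt0 //.
have -> : hsum 0 f n = \sum_(i < 3) symsum n (fun k => csq (fhat (fun x => phi x 0 i) k)).
  rewrite /hsum symsumE; under [RHS]eq_bigr do rewrite symsumE.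
  rewrite exchange_big /=; apply: eq_bigr => k _.
  by rewrite wt0 mul1r cnormsq_csq; apply: eq_bigr => i _; rewrite fourierE.
by rewrite big_distrr /=; apply: ler_sum => i _; exact: fhat_bessel.
Qed.

(** [cross_coefs_lim] truncates S instead. At fixed k the series converges absolutely, both
    sequences being square summable, and recentring it by k turns one truncation into the other. *)
Lemma test_sum_lim k : vcvg (fun K => test_sum K k) (w k).
Proof.
move=> i; have h := cross_coefs_lim k i.
pose T l := crossp (f (k - l)) (c l).
have bnd n : symsum n (fun l => cnormsq (f (k - l)) + cnormsq (c l)) <= mass + M.
  rewrite symsumD; apply: lerD.
    apply: le_trans (symsum_shift_le _ _ (fun l => cnormsq_ge0 (f l))) _.
    have h0 := hbd_fourier0 (n + `|k|)%N; apply: (le_trans _ h0).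
    by apply: ler_symsum => l _; rewrite wt0 mul1r.
  by apply: le_trans (hM n); exact: symsum_cnormsq.
have tE K : test_sum K k = symsum K (fun m => T (k - m)).
  by apply: eq_symsum => m _; rewrite /T subKr.
have amg l := crossp_amgm (f (k - l)) (c l) i (ltr01 : 0 < (1 : R)).
have hR n : symsum n (fun l => `|Re (T l 0 i)|) <= mass + M.
  apply: le_trans (bnd n); apply: ler_symsum => l _.
  have [h1 _] := amg l; move: h1; rewrite divr1 mul1r => h1.
  by apply: le_trans h1; rewrite mulr_natl mulr2n lerDl.
have hI n : symsum n (fun l => `|Im (T l 0 i)|) <= mass + M.
  apply: le_trans (bnd n); apply: ler_symsum => l _.
  have [_ h1] := amg l; move: h1; rewrite divr1 mul1r => h1.
  by apply: le_trans h1; rewrite mulr_natl mulr2n lerDl.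
have reE (G : int -> cvec3) n : Re (symsum n G 0 i) = symsum n (fun l => Re (G l 0 i)).
  by rewrite symsum_mxE raddf_symsum.
have imE (G : int -> cvec3) n : Im (symsum n G 0 i) = symsum n (fun l => Im (G l 0 i)).
  by rewrite symsum_mxE raddf_symsum.
have [h1 h2] := h; split.
  under eq_fun do rewrite tE reE; apply: (cvg_symsum_shift k hR).
  by move: h1; under eq_fun do rewrite reE.
under eq_fun do rewrite tE imE; apply: (cvg_symsum_shift k hI).
by move: h2; under eq_fun do rewrite imE.
Qed.

Definition trunc_fun K (x : R) : 'rV[R]_3 := \row_i rtp K (fun k => f k 0 i) x.

Lemma fourier_conj_sym i : conj_sym (fun k => f k 0 i).
Proof. by move=> k; rewrite !fourierE fhat_conj. Qed.

Lemma L2_trunc K i : L2 (fun x => trunc_fun K x 0 i).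
Proof.
have -> : (fun x => trunc_fun K x 0 i) = rtp K (fun k => f k 0 i) by apply/funext => x;
  rewrite mxE.
exact: L2_rtp.
Qed.

Lemma test_sum_fourier K : fourier (fun x => cross (trunc_fun K x) (S x)) = test_sum K.
Proof.
apply/funext => k; apply/rowP => i; rewrite fourier_cross; last exact: L2_trunc.
have E j l : fhat (fun x => S x 0 l * trunc_fun K x 0 j) k = symsum K (fun m => f m 0 j
  * c (k - m) 0 l).
  have -> : (fun x => S x 0 l * trunc_fun K x 0 j) = (fun x => rtp K (fun k => f k 0 j)
    x * S x 0 l).
    by apply/funext => x; rewrite mxE mulrC.
  rewrite fhat_rtpM //; last exact: fourier_conj_sym.
  by apply: eq_symsum => m _; rewrite (repr_fhat _ (hS l)).
rewrite !E /test_sum symsum_mxE -mulN1r mulr_symsumr -symsumD; apply: eq_symsum => m _.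
by rewrite [crossp _ _ _ _]mxE mulN1r.
Qed.

End Test.

Lemma rdot_symsuml N (F : int -> cvec3) v :
  rdot (symsum N F) v = symsum N (fun l => rdot (F l) v).
Proof.
rewrite !symsumE; apply: (big_morph (fun u => rdot u v)) => [x y|].
  by rewrite !rdotE -big_split; apply: eq_bigr => i _; rewrite mxE /= !raddfD /=; ring.
by rewrite rdotE big1 // => i _; rewrite mxE /= !mul0r addr0.
Qed.

Section Identity.
Variable phi : R -> 'rV[R]_3.
Hypothesis hphi : forall i, L2 (fun x => phi x 0 i).
Local Notation f := (fourier phi).
Local Notation w := (fourier (fun x => cross (phi x) (S x))).
Local Notation trunc_fun := (trunc_fun phi).
Local Notation test_sum := (test_sum phi).
Local Notation mass := (mass phi).

(** Bessel's inequality for P_K phi x S, the pointwise bound by |P_K phi|, Parseval for the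
    trigonometric polynomial P_K phi, and Bessel's inequality for phi. *)
Lemma hbd_test_sum K : hbd 0 (test_sum K) mass.
Proof.
move=> n; rewrite -(test_sum_fourier hphi).
have LP i : L2 (fun x => trunc_fun K x 0 i) by exact: L2_trunc.
have Lc i : L2 (fun x => cross (trunc_fun K x) (S x) 0 i).
  have L1 j l : L2 (fun x => S x 0 j * trunc_fun K x 0 l).
    by apply: (@L2_mul _ _ _ 1) => // [|x]; [have [] := LS j|exact: coord_le1].
  have := L2B (L1 (i + 2%:R) (i + 1)) (L1 (i + 1) (i + 2%:R)).
  by congr L2; apply/funext => x; rewrite crossE.
apply: le_trans (hbd_fourier0 Lc n) _; apply: le_trans (hbd_fourier0 hphi K).
rewrite -ler_pdivlMl ?invr_gt0 ?twopi_gt0 // invrK.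
have -> : 2 * pi * hsum 0 f K = \sum_(i < 3) ip (fun x => trunc_fun K x 0 i) (fun x =>
  trunc_fun K x 0 i).
  rewrite /hsum symsumE; under eq_bigr do rewrite wt0 mul1r cnormsq_csq.
  rewrite exchange_big /= big_distrr /=; apply: eq_bigr => i _.
  have -> : (fun x => trunc_fun K x 0 i) = rtp K (fun k => f k 0 i) by apply/funext =>
    x; rewrite mxE.
  by rewrite rtp_parseval //; [rewrite symsumE|exact: fourier_conj_sym hphi i|exact:
    fourier_conj_sym hphi i].
rewrite /ip -!(@circ_int_of_sum R); [|by move=> i; exact: circ_intM|by move=> i; exact:
  circ_intM].
apply: le_Rintegral => //.
- by apply: circ_int_sum => i; exact: circ_intM.
- by apply: circ_int_sum => i; exact: circ_intM.
by move=> x _; apply: cross_norm_le; exact: sphere2_dotp.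
Qed.

Variables (nu : int -> R) (B : R).
Hypothesis nuB : forall k, `|nu k| <= B.

Definition mult (k : int) : cvec3 := (nu k)%:C *: c k.

Lemma rdot_dotp (u v : cvec3) : rdot u v = Re (dotp u (map_mx Num.conj v)).
Proof. by rewrite /rdot /dotp; congr (Re _); apply: eq_bigr => i _; rewrite mxE. Qed.

Lemma crossp_conj (u v : cvec3) : map_mx Num.conj (crossp u v) =
  crossp (map_mx Num.conj u) (map_mx Num.conj v).
Proof. by apply/rowP => i; rewrite !mxE rmorphB !rmorphM. Qed.

(** Cyclicity of the triple product, together with the reality of S: the conjugate of c (k - m) is c
    (m - k). *)
Lemma rdot_triple k m : rdot (mult k) (crossp (f m) (c (k - m))) = rdot (f m) (cterm nu
  c m k).
Proof.
rewrite /mult /cterm rdotZl [RHS]rdotC rdotZl; congr (_ * _).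
rewrite !rdot_dotp crossp_conj dotp_triple.
have -> : map_mx Num.conj (c (k - m)) = c (m - k).
  by apply/rowP => i; rewrite mxE -coefs_real opprB.
by rewrite dotpC.
Qed.

Lemma cnormsq_shift m n : symsum n (fun k => cnormsq (c (m - k))) <= M.
Proof.
apply: le_trans (symsum_shift_le _ _ (fun l => cnormsq_ge0 (c l))) _.
by apply: le_trans (hM _); exact: symsum_cnormsq.
Qed.

Lemma conv_lim_self m : vcvg (fun n => symsum n (cterm nu c m)) (conv nu c m).
Proof. by apply: (conv_cvg nuB hM) => n; exact: cnormsq_shift. Qed.

Lemma hbd_mult : hbd 0 mult (B ^+ 2 * M).
Proof.
move=> n; apply: (@le_trans _ _ (B ^+ 2 * symsum n (fun k => cnormsq (c k)))); last first.
  by rewrite ler_wpM2l ?sqr_ge0 //; apply: le_trans (hM n); exact: symsum_cnormsq.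
rewrite -symsumZ; apply: ler_symsum => k _; rewrite wt0 mul1r cnormsqZ.
rewrite ler_wpM2r ?cnormsq_ge0 // -(real_normK (num_real (nu k))).
by rewrite ler_sqr ?nnegrE // (le_trans _ (nuB k)).
Qed.

(** For truncated phi the sum over m is finite, so it may be exchanged with the limit of the sums
    over k, whose inner limit is [conv]. *)
Lemma pairing_test_sum K :
  pairing mult (test_sum K) = symsum K (fun m => rdot (f m) (conv nu c m)).
Proof.
have hN : hbd (- 0) (test_sum K) mass by rewrite oppr0; exact: hbd_test_sum.
have h1 := pairing_cvg hbd_mult hN.
have h2 : symsum K (fun m => rdot (f m) (symsum n (cterm nu c m))) @[n --> \oo] -->
    symsum K (fun m => rdot (f m) (conv nu c m)).
  apply: cvg_symsum => m; apply: cvg_rdot; last exact: conv_lim_self.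
  by move=> i; exact: ccvg_cst.
have E : (fun n => symsum n (fun k => rdot (mult k) (test_sum K k))) =
    (fun n => symsum K (fun m => rdot (f m) (symsum n (cterm nu c m)))).
  apply/funext => n.
  transitivity (symsum n (fun k => symsum K (fun m => rdot (f m) (cterm nu c m k)))).
    apply: eq_symsum => k _; rewrite rdotC rdot_symsuml; apply: eq_symsum => m _.
    by rewrite rdotC rdot_triple.
  rewrite exchange_symsum; apply: eq_symsum => m _.
  by rewrite rdotC rdot_symsuml; apply: eq_symsum => k _; rewrite rdotC.
rewrite E in h1; exact: (cvg_unique _ h1 h2).
Qed.

Variable E : R.
Hypothesis gE : hbd (- 2^-1) (conv nu c) E.

(** The identity for P_K phi passes to the limit on both sides. On the left P_K phi x S converges
    weakly in L^2, which suffices because a bounded nu puts [mult] in L^2; on the right [conv] is in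
    H^{-1/2} and phi in H^{1/2}. *)
Lemma pairing_cross (A : R) : hbd 2^-1 f A -> pairing w mult = pairing (conv nu c) f.
Proof.
move=> fA.
have hN : hbd (- 0) mult (B ^+ 2 * M) by rewrite oppr0; exact: hbd_mult.
have h1 := weak_lim (test_sum_lim hphi) hbd_test_sum hN.
have fA' : hbd (- - 2^-1) f A by rewrite opprK.
have h2 := pairing_cvg gE fA'.
have E' : (fun K => pairing (test_sum K) mult) = (fun K => symsum K (fun m => rdot
  (conv nu c m) (f m))).
  apply/funext => K; transitivity (pairing mult (test_sum K)).
    rewrite /pairing; congr (lim (_ @ \oo)); apply/funext => n; apply: eq_symsum => k
      _; exact: rdotC.
  by rewrite pairing_test_sum; apply: eq_symsum => m _; exact: rdotC.
rewrite E' in h1; exact: (cvg_unique _ h1 h2).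
Qed.

End Identity.

Section Peetre.
Variables (f : int -> cvec3) (A : R).
Hypothesis hf : hbd 2 f A.

Lemma wt1 k : wt 1 k = 1 + k%:~R ^+ 2 :> R.
Proof. by rewrite /wt powRr1 // (le_trans ler01) // wt_base_ge1. Qed.

(** Telescoping: 2 / (1 + x^2) <= 4 / x - 4 / (x + 1) with x = K + 1. The constant 5 is the term 1
    at k = 0 plus the telescoped 4. *)
Lemma symsum_wtN1 K : symsum K (fun k => (wt 1 k)^-1) <= (5 : R) - 4 / K.+1%:R.
Proof.
elim: K => [|K IH]; first by rewrite symsum0 wt1 expr0n addr0 invr1; lra.
rewrite symsumS wt_opp; apply: le_trans (lerD IH (lexx _)) _.
rewrite wt1 -[(K.+1%:Z)%:~R]/(K.+1%:R : R) -[K.+2%:R]natr1.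
have : 0 <= K%:R :> R by []. 
rewrite -[K.+1%:R]natr1; move: (K%:R : R) => x x0.
rewrite -subr_ge0.
have -> : 5 - 4 / (x + 1 + 1) - (5 - 4 / (x + 1) + ((1 + (x + 1) ^+ 2)^-1 + (1 + (x +
  1) ^+ 2)^-1)) =
  (2 * x ^+ 2 + 2 * x + 4) / ((x + 1 + 1) * (x + 1) * (1 + (x + 1) ^+ 2)).
  field; rewrite !gt_eqF //=; nra.
by rewrite divr_ge0 // ?mulr_ge0 // ?addr_ge0 ?mulr_ge0 ?sqr_ge0 //; lra.
Qed.

Lemma peetre k m : wt 2^-1 k <= 2 * (wt 2^-1 m * wt 2^-1 (k - m)) :> R.
Proof.
have h0 := wt_half_ge1 R m; have h1 := wt_half_ge1 R (k - m); have h2 := wt_half_ge1 R k.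
rewrite -(@ler_pXn2r _ 2) ?nnegrE ?mulr_ge0 ?wt_ge0 //.
rewrite !exprMn !wt_half.
have -> : k%:~R = m%:~R + (k - m)%:~R :> R by rewrite -intrD addrC subrK.
move: (m%:~R : R) ((k - m)%:~R : R) => x y.
have := sqr_ge0 (x - y); have := sqr_ge0 (x * y); have := sqr_ge0 x; have := sqr_ge0 y.
nra.
Qed.

Lemma weighted_cs K (v : int -> cvec3) : cnormsq (symsum K v) <=
  5 * symsum K (fun m => wt 1 m * cnormsq (v m)).
Proof.
have cs (I : Type) (r : seq I) (b : I -> R) (x : I -> R) : (forall i, 0 < b i) ->
    (\sum_(i <- r) x i) ^+ 2 <= (\sum_(i <- r) (b i)^-1) * \sum_(i <- r) b i * x i ^+ 2.
  move=> b0; elim: r => [|i r IH]; first by rewrite !big_nil expr0n mul0r.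
  rewrite !big_cons; move: IH.
  set X := \sum_(j <- r) x j; set P := \sum_(j <- r) _; set Q := \sum_(j <- r) _ => IH.
  have P0 : 0 <= P by apply: sumr_ge0 => j _; rewrite invr_ge0 ltW.
  have Q0 : 0 <= Q by apply: sumr_ge0 => j _; rewrite mulr_ge0 ?sqr_ge0 // ltW.
  have bb := b0 i; have b1 : (b i)^-1 * b i = 1 by rewrite mulVf // gt_eqF.
  have bi0 : 0 < (b i)^-1 by rewrite invr_gt0.
  have -> : ((b i)^-1 + P) * (b i * x i ^+ 2 + Q) = x i ^+ 2 * ((b i)^-1 * b i) + (b
    i)^-1 * Q + P * b i * x i ^+ 2 + P * Q by ring.
  rewrite b1 mulr1.
  suff : 2 * x i * X <= (b i)^-1 * Q + P * b i * x i ^+ 2 by nra.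
  have [P_eq|P_gt] := eqVneq P 0.
    have X2 : X = 0.
      by apply/eqP; rewrite -sqrf_eq0 eq_le sqr_ge0 andbT (le_trans IH) // P_eq mul0r.
    by rewrite X2 P_eq mulr0 !mul0r addr0 mulr_ge0 // ltW.
  have Pp : 0 < P by rewrite lt_def P_gt.
  rewrite -(ler_pM2l Pp).
  have : P * (b i)^-1 * Q >= (b i)^-1 * X ^+ 2 by rewrite mulrAC [leRHS]mulrC ler_pM2l
    // mulrC.
  have := mulr_ge0 (ltW bi0) (sqr_ge0 (P * b i * x i - X)).
  have -> : (b i)^-1 * (P * b i * x i - X) ^+ 2 = ((b i)^-1 * b i) * (P ^+ 2 * b i * x
    i ^+ 2)
     - 2 * ((b i)^-1 * b i) * P * x i * X + (b i)^-1 * X ^+ 2 by ring.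
  rewrite b1; move: (b i)^-1 => bi h1 h2; nra.
have cs' (x : int -> R) : symsum K x ^+ 2 <= 5 * symsum K (fun m => wt 1 m * x m ^+ 2).
  have := @cs _ (sseq K) (wt 1) x (wt_gt0 1); rewrite -!symsumE => h; apply: (le_trans h).
  rewrite ler_wpM2r //; first by apply: symsum_ge0 => m; rewrite mulr_ge0 ?wt_ge0
    ?sqr_ge0.
  by apply: (le_trans (symsum_wtN1 K)); rewrite gerBl divr_ge0.
rewrite cnormsqE.
have E : symsum K (fun m => wt 1 m * cnormsq (v m)) = \sum_(i < 3)
   (symsum K (fun m => wt 1 m * Re (v m 0 i) ^+ 2) + symsum K (fun m => wt 1 m * Im (v
     m 0 i) ^+ 2)).
  under [RHS]eq_bigr do rewrite -symsumD symsumE.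
  rewrite exchange_big /= symsumE; apply: eq_bigr => m _.
  by rewrite cnormsqE big_distrr; apply: eq_bigr => i _ /=; ring.
rewrite E big_distrr /=; apply: ler_sum => i _; rewrite mulrDr symsum_mxE !raddf_symsum.
by apply: lerD; exact: cs'.
Qed.

(** Places psi x S in H^{1/2} for smooth psi. The sequence f pays a weight 1/2 for Peetre's
    inequality and a weight 1 for the weighted Cauchy-Schwarz, together below its weight 2. The
    factor 20 is 5 from [weighted_cs], 2 from [peetre] and 2 from [cnormsq_cross_le]. *)
Lemma peetre_hsum K n :
  hsum 2^-1 (fun k => symsum K (fun m => crossp (f m) (c (k - m)))) n <= 20 * A * M.
Proof.
apply: (@le_trans _ _ (symsum n (fun k => symsum K (fun m =>
    20 * (wt 2 m * cnormsq (f m)) * (wt 2^-1 (m - k) * cnormsq (c (k - m))))))).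
  apply: ler_symsum => k _.
  apply: le_trans (ler_wpM2l (wt_ge0 _ _) (weighted_cs K _)) _.
  rewrite mulrCA -!symsumZ; apply: ler_symsum => m _.
  have h1 := cnormsq_cross_le (f m) (c (k - m)).
  have h2 := peetre k m; rewrite -(wt_opp 2^-1 (m - k)) opprB.
  have w1 := wt_gt0 (R := R) 1 m.
  have w2 : wt 2^-1 m * wt 1 m <= wt (2 : R) m.
    by rewrite -wtD; apply: wt_le; lra.
  have p1 : 0 <= cnormsq (f m) * cnormsq (c (k - m)) by rewrite mulr_ge0 ?cnormsq_ge0.
  have p2 := cnormsq_ge0 (crossp (f m) (c (k - m))).
  apply: (@le_trans _ _ (5 * ((2 * (wt 2^-1 m * wt 2^-1 (k - m))) *
     (wt 1 m * (2 * (cnormsq (f m) * cnormsq (c (k - m)))))))).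
    rewrite ler_pM2l //; apply: ler_pM; rewrite ?wt_ge0 ?mulr_ge0 ?(ltW w1) //.
    by rewrite ler_pM2l.
  have -> : 5 * ((2 * (wt 2^-1 m * wt 2^-1 (k - m))) *
     (wt 1 m * (2 * (cnormsq (f m) * cnormsq (c (k - m)))))) =
    (wt 2^-1 m * wt 1 m) * (20 * wt 2^-1 (k - m) * (cnormsq (f m) * cnormsq (c (k -
      m)))) by ring.
  have -> : 20 * (wt 2 m * cnormsq (f m)) * (wt 2^-1 (k - m) * cnormsq (c (k - m))) =
    wt 2 m * (20 * wt 2^-1 (k - m) * (cnormsq (f m) * cnormsq (c (k - m)))) by ring.
  by rewrite ler_wpM2r // mulr_ge0 // mulr_ge0 ?wt_ge0.
rewrite exchange_symsum.
apply: (@le_trans _ _ (symsum K (fun m => (20 * M) * (wt 2 m * cnormsq (f m))))); last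
  first.
  rewrite symsumZ [leRHS]mulrAC ler_wpM2l //; last exact: hf.
  by rewrite mulr_ge0 // (hbd_ge0 hM).
apply: ler_symsum => m _; rewrite symsumZ [leRHS]mulrAC; apply: ler_wpM2l.
  by rewrite mulr_ge0 ?hterm_ge0.
pose G l := wt 2^-1 l * cnormsq (c (- l)).
have G0 l : 0 <= G l by rewrite mulr_ge0 ?wt_ge0 ?cnormsq_ge0.
have := symsum_shift_le n m G0.
rewrite -(symsumN _ G) (@eq_symsum _ n _ (fun k => wt 2^-1 (m - k) * cnormsq (c (k -
  m)))); last first.
  by move=> k _; rewrite /G opprB.
move=> h; apply: (le_trans h); have h1 := hM (n + `|m|)%N; apply: le_trans h1.
by apply: ler_symsum => k _; rewrite /G wt_opp opprK.
Qed.

End Peetre.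
End Field.
End Products.

(** * Decay of the Fourier coefficients of smooth test functions *)

Section Smooth.
Variable R : realType.
Local Notation mu := (@lebesgue_measure R).
Local Notation circ := (@circle R).

Lemma fourierB (u v : R -> 'rV[R]_3) : (forall i, L2 (fun x => u x 0 i)) ->
  (forall i, L2 (fun x => v x 0 i)) ->
  fourier (fun x => u x - v x) = fun k => fourier u k - fourier v k.
Proof.
move=> hu hv; apply/funext => k; apply/rowP => i; rewrite fourierE.
have -> : (fun x => (u x - v x) 0 i) = (fun x => u x 0 i - v x 0 i).
  by apply/funext => x; rewrite !mxE.
by rewrite (fhatB k (hu i) (hv i)) [RHS]mxE [X in _ = _ + X]mxE !fourierE.
Qed.

Lemma smooth_is_derive (h : R -> R) : smooth h -> forall x : R, is_derive x (1 : R) h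
  (derive1 h x).
Proof. by move=> sh x; rewrite derive1E; apply: DeriveDef => //; exact: (sh 0%N x). Qed.

Lemma smooth_derive1 (h : R -> R) : smooth h -> smooth (derive1 h).
Proof. by move=> sh m t; rewrite -derive1Sn; exact: sh. Qed.

Lemma periodic_derive1 (h : R -> R) (p : R) : smooth h -> periodic h p -> periodic
  (derive1 h) p.
Proof.
move=> sh ph x.
have d1 := smooth_is_derive sh (x + p).
have d2 : is_derive x (1 : R) (h \o (fun y => y + p)) (derive1 h (x + p) * 1).
  apply: is_derive1_comp.
  have := @is_deriveD _ _ _ id (cst p) x 1 1 0 _ _; rewrite addr0; exact.
have e : h \o (fun y => y + p) = h by apply/funext => y /=; exact: ph.
rewrite e mulr1 in d2.
have d3 := smooth_is_derive sh x.
by have [_ <-] := d2; have [_ <-] := d3.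
Qed.

Lemma csq_fhat_derive (h : R -> R) k : smooth h -> periodic h (2 * pi) ->
  csq (fhat (derive1 h) k) = k%:~R ^+ 2 * csq (fhat h k).
Proof.
move=> sh ph; have dh := smooth_is_derive sh.
have ch : continuous h := is_derive_continuous dh.
have ch' : continuous (derive1 h) := is_derive_continuous (smooth_is_derive
  (smooth_derive1 sh)).
have mc := @circle_measurable R.
have end0 : h (2 * pi) = h 0 by rewrite -(ph 0) add0r.
have L1 := L2_cont ch; have L1' := L2_cont ch'.
have ibp (e e' : R -> R) : (forall x : R, is_derive x (1 : R) e (e' x)) -> continuous e
  -> continuous e' ->
    e (2 * pi) = e 0 -> ip (derive1 h) e = - ip h e'.
  move=> de ce ce' ee; have L2e := L2_cont ce; have L2e' := L2_cont ce'.
  have d (x : R) : 0 <= x <= 2 * pi -> is_derive x (1 : R) (fun x => h x * e x) (h x *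
    e' x + derive1 h x * e x).
    move=> _; have := is_deriveM (dh x) (de x).
    by rewrite /GRing.scale /= (mulrC (e x)).
  have c : continuous (fun x => h x * e' x + derive1 h x * e x).
    by move=> x; apply: cvgD; apply: cvgM; [exact: ch|exact: ce'|exact: ch'|exact: ce].
  have := circ_FTC d c; rewrite ee end0 subrr RintegralD //; [|exact: circ_intM|exact:
    circ_intM].
  by rewrite -/(ip h e') -/(ip (derive1 h) e) => /eqP; rewrite addrC addr_eq0 => /eqP.
rewrite /csq !fhatRe !fhatIm.
rewrite (ibp _ _ (ec_derive k) (@ec_cont R k)) ?(ibp _ _ (es_derive k) (@es_cont R k)).
- rewrite !ipZr //; [ring| |]; [exact: L2_ec|exact: L2_es].
- by move=> x; apply: cvgM; [exact: cvg_cst|exact: ec_cont].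
- by rewrite /es expi_2pi expi0.
- by move=> x; apply: cvgM; [exact: cvg_cst|exact: es_cont].
- by rewrite /ec expi_2pi expi0.
Qed.

Lemma smooth_circle_L2 (psi : R -> 'rV[R]_3) i : smooth_circle psi -> L2 (fun x => psi
  x 0 i).
Proof. by move=> [_ sp]; apply: L2_cont; exact: is_derive_continuous (smooth_is_derive
  (sp i)). Qed.

(** (1 + k^2)^2 <= 2 (1 + k^4), and k^4 times the squared coefficient of psi is the squared
    coefficient of its second derivative, summable by Bessel. *)
Lemma smooth_circle_hbd (psi : R -> 'rV[R]_3) : smooth_circle psi ->
  exists A, hbd 2 (fourier psi) A.
Proof.
move=> [pp sp]; have pi' i : periodic (fun x => psi x 0 i) (2 * pi) by move=> x;
  rewrite pp.
pose h2 i := derive1 (derive1 (fun x => psi x 0 i)).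
have L0 i : L2 (fun x => psi x 0 i) by exact: smooth_circle_L2.
have Lh2 i : L2 (h2 i).
  by apply: L2_cont; exact: is_derive_continuous (smooth_is_derive (smooth_derive1
    (smooth_derive1 (sp i)))).
exists (\sum_(i < 3) 2 * ((2 * pi)^-1 * ip (fun x => psi x 0 i) (fun x => psi x 0 i) +
    (2 * pi)^-1 * ip (h2 i) (h2 i))) => n.
have E k : cnormsq (fourier psi k) = \sum_(i < 3) csq (fhat (fun x => psi x 0 i) k).
  by rewrite cnormsq_csq; apply: eq_bigr => i _; rewrite fourierE.
rewrite /hsum symsumE; under eq_bigr do rewrite E big_distrr.
rewrite exchange_big /=; apply: ler_sum => i _.
have b0 := fhat_bessel n (L0 i); have b2 := fhat_bessel n (Lh2 i).
rewrite -!ler_pdivlMl ?twopi_gt0 // in b0 b2.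
apply: (@le_trans _ _ (2 * (symsum n (fun k => csq (fhat (fun x => psi x 0 i) k)) +
  symsum n (fun k => csq (fhat (h2 i) k))))); last first.
  by rewrite ler_pM2l // lerD.
rewrite -symsumD -symsumZ -symsumE; apply: ler_symsum => k _.
have e1 := csq_fhat_derive k (sp i) (pi' i).
have e2 := csq_fhat_derive k (smooth_derive1 (sp i)) (periodic_derive1 (sp i) (pi' i)).
rewrite [csq (fhat (h2 i) k)]e2 e1.
have -> : wt 2 k = (1 + k%:~R ^+ 2) ^+ 2 :> R.
  by rewrite (_ : 2 = 1 + 1 :> R) // wtD wt1 expr2.
have := csq_ge0 (fhat (fun x => psi x 0 i) k); move: (csq _) (k%:~R : R) => y x y0.
rewrite -subr_ge0.
have -> : 2 * (y + x ^+ 2 * (x ^+ 2 * y)) - (1 + x ^+ 2) ^+ 2 * y = y * (x ^+ 2 - 1) ^+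
  2 by ring.
by rewrite mulr_ge0 ?sqr_ge0.
Qed.

End Smooth.

(** * The weak form, obtained by letting the Yosida parameter tend to infinity *)

Section HalfWave.
Variable R : realType.
Local Notation circ := (@circle R).
Local Notation cvec3 := 'rV[R[i]]_3.
Variables (S : R -> 'rV[R]_3) (c g : int -> cvec3) (M E : R).
Hypothesis hS : forall i, repr (fun x => S x 0 i) (fun k => c k 0 i) M.
Hypothesis hs : forall x, sphere2 (S x).
Hypothesis hM : hbd 2^-1 c M.
Local Notation nu p := (fun k : int => yos p.+1%:R `|k%:~R : R|).
Hypothesis hgE : forall p : nat, hbd (- 2^-1) (conv (nu p) c) E.
Hypothesis hg : forall k, vcvg (fun p : nat => conv (nu p) c k) (g k).

Lemma hbd_g : hbd (- 2^-1) g E.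
Proof. exact: hbd_lim hg hgE. Qed.

Lemma half_powR_sq (x : R) : 0 <= x -> x `^ 2^-1 * x `^ 2^-1 = x.
Proof. by move=> x0; rewrite powR12_sqrt // -expr2 sqr_sqrtr. Qed.

Lemma pairingC (a b : int -> cvec3) : pairing a b = pairing b a.
Proof.
rewrite /pairing; congr (lim (_ @ \oo)); apply/funext => n; apply: eq_symsum => k _;
  exact: rdotC.
Qed.

Lemma pairingBl s (a b d : int -> cvec3) A B D : hbd s a A -> hbd s b B -> hbd (- s) d
  D ->
  pairing (fun k => a k - b k) d = pairing a d - pairing b d.
Proof.
move=> ha hb hd; have h1 := pairing_cvg (hbdB ha hb) hd.
have h2 : symsum n (fun k => rdot (a k) (d k)) - symsum n (fun k => rdot (b k) (d k))
  @[n --> \oo] -->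
    pairing a d - pairing b d by apply: cvgB; [exact: pairing_cvg ha hd|exact:
      pairing_cvg hb hd].
have e : (fun n => symsum n (fun k => rdot (a k - b k) (d k))) =
  (fun n => symsum n (fun k => rdot (a k) (d k)) - symsum n (fun k => rdot (b k) (d k))).
  by apply/funext => n; rewrite -symsumB; apply: eq_symsum => k _; rewrite rdotBl.
rewrite e in h1; exact: (cvg_unique _ h1 h2).
Qed.

(** [pairing_cross] holds for each bounded symbol. As p grows, the side with phi x S converges
    because the regularised symbol is at most |k|, which keeps its product with c bounded in
    H^{-1/2} while phi x S is in H^{1/2}; the other side converges by the uniform bound E on the
    torques. *)
Lemma half_wave_identity (phi : R -> 'rV[R]_3) A B : (forall i, L2 (fun x => phi x 0
  i)) ->
  hbd 2^-1 (fourier phi) A -> hbd 2^-1 (fourier (fun x => cross (phi x) (S x))) B ->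
  half_wave_form S phi = pairing (fourier phi) g.
Proof.
move=> hphi hA hB; set f := fourier phi; set w := fourier _ in hB.
have nub p k : `|yos p.+1%:R `|k%:~R : R| | <= p.+1%:R :> R.
  rewrite ger0_norm; first by have [_] := yos_le (ltr0Sn R p) (normr_ge0 (k%:~R : R)).
  by rewrite yos_ge0.
have id p := pairing_cross hS hs hM hphi (nub p) (hgE p) hA.
pose absc k : cvec3 := (`|k%:~R : R|)%:C *: c k.
have hA' : hbd (- - 2^-1) f A by rewrite opprK.
have hB' : hbd (- - 2^-1) w B by rewrite opprK.
have h1 := weak_lim hg hgE hA'.
have h2 : pairing (mult c (nu p)) w @[p --> \oo] --> pairing absc w.
  apply: (weak_lim (s := - 2^-1) (A := M)) hB' => [k|p n].
    by apply: vcvgZ; [apply: ccvg_real; exact: cvg_yos_infty|move=> i; exact: ccvg_cst].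
  apply: le_trans (hM n); apply: ler_symsum => k _.
  have [y1 _] := yos_le (ltr0Sn R p) (normr_ge0 (k%:~R : R)).
  have y0 := yos_ge0 (ltr0Sn R p) (normr_ge0 (k%:~R : R)).
  rewrite cnormsqZ mulrA ler_wpM2r ?cnormsq_ge0 // wtN.
  rewrite mulrC ler_pdivrMr ?wt_gt0 // -expr2 ler_sqr ?nnegrE ?wt_ge0 //.
  by apply: le_trans y1 _; exact: norm_le_wt_half.
have e : (fun p => pairing (conv (nu p) c) f) = (fun p => pairing (mult c (nu p)) w).
  by apply/funext => p; rewrite -id pairingC.
rewrite e in h1.
have h3 : pairing absc w = pairing g f by exact: (cvg_unique _ h2 h1).
rewrite [RHS]pairingC -h3 /half_wave_form (coefs_fourier hS).
rewrite /pairing; congr (lim (_ @ \oo)); apply/funext => n; apply: eq_symsum => k _.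
(* The symbol |k| is the product of the two square roots that [half_wave_form] places on its two
   arguments. *)
rewrite -![complex.Re _]/(rdot _ _) /absc /nabla_pow rdotZl rdotC rdotZl rdotC -/w
  rdotZl mulrA; congr (_ * _).
by apply: half_powR_sq; exact: normr_ge0.
Qed.

Lemma half_wave_identity_smooth (psi : R -> 'rV[R]_3) : smooth_circle psi ->
  half_wave_form S psi = pairing (fourier psi) g.
Proof.
move=> sp; have [A hA] := smooth_circle_hbd sp.
have L i := smooth_circle_L2 i sp.
have hA' : hbd 2^-1 (fourier psi) A by apply: hbd_le hA; lra.
apply: (half_wave_identity L hA' (B := 20 * A * M)).
apply: (hbd_lim (test_sum_lim hS hs hM L)) => K n.
exact: (peetre_hsum hM hA).
Qed.

(** If phi x S is in H^{1/2}, the identity is literal. Otherwise it is applied to smooth psi, and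
    the pairing with g is continuous in the H^{1/2} norm since g is in H^{-1/2}. *)
Lemma half_wave_value_pairing (phi : R -> 'rV[R]_3) : sobolev_fun 2^-1 phi ->
  half_wave_value S phi (pairing (fourier phi) g).
Proof.
move=> [_ mphi iphi /sobolev_norm_fin [A hA]].
have L i : L2 (fun x => phi x 0 i) by split; [exact: mphi|exact: iphi].
split=> [[_ _ _ /sobolev_norm_fin [B hB]]|_ e e0].
  by apply/esym; exact: half_wave_identity hA hB.
have E0 : 0 <= E := hbd_ge0 (hgE 0%N).
(* With this d the duality bound d + E d equals e; it controls twice the difference, whence the
   strict inequality. *)
pose d := e / (1 + E).
have d0 : 0 < d by rewrite divr_gt0 // ltr_wpDr.
exists d => // psi sp hd.
rewrite half_wave_identity_smooth //.
have [B hB] := smooth_circle_hbd sp.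
have hB' : hbd 2^-1 (fourier psi) B by apply: hbd_le hB; lra.
rewrite -(pairingBl hB' hA hbd_g).
have Lp i := smooth_circle_L2 i sp.
rewrite (fourierB Lp L) in hd.
have := pairing_le (sobolev_norm_hbd (ltW hd)) hbd_g (_ : 0 < d^-1).
rewrite invr_gt0 invrK => /(_ d0).
have -> : d^-1 * d ^+ 2 + E * d = e.
  have -> : d^-1 * d ^+ 2 = d by rewrite expr2 mulrA mulVf ?mul1r // gt_eqF.
  by rewrite -{1}[d]mul1r -mulrDl mulrC /d divfK // gt_eqF // ltr_wpDr.
move=> h; have aux (x y : R) : 0 < y -> 2 * x <= y -> x < y by lra.
exact: aux h.
Qed.

End HalfWave.

(** * Weak-* convergence in time *)

Section Time.
Variable R : realType.
Local Notation mu := (@lebesgue_measure R).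
Local Notation cvec3 := 'rV[R[i]]_3.
Local Notation coefs := (int -> 'rV[R[i]]_3).
Implicit Types (s T : R).

Lemma itime_measurable T : measurable (itime T : set (measurableTypeR R)).
Proof. exact: measurable_itv. Qed.

Lemma time_dct T (h_ : nat -> R -> R) (h : R -> R) (G : R -> \bar R) :
  (forall j, measurable_fun (itime T) (h_ j)) -> measurable_fun (itime T) h ->
  {ae mu, forall t, itime T t -> h_ j t @[j --> \oo] --> h t} ->
  mu.-integrable (itime T) G ->
  {ae mu, forall t, forall j, itime T t -> (`|(h_ j t)%:E| <= G t)%E} ->
  \int[mu]_(t in itime T) h_ j t @[j --> \oo] --> \int[mu]_(t in itime T) h t.
Proof.
move=> mh_ mh hc iG hG.
have [i1 _ h1] := @dominated_convergence _ _ R mu (itime T) (@itime_measurable T)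
   (fun j t => (h_ j t)%:E) (fun t => (h t)%:E) G
   (fun j => (measurable_EFinP _ _).2 (mh_ j)) ((measurable_EFinP _ _).2 mh)
   (ae_mono (fun t ht it => cvg_EFin (nearW _ (fun j => erefl : (h_ j t)%:E \is a
     fin_num)) (ht it)) hc) iG hG.
have fin : (\int[mu]_(t in itime T) (h t)%:E)%E \is a fin_num.
  by apply: integrable_fin_num i1; exact: (@itime_measurable T).
rewrite -(fineK fin) in h1; exact: fine_cvg h1.
Qed.

Lemma measurable_pairing T (a b : R -> coefs) : measurable_coefs T a ->
  measurable_coefs T b ->
  measurable_fun (itime T) (fun t => pairing (a t) (b t)).
Proof.
move=> ma mb; apply: measurable_lim => [|n]; first exact: (@itime_measurable T).
have -> : (fun t => symsum n (fun k => complex.Re (\sum_(i < 3) a t k 0 i * (b t k 0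
  i)^* ))) =
   (fun t => \sum_(k <- sseq n) \sum_(i < 3) (Re (a t k 0 i) * Re (b t k 0 i) + Im (a t
     k 0 i) * Im (b t k 0 i))).
  by apply/funext => t; rewrite symsumE; apply: eq_bigr => k _; exact: rdotE.
apply: measurable_sum => k; apply: measurable_sum => i.
have [h1 h2] := ma k i; have [h3 h4] := mb k i.
by apply: measurable_funD; apply: measurable_funM.
Qed.

(** The bound is linear in the norm N of b because the test functions of [weakstar_of] are
    integrable in time, not square integrable: it is their dominating function. *)
Lemma pairing_norm_le s (a b : coefs) (A N : R) : hbd s a A -> hbd (- s) b (N ^+ 2) ->
  0 <= N ->
  `|pairing a b| <= (A + 1) * N.
Proof.
move=> ha hb N0; have A0 := hbd_ge0 ha.
apply/ler_addgt0Pr => e e0.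
(* The parameter N would give the linear bound but may vanish; the added term keeps it positive and
   costs at most e. *)
have d0 : 0 < N + e / (A + 1) by rewrite ltr_wpDl // divr_gt0 // ltr_wpDl.
have := pairing_le ha hb d0.
have h1 : N ^+ 2 / (N + e / (A + 1)) <= N.
  by rewrite ler_pdivrMr // expr2 ler_wpM2l // lerDl divr_ge0 ?addr_ge0 // ltW.
have h2 : (N + e / (A + 1)) * A <= N * A + e.
  rewrite mulrDl lerD2l mulrAC ler_pdivrMr ?ltr_wpDl //.
  by rewrite ler_pM2l // lerDl.
move=> h3; have NA : 0 <= N * A by rewrite mulr_ge0.
have aux (x p q r n a' e' : R) : 2 * x <= p + q -> p <= n * a' + e' -> q <= n -> 0 <= n
  * a' -> 0 <= n -> 0 < e' ->
   x <= (a' + 1) * n + e' by nra.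
exact: aux h3 h2 h1 NA N0 e0.
Qed.

(** At almost every time psi has a finite norm and [weak_lim] gives convergence of the pairings;
    dominated convergence, with M + 1 times the norm of psi, integrates it over [0, T]. *)
Lemma weakstar_of s T (c_ : nat -> R -> coefs) (c : R -> coefs) (M : R) :
  (forall j, measurable_coefs T (c_ j)) -> (forall j t, itime T t -> real_coefs (c_ j
    t)) ->
  (forall j t, itime T t -> hbd s (c_ j t) M) ->
  (forall t k, itime T t -> vcvg (fun j => c_ j t k) (c t k)) ->
  weakstar_Linfty s T c_ c.
Proof.
move=> mc_ rc_ hM hc.
have mc : measurable_coefs T c.
  move=> k i; split.
    apply: (measurable_fun_cvg (h := fun j t => Re (c_ j t k 0 i))).
      by move=> j; have [] := mc_ j k i.
    by move=> t it; have [] := hc t k it i.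
  apply: (measurable_fun_cvg (h := fun j t => Im (c_ j t k 0 i))).
    by move=> j; have [_] := mc_ j k i.
  by move=> t it; have [_] := hc t k it i.
have rc t : itime T t -> real_coefs (c t).
  move=> it k i; apply: (ccvg_unique (hc t (- k) it i)).
  have := ccvgJ (hc t k it i); congr (ccvg _ _); apply/funext => j; exact/esym/rc_.
have hMc t : itime T t -> hbd s (c t) M.
  by move=> it; apply: (hbd_lim (fun k => hc t k it)) => j; exact: hM.
have bound (a : R -> coefs) : (forall t, itime T t -> hbd s (a t) M) ->
    exists M' : R, on_interval T (fun t => (sobolev_norm s (a t) <= M'%:E)%E).
  move=> ha; exists (Num.sqrt M); apply: aeW => t it.
  by apply: sobolev_norm_le_sqrt; [exact: hbd_ge0 (ha t it)|exact: ha].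
split.
- by move=> j; split; [exact: mc_|apply: aeW => t; exact: rc_|exact: bound (hM j)].
- by split; [exact: mc|apply: aeW; exact: rc|exact: bound].
move=> psi [mpsi _ ipsi].
have mN := measurable_sobolev_norm (- s) mpsi.
have iN : mu.-integrable (itime T) (fun t => sobolev_norm (- s) (psi t)).
  apply/integrableP; split => //.
  have -> : (\int[mu]_(t in itime T) `|sobolev_norm (- s) (psi t)| =
    \int[mu]_(t in itime T) sobolev_norm (- s) (psi t))%E.
    by apply: eq_integral => t _; rewrite gee0_abs // sobolev_norm_ge0.
  exact: ipsi.
have fin : {ae mu, forall t, itime T t -> exists N : R, [/\ 0 <= N,
    sobolev_norm (- s) (psi t) = N%:E & hbd (- s) (psi t) (N ^+ 2)]}.
  have := integrable_ae (@itime_measurable T) iN; apply: ae_mono => t h it.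
  have := h it; have := sobolev_norm_ge0 (- s) (psi t).
  case E : (sobolev_norm (- s) (psi t)) => [r| |] // r0 _; exists r; split => //.
  by apply: sobolev_norm_hbd; rewrite E.
apply: (@time_dct T _ _ (fun t => (M + 1)%:E * sobolev_norm (- s) (psi t))%E).
- by move=> j; exact: measurable_pairing.
- exact: measurable_pairing.
- move: fin; apply: ae_mono => t h it; have [N [N0 _ hN]] := h it.
  exact: (weak_lim (fun k => hc t k it) (fun j => hM j t it) hN).
- by apply: integrableZl => //; exact: (@itime_measurable T).
move: fin; apply: ae_mono => t h j it; have [N [N0 -> hN]] := h it.
rewrite abse_EFin -EFinM lee_fin; exact: pairing_norm_le (hM j t it) hN N0.
Qed.

(** Here c is fixed and the symbol varies under the common bound D, for which [cterm_tail] gives a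
    single truncation level. *)
Lemma conv_cvg_nu (c : coefs) (nu_ : nat -> int -> R) (nu : int -> R) (D M : R) m :
  0 <= D -> (forall p k, `|nu_ p k| <= D) -> (forall k, `|nu k| <= D) ->
  (forall k, nu_ ^~ k @ \oo --> nu k) -> hbd 2^-1 c M ->
  (forall n, symsum n (fun k => cnormsq (c (m - k))) <= M) ->
  vcvg (fun p => conv (nu_ p) c m) (conv nu c m).
Proof.
move=> D0 hD_ hD hnu hM hm.
have M0 := hbd_ge0 hM.
have tail (e : R) : 0 < e -> exists K, forall (v : int -> R), (forall k, `|v k| <= D)
  -> forall i,
    `|Re (conv v c m 0 i) - Re (symsum K (cterm v c m) 0 i)| <= e /\
    `|Im (conv v c m 0 i) - Im (symsum K (cterm v c m) 0 i)| <= e.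
  move=> e0; have [K hK] := cterm_tail M m D0 e0; exists K => v hv i.
  have [c1 c2] := conv_cvg hv hM hm i.
  have near_le (x : nat -> R) (l y : R) : x @ \oo --> l -> (forall n, (K <= n)%N -> `|x
    n - y| <= e) ->
      `|l - y| <= e.
    move=> xl h; have : `|x n - y| @[n --> \oo] --> `|l - y|.
      by apply: cvg_norm; apply: cvgB => //; exact: cvg_cst.
    by move/cvgr_to_le; apply; exists K.
  split; [apply: (near_le _ _ _ c1)|apply: (near_le _ _ _ c2)] => n Kn.
    by have [] := hK v c hv n K _ (hM n) (hm n) i; rewrite ?leqnn.
  by have [] := hK v c hv n K _ (hM n) (hm n) i; rewrite ?leqnn.
have fin K : vcvg (fun p => symsum K (cterm (nu_ p) c m)) (symsum K (cterm nu c m)).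
  apply: vcvg_symsum => k; apply: vcvgZ; first by apply: ccvg_real; exact: hnu.
  by move=> i; exact: ccvg_cst.
have e3 (x : nat -> nat -> R) (y : nat -> R) (X : nat -> R) (Y : R) :
   (forall K, x ^~ K @ \oo --> y K) -> (forall e : R, 0 < e -> exists K, (forall p, `|X
     p - x p K| <= e) /\ `|Y - y K| <= e) ->
   X @ \oo --> Y.
  move=> hx hX; apply/cvgrPdist_le => e e0.
  have e4 : 0 < e / 3 by rewrite divr_gt0.
  have [K [h1 h2]] := hX _ e4.
  move/cvgrPdist_le : (hx K) => /(_ _ e4); apply: filterS => p h3.
  have -> : Y - X p = (Y - y K) + (y K - x p K) - (X p - x p K) by ring.
  have := h1 p; have aux (a b d e' : R) : `|a| <= e' / 3 -> `|b| <= e' / 3 -> `|d| <=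
    e' / 3 -> `|a + b - d| <= e'.
    move=> u1 u2 u3; apply: le_trans (ler_normB _ _) _.
    have := ler_normD a b; lra.
  by move=> h4; exact: aux.
move=> i; split.
  apply: (e3 (fun p K => Re (symsum K (cterm (nu_ p) c m) 0 i)) (fun K => Re (symsum K
    (cterm nu c m) 0 i))).
    by move=> K; have [] := fin K i.
  move=> e e0; have [K hK] := tail e e0; exists K; split.
    by move=> p; have [] := hK (nu_ p) (hD_ p) i.
  by have [] := hK nu hD i.
apply: (e3 (fun p K => Im (symsum K (cterm (nu_ p) c m) 0 i)) (fun K => Im (symsum K
  (cterm nu c m) 0 i))).
  by move=> K; have [] := fin K i.
move=> e e0; have [K hK] := tail e e0; exists K; split.
  by move=> p; have [] := hK (nu_ p) (hD_ p) i.
by have [] := hK nu hD i.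
Qed.

(** K is so large that (1 + k^2)^(s - r) >= 1 / e beyond it, so that there the weight of order r is
    at most e times that of order s. It depends on neither a nor n. *)
Lemma hsum_split s r e : 0 < e -> r < s -> exists K, forall a n,
  hsum r a n <= hsum r a K + e * hsum s a n :> R.
Proof.
move=> e0 rs; have sr : 0 < s - r by rewrite subr_gt0.
pose X := (e^-1) `^ ((s - r)^-1).
have X0 : 0 <= X by exact: powR_ge0.
pose K := Num.bound X; exists K => a n.
have big k : (K < `|k|)%N -> wt r k <= e * wt s k.
  move=> hk; have -> : s = (s - r) + r by rewrite subrK.
  rewrite wtD mulrA -[leLHS]mul1r ler_wpM2r ?wt_ge0 //.
  rewrite mulrC -ler_pdivrMr // div1r.
  have -> : e^-1 = X `^ (s - r).
    by rewrite /X -powRrM mulVf ?gt_eqF // powRr1 // invr_ge0 ltW.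
  apply: ge0_ler_powR; rewrite ?nnegrE ?(ltW sr) //.
    by rewrite (le_trans ler01) // wt_base_ge1.
  apply: (@le_trans _ _ K%:R); first exact/ltW/archi_boundP.
  have k1 : (1 : R) <= `|k|%N%:R by rewrite ler1n; exact: leq_ltn_trans hk.
  apply: (@le_trans _ _ (`|k|%N%:R)); first by rewrite ler_nat ltnW.
  have -> : k%:~R ^+ 2 = (`|k|%N%:R : R) ^+ 2.
    by rewrite natr_absz intr_norm real_normK ?num_real.
  by nra.
pose F k : R := if (`|k| <= K)%N then wt r k * cnormsq (a k) else 0.
have F0 k : 0 <= F k by rewrite /F; case: ifP => // _; exact: hterm_ge0.
have FK : symsum n F <= hsum r a K.
  have -> : hsum r a K = symsum K F by apply: eq_symsum => k hk; rewrite /F hk.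
  have [nK|Kn] := leqP n K; first exact: (symsum_nd F0).
  rewrite (symsum_widen (ltnW Kn)) // => k hk; by rewrite /F leqNgt hk.
apply: le_trans (lerD FK (lexx _)).
rewrite -symsumZ -symsumD; apply: ler_symsum => k _; rewrite /F; case: leqP => hk.
  by rewrite lerDl mulr_ge0 ?hterm_ge0 // ltW.
by rewrite add0r mulrA ler_wpM2r ?cnormsq_ge0 //; exact: big.
Qed.

Lemma symsum_near_le (F_ : nat -> R -> int -> R) (P : R -> Prop) K :
  (forall k (e : R), 0 < e -> \forall j \near \oo, forall t, P t -> F_ j t k <= e) ->
  forall e : R, 0 < e -> \forall j \near \oo, forall t, P t -> symsum K (F_ j t) <= e.
Proof.
move=> h; elim: K => [|K IH] e e0.
  by apply: filterS (h 0 e e0) => j hj t Pt; rewrite symsum0; exact: hj.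
have e3 : 0 < e / 3 by rewrite divr_gt0.
have h1 := IH _ e3; have h2 := h K.+1%:Z _ e3; have h3 := h (- K.+1%:Z) _ e3.
near=> j => t Pt; rewrite symsumS.
have aux (x y z e' : R) : x <= e' / 3 -> y <= e' / 3 -> z <= e' / 3 -> x + (y + z) <=
  e' by lra.
by apply: aux; move: t Pt; near: j.
Unshelve. all: by end_near. Qed.

End Time.

(** * The limit *)

Section Flow.
Variable R : realType.
Local Notation cvec3 := 'rV[R[i]]_3.
Variables (S0N : forall n : nat, 'I_n.*2.+1 -> 'rV[R]_3).
Variables (SN : forall n : nat, R -> 'I_n.*2.+1 -> 'rV[R]_3).
Arguments SN n : clear implicits.
Arguments S0N n : clear implicits.
Hypothesis sol : forall n, lattice_solution (S0N n) (SN n).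

Lemma initial_energy : (forall n k, sphere2 (S0N n k)) ->
  (ereal_sup (range (fun n : nat => sobolev_norm 2^-1 (fourier (interp (S0N n))))) <
    +oo)%E ->
  exists E : R, forall n, energy (S0N n) <= E.
Proof.
move=> hs hb; set X := ereal_sup _ in hb.
have le n : (sobolev_norm 2^-1 (fourier (interp (S0N n))) <= X)%E.
  by apply: ereal_sup_ubound; exists n.
have X0 : (0 <= X)%E := le_trans (sobolev_norm_ge0 _ _) (le 0%N).
case EX : X X0 hb => [x| |] // x0 _; exists (x ^+ 2) => n.
have := le n; rewrite EX => /sobolev_norm_hbd; rewrite fourier_interp => h.
apply: le_trans (energy_le_hsum _) _; have := h n; congr (_ <= _).
by apply: eq_symsum => k hk; rewrite /tdft hk.
Qed.

Variable E : R.
Hypothesis hE : forall n, energy (S0N n) <= E.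

Let hs n t k : 0 <= t -> sphere2 (SN n t k).
Proof. exact: flow_sphere (sol n) t k. Qed.

Lemma energy_le n t : 0 <= t -> energy (SN n t) <= E.
Proof. by move=> t0; rewrite (flow_energy (sol n) t0). Qed.

Lemma E_ge0 : 0 <= E.
Proof.
apply: le_trans (hE 0%N); rewrite energyE; apply: symsum_ge0 => k.
by rewrite mulr_ge0 ?lam_ge0 ?cnormsq_ge0.
Qed.

Lemma hsum_dft_le n t : 0 <= t -> hsum 2^-1 (dft (SN n t)) n <= 1 + 2 * E.
Proof.
move=> t0; apply: le_trans (dft_hsum_le (fun j => hs j t0)) _.
by rewrite lerD2l ler_pM2l // energy_le.
Qed.

Lemma hbd_tdft n t : 0 <= t -> hbd 2^-1 (tdft (SN n t)) (1 + 2 * E).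
Proof. by move=> t0 m; apply: le_trans (hsum_tdft _ _ _) (hsum_dft_le n t0). Qed.

Lemma cnormsq_dft_le1 n t k : 0 <= t -> cnormsq (dft (SN n t) k) <= 1.
Proof.
move=> t0; rewrite -(dft_mass (fun j => hs (n := n) j t0) k).
have := @symsum_term R n (fun l => cnormsq (dft (SN n t) (k - l))) 0 (fun l =>
  cnormsq_ge0 _) isT.
by rewrite subr0.
Qed.

Lemma coord_sqrt_le1 (z : R[i]) : csq z <= 1 -> `|Re z| <= 1 /\ `|Im z| <= 1.
Proof.
case: z => x y; rewrite /csq /= => h.
have hx := sqr_ge0 x; have hy := sqr_ge0 y.
by split; rewrite -(@expr_le1 _ 2) // real_normK ?num_real //; lra.
Qed.

Lemma dft_coord_le1 n t k i : 0 <= t ->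
  `|Re (dft (SN n t) k 0 i)| <= 1 /\ `|Im (dft (SN n t) k 0 i)| <= 1.
Proof.
by move=> t0; apply: coord_sqrt_le1; exact: le_trans (sqr_coord_le _ i)
  (cnormsq_dft_le1 n k t0).
Qed.

Local Notation vel n t := (dft (velocity (SN n) t)).

Lemma vel_torque n t : vel n t = torque (SN n t) (@kap R n).
Proof. by []. Qed.

(** The antisymmetrised symbol is at most |m| / 2 by the Lipschitz bound on [lam], and both factors
    of the convolution have mass 1. This is the Lipschitz constant in time of the m-th coefficient,
    the same for all n. *)
Lemma vel_coord_le n t m i : 0 <= t ->
  `|Re (vel n t m 0 i)| <= `|m%:~R| /\ `|Im (vel n t m 0 i)| <= `|m%:~R|.
Proof.
move=> t0; rewrite vel_torque torque_symE; last exact: kap_even.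
set nu := (fun k : int => _).
have hnu k : `|nu k| <= `|m%:~R| / 2 :> R.
  rewrite /nu normrM ger0_norm ?invr_ge0 // mulrC ler_pM2r ?invr_gt0 //.
  exact: lam_sym_le.
set c := dft (SN n t).
have h k := cterm_amgm c m i (hnu k) (ltr01 : 0 < (1 : R)).
have mass : symsum n (fun k => `|m%:~R| / 2 / 2 * (1 * cnormsq (c (m - k)) + cnormsq (c
  k) / 1)) = `|m%:~R| / 2 :> R.
  rewrite symsumZ symsumD.
  have -> : symsum n (fun k => 1 * cnormsq (c (m - k))) = 1.
    by rewrite -[RHS](dft_mass (fun j => hs (n := n) j t0) m); apply: eq_symsum => k _;
      rewrite mul1r.
  have -> : symsum n (fun k => cnormsq (c k) / 1) = 1.
    rewrite -[RHS](dft_mass (fun j => hs (n := n) j t0) 0) -[LHS]symsumN; apply: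
      eq_symsum => k _.
    by rewrite divr1 sub0r.
  by field.
have fin : `|m%:~R| / 2 <= `|m%:~R| :> R.
  by rewrite ler_pdivrMr // ler_peMr // ler1n.
split; apply: le_trans fin; rewrite -mass symsum_mxE raddf_symsum.
  by apply: le_trans (ler_norm_symsum _ _) _; apply: ler_symsum => k _; have [] := h k.
by apply: le_trans (ler_norm_symsum _ _) _; apply: ler_symsum => k _; have [] := h k.
Qed.

Variable T : R.
Hypothesis T_gt0 : 0 < T.

Lemma convergent_subsequence : exists (sigma : nat -> nat) (c : R -> int -> cvec3),
  [/\ {homo sigma : i j / (i < j)%N},
    forall k i s t, `|Re (c t k 0 i) - Re (c s k 0 i)| <= `|k%:~R| * `|t - s| /\
                    `|Im (c t k 0 i) - Im (c s k 0 i)| <= `|k%:~R| * `|t - s| &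
    forall k i (e : R), 0 < e -> \forall j \near \oo, forall t, itime T t ->
      `|Re (dft (SN (sigma j) t) k 0 i) - Re (c t k 0 i)| <= e /\
      `|Im (dft (SN (sigma j) t) k 0 i) - Im (c t k 0 i)| <= e].
Proof.
(* [lipschitz_subsequence] concerns functions on the whole line, whereas the bounds hold for t >= 0;
   composing with the projection onto [0, T] preserves them. *)
pose clamp t := Num.max 0 (Num.min t T).
have cl0 t : 0 <= clamp t by rewrite le_max lexx.
have clT t : itime T t -> clamp t = t.
  by rewrite /itime /= in_itv /= => /andP[h1 h2]; rewrite /clamp min_l // max_r.
have clL s t : `|clamp t - clamp s| <= `|t - s|.
  rewrite /clamp; have aux (x y z : R) : `|Num.min x z - Num.min y z| <= `|x - y|.
    by case: (leP x z) => h1; case: (leP y z) => h2; rewrite ?subrr ?normr0 //;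
       rewrite !ler_norml; have := ler_norm (x - y); have := ler_norm (y - x); rewrite
         (distrC y x);
       move=> ? ?; apply/andP; split; lra.
  have aux' (x y : R) : `|Num.max 0 x - Num.max 0 y| <= `|x - y|.
    by case: (leP 0 x) => h1; case: (leP 0 y) => h2; rewrite ?subrr ?normr0 //;
       rewrite !ler_norml; have := ler_norm (x - y); have := ler_norm (y - x); rewrite
         (distrC y x);
       move=> ? ?; apply/andP; split; lra.
  exact: le_trans (aux' _ _) (aux _ _ _).
(* Frequency, coordinate and the choice of real or imaginary part are coded in one natural number;
   numbers that code nothing carry the zero function. *)
pose I := (int * 'I_3 * bool)%type.
pose val (b : bool) (z : R[i]) : R := if b then Re z else Im z.
pose f n m t : R := if unpickle m is Some (k, i, b) then val b (dft (SN n (clamp t)) k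
  0 i) else 0.
pose L m : R := if (unpickle m : option I) is Some (k, i, b) then `|k%:~R| else 0.
have hf n m t : `|f n m t| <= 1.
  rewrite /f; case: (unpickle m : option I) => [[[k i] b]|]; last by rewrite normr0.
  by have [h1 h2] := dft_coord_le1 n k i (cl0 t); case: b.
have hL n m s t : `|f n m t - f n m s| <= L m * `|t - s|.
  rewrite /f /L; case: (unpickle m : option I) => [[[k i] b]|]; last by rewrite subrr
    normr0 mul0r.
  have [d1 d2] := dft_hderiv (sol n) k i.
  have step : `|val b (dft (SN n (clamp t)) k 0 i) - val b (dft (SN n (clamp s)) k 0
    i)| <=
     `|k%:~R| * `|clamp t - clamp s|.
    case: b; [apply: (hderiv_lip d1)|apply: (hderiv_lip d2)] => // u u0.
      by have [] := vel_coord_le n k i u0.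
    by have [] := vel_coord_le n k i u0.
  by apply: le_trans step _; rewrite ler_wpM2l.
have [sigma [F [hsig FL FC]]] := lipschitz_subsequence (C := fun=> 1) T_gt0 hf hL.
pose ix k i b : nat := pickle ((k, i, b) : I).
pose c t k : cvec3 := \row_i (F (ix k i true) t +i* F (ix k i false) t).
exists sigma, c; split => //.
  move=> k i s t; rewrite !mxE /=.
  have := FL (ix k i true) s t; have := FL (ix k i false) s t.
  by rewrite /L /ix !pickleK.
move=> k i e e0.
have [J1 h1] := FC (ix k i true) e e0; have [J2 h2] := FC (ix k i false) e e0.
exists (maxn J1 J2) => // j; rewrite /= geq_max => /andP[j1 j2] t it.
have it' : 0 <= t <= T by move: it; rewrite /itime /= in_itv.
have := h1 j j1 t it'; have := h2 j j2 t it'.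
by rewrite /f /ix !pickleK clT // !mxE.
Qed.

End Flow.

Section Subsequence.
Variable R : realType.
Local Notation C := R[i].
Local Notation cvec3 := 'rV[R[i]]_3.
Variables (S0N : forall n : nat, 'I_n.*2.+1 -> 'rV[R]_3).
Variables (SN : forall n : nat, R -> 'I_n.*2.+1 -> 'rV[R]_3).
Arguments SN n : clear implicits.
Arguments S0N n : clear implicits.
Hypothesis sol : forall n, lattice_solution (S0N n) (SN n).
Variable E : R.
Hypothesis hE : forall n, energy (S0N n) <= E.
Variables (sigma : nat -> nat).
Hypothesis hsig : {homo sigma : i j / (i < j)%N}.
Local Notation D j t := (dft (SN (sigma j) t)).
Local Notation M := (1 + 2 * E).

Lemma sigma_ge K : \forall j \near \oo, (K <= sigma j)%N.
Proof.
have h j : (j <= sigma j)%N.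
  by elim: j => // j IH; apply: leq_ltn_trans IH _; exact: hsig.
by exists K => // j /= Kj; exact: leq_trans (h j).
Qed.

Section AtTime.
Variables (t : R) (c : int -> cvec3).
Hypothesis t0 : 0 <= t.
Hypothesis hc : forall k, vcvg (fun j => D j t k) (c k).

Let hs n k : sphere2 (SN n t k).
Proof. exact: (flow_sphere (sol n) _ t0). Qed.

Lemma ccvg_near_eq (z_ y_ : nat -> C) z : (\forall j \near \oo, z_ j = y_ j) ->
  ccvg z_ z -> ccvg y_ z.
Proof.
move=> e [h1 h2]; split.
  by apply: cvg_trans h1; apply: near_eq_cvg; move: e; apply: filterS => j ->.
by apply: cvg_trans h2; apply: near_eq_cvg; move: e; apply: filterS => j ->.
Qed.

Lemma tdft_cvg k : vcvg (fun j => tdft (SN (sigma j) t) k) (c k).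
Proof.
move=> i; apply: ccvg_near_eq (hc k i).
by move: (sigma_ge `|k|); apply: filterS => j hj; rewrite /tdft hj.
Qed.

Lemma hbd_c : hbd 2^-1 c M.
Proof. by apply: (hbd_lim tdft_cvg) => j; exact: hbd_tdft. Qed.

Lemma real_c : real_coefs c.
Proof.
move=> k i; apply: (ccvg_unique (hc (- k) i)).
have := ccvgJ (hc k i); congr (ccvg _ _); apply/funext => j; exact/esym/dft_real.
Qed.

Lemma lattice_conv_lim (nu_ : nat -> int -> R) nu B m :
  (forall j k, `|nu_ j k| <= B) -> (forall k, nu_ ^~ k @ \oo --> nu k) ->
  vcvg (fun j => symsum (sigma j) (cterm (nu_ j) (D j t) m)) (conv nu c m).
Proof.
move=> hB hnu.
have hm j : symsum (sigma j) (fun k => cnormsq (D j t (m - k))) <= M.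
  by rewrite (dft_mass (hs (n := sigma j))) lerDl mulr_ge0 // (E_ge0 hE).
by have [] := conv_lim sigma_ge hc hB hnu (fun j => hsum_dft_le sol hE (sigma j) t0) hm.
Qed.

(** The difference |k| - |m - k| is bounded by |m|, whereas |k| alone is not bounded in k: in this
    form the torque falls under the lemmas on [conv], which ask for a bounded symbol. *)
Definition limit_torque m : cvec3 := conv (fun k => 2^-1 * (`|k%:~R| - `|(m - k)%:~R|))
  c m.

Lemma velocity_cvg m : vcvg (fun j => dft (velocity (SN (sigma j)) t) m) (limit_torque m).
Proof.
have h := @lattice_conv_lim (fun j k => 2^-1 * (lam R (sigma j) k - lam R (sigma j) (m
  - k)))
  (fun k => 2^-1 * (`|k%:~R| - `|(m - k)%:~R|)) (2^-1 * `|m%:~R|) m.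
have {}h := h _ _; have -> : (fun j => dft (velocity (SN (sigma j)) t) m) =
    (fun j => symsum (sigma j) (cterm (fun k => 2^-1 * (lam R (sigma j) k - lam R
      (sigma j) (m - k))) (D j t) m)).
  by apply/funext => j; rewrite vel_torque torque_symE //; exact: kap_even.
apply: h => [j k|k].
  by rewrite normrM ger0_norm ?invr_ge0 // ler_pM2l ?invr_gt0 //; exact: lam_sym_le.
apply: cvgM; first exact: cvg_cst.
by apply: cvgB; apply: cvg_lam; exact: sigma_ge.
Qed.

Section Yosida.
Variable B : R.
Hypothesis B0 : 0 < B.
Local Notation nu := (fun k : int => yos B `|k%:~R : R|).

Lemma lattice_yosida n : exists ker : 'I_n.*2.+1 -> R,
  [/\ forall r, ker (- r) = ker r, forall r, 0 <= ker r &
   forall k, symb (chi R (n := n)) ker (zp n k) = yos B (lam R n k)].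
Proof.
have [ker [h1 h2 h3]] := yosida_kernel (@chi0 R n) (@chiD R n) (@chiC R n) (@chi_conj R
  n) (@chi_sum R n)
  (@kap_even R n) (@kap_ge0 R n) B0.
by exists ker; split => // k; rewrite /symb h3.
Qed.

Lemma yos_norm_le n k : `|yos B (lam R n k)| <= B.
Proof.
have [_ h] := yos_le B0 (lam_ge0 R n k).
by rewrite ger0_norm // yos_ge0 // lam_ge0.
Qed.

Lemma cvg_yos_lam k : yos B (lam R (sigma j) k) @[j --> \oo] --> nu k.
Proof. by apply: cvg_yos => //; apply: cvg_lam; exact: sigma_ge. Qed.

(** One and the same lattice torque is read through [torqueE] and through [torque_symE], so that
    both expansions acquire a limit; the nonnegative kernel supplies the bound by the energy. *)
Lemma yosida_torque_cvg : exists ker : forall j, 'I_(sigma j).*2.+1 -> R,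
  (forall j r, ker j (- r) = ker j r) /\
  (forall m, vcvg (fun j => torque (SN (sigma j) t) (ker j) m) (conv nu c m)) /\
  (forall m, vcvg (fun j => torque (SN (sigma j) t) (ker j) m)
     (conv (fun k => 2^-1 * (nu k - nu (m - k))) c m)) /\
  (forall j, hsum (- 2^-1) (torque (SN (sigma j) t) (ker j)) (sigma j) <= E).
Proof.
pose ker j := xget (fun=> 0) [set ker : 'I_(sigma j).*2.+1 -> R |
  [/\ forall r, ker (- r) = ker r, forall r, 0 <= ker r &
   forall k, symb (chi R (n := sigma j)) ker (zp (sigma j) k) = yos B (lam R (sigma j)
     k)]].
have hker j : [/\ forall r, ker j (- r) = ker j r, forall r, 0 <= ker j r &
   forall k, symb (chi R (n := sigma j)) (ker j) (zp (sigma j) k) = yos B (lam R (sigma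
     j) k)].
  exact: (@xgetPex _ (fun=> 0) _ (lattice_yosida (sigma j))).
exists ker; split; first by move=> j; have [] := hker j.
split.
  move=> m; have -> : (fun j => torque (SN (sigma j) t) (ker j) m) =
     (fun j => symsum (sigma j) (cterm (fun k => yos B (lam R (sigma j) k)) (D j t) m)).
    apply/funext => j; have [h1 _ h3] := hker j; rewrite torqueE //; apply: eq_symsum
      => k _.
    by rewrite /cterm h3.
  by apply: lattice_conv_lim => [j k|k]; [exact: yos_norm_le|exact: cvg_yos_lam].
split.
  move=> m; have -> : (fun j => torque (SN (sigma j) t) (ker j) m) =
     (fun j => symsum (sigma j) (cterm (fun k => 2^-1 * (yos B (lam R (sigma j) k) -
       yos B (lam R (sigma j) (m - k)))) (D j t) m)).
    apply/funext => j; have [h1 _ h3] := hker j; rewrite torque_symE //; apply: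
      eq_symsum => k _.
    by rewrite /cterm !h3.
  apply: (@lattice_conv_lim _ _ (2^-1 * `|m%:~R|)) => [j k|k].
    rewrite normrM ger0_norm ?invr_ge0 // ler_pM2l ?invr_gt0 //.
    by apply: le_trans (yos_lip B0 (lam_ge0 _ _ _) (lam_ge0 _ _ _)) _; exact: lam_sym_le.
  apply: cvgM; first exact: cvg_cst.
  by apply: cvgB; exact: cvg_yos_lam.
move=> j; have [h1 h2 h3] := hker j.
apply: le_trans (torque_hsum_le (hs (n := sigma j)) h1 h2 _) (energy_le sol hE (sigma
  j) t0).
by move=> k; rewrite h3; have [] := yos_le B0 (lam_ge0 R (sigma j) k).
Qed.

Lemma hbd_conv_yos : hbd (- 2^-1) (conv nu c) E.
Proof.
have [ker [_ [h1 [_ h2]]]] := yosida_torque_cvg => n.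
pose a j (k : int) : cvec3 := if (`|k| <= sigma j)%N then torque (SN (sigma j) t) (ker
  j) k else 0.
have ha k : vcvg (a ^~ k) (conv nu c k).
  move=> i; apply: ccvg_near_eq (h1 k i).
  by move: (sigma_ge `|k|); apply: filterS => j hj; rewrite /a hj.
by apply: (hbd_lim ha) => j m; apply: le_trans (h2 j); exact: hsum_trunc.
Qed.

(** The substitution k -> m - k, exact on the finite group, is carried to the limit by uniqueness of
    limits, without rearranging an infinite series. *)
Lemma conv_yos_sym m : conv nu c m = conv (fun k => 2^-1 * (nu k - nu (m - k))) c m.
Proof.
have [ker [_ [h1 [h2 _]]]] := yosida_torque_cvg.
apply/rowP => i; exact: ccvg_unique (h1 m i) (h2 m i).
Qed.

End Yosida.

(** The parameter is sent to infinity in antisymmetrised form: by [yos_lip] these symbols are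
    bounded by |m| / 2 for every p, whereas the plain ones have no bound uniform in both p and k. *)
Lemma cvg_conv_yos m :
  vcvg (fun p : nat => conv (fun k : int => yos p.+1%:R `|k%:~R : R|) c m)
    (limit_torque m).
Proof.
have -> : (fun p : nat => conv (fun k : int => yos p.+1%:R `|k%:~R : R|) c m) =
  (fun p : nat => conv (fun k : int => 2^-1 * (yos p.+1%:R `|k%:~R : R| - yos p.+1%:R
    `|(m - k)%:~R : R|)) c m).
  by apply/funext => p; rewrite conv_yos_sym.
have lip (k : int) : `| `|k%:~R| - `|(m - k)%:~R| | <= `|m%:~R| :> R.
  rewrite -[`|(m - k)%:~R|]normrN; apply: le_trans (ler_dist_dist _ _) _.
  by rewrite opprK -intrD addrC subrK.
apply: (@conv_cvg_nu R c _ _ (2^-1 * `|m%:~R|) M).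
- by rewrite mulr_ge0 // invr_ge0.
- move=> p k; rewrite normrM ger0_norm ?invr_ge0 // ler_pM2l ?invr_gt0 //.
  by apply: le_trans (yos_lip (ltr0Sn R p) (normr_ge0 _) (normr_ge0 _)) _; exact: lip.
- by move=> k; rewrite normrM ger0_norm ?invr_ge0 // ler_pM2l ?invr_gt0 //; exact: lip.
- move=> k; apply: cvgM; first exact: cvg_cst.
  by apply: cvgB; exact: cvg_yos_infty.
- exact: hbd_c.
- by move=> n; exact: (cnormsq_shift hbd_c).
Qed.

End AtTime.
End Subsequence.

(** * The limit map, its equation and the convergence towards it *)

Section LimitFunction.
Variable R : realType.
Local Notation mu := (@lebesgue_measure R).
Local Notation circ := (@circle R).
Local Notation C := R[i].
Local Notation cvec3 := 'rV[R[i]]_3.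
Variables (S0N : forall n : nat, 'I_n.*2.+1 -> 'rV[R]_3).
Variables (SN : forall n : nat, R -> 'I_n.*2.+1 -> 'rV[R]_3).
Arguments SN n : clear implicits.
Arguments S0N n : clear implicits.
Hypothesis sol : forall n, lattice_solution (S0N n) (SN n).
Variable E : R.
Hypothesis hE : forall n, energy (S0N n) <= E.
Variables (sigma : nat -> nat) (T : R) (c : R -> int -> cvec3).
Hypothesis hsig : {homo sigma : i j / (i < j)%N}.
Hypothesis T_gt0 : 0 < T.
Hypothesis hLip : forall k i s t,
  `|Re (c t k 0 i) - Re (c s k 0 i)| <= `|k%:~R| * `|t - s| /\
  `|Im (c t k 0 i) - Im (c s k 0 i)| <= `|k%:~R| * `|t - s|.
Hypothesis hconv : forall k i (e : R), 0 < e -> \forall j \near \oo, forall t, itime T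
  t ->
  `|Re (dft (SN (sigma j) t) k 0 i) - Re (c t k 0 i)| <= e /\
  `|Im (dft (SN (sigma j) t) k 0 i) - Im (c t k 0 i)| <= e.
Local Notation D j t := (dft (SN (sigma j) t)).
Local Notation M := (1 + 2 * E).

Lemma itime_ge0 t : itime T t -> 0 <= t.
Proof. by rewrite /itime /= in_itv /= => /andP[]. Qed.

Lemma c_cvg t k : itime T t -> vcvg (fun j => D j t k) (c t k).
Proof.
move=> it i; split; apply/cvgrPdist_le => e e0.
  by move: (hconv k i e0); apply: filterS => j /(_ t it) [h _]; rewrite distrC.
by move: (hconv k i e0); apply: filterS => j /(_ t it) [_ h]; rewrite distrC.
Qed.

Lemma lip_cont (f : R -> R) (L : R) : (forall s t, `|f t - f s| <= L * `|t - s|) ->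
  continuous f.
Proof.
move=> h t; apply/cvgrPdist_le => e e0.
have L0 : 0 < `|L| + 1 by rewrite ltr_wpDl.
apply/nbhs_ballP; exists (e / (`|L| + 1)); first by rewrite /= divr_gt0.
move=> s /= hs; apply: le_trans (h s t) _.
move: hs; rewrite ltr_pdivlMr // => /ltW; apply: le_trans.
rewrite mulrC ler_wpM2l // (le_trans (ler_norm L)) // lerDl //.
Qed.

Lemma c_cont k i : continuous (fun t => Re (c t k 0 i)) /\ continuous (fun t => Im (c t
  k 0 i)).
Proof.
split; apply: (@lip_cont _ `|k%:~R|) => s t; first by have [] := hLip k i s t.
by have [] := hLip k i s t.
Qed.

Definition slim (t x : R) (i : 'I_3) : R := lim_rtp (fun k => c t k 0 i) x.

(* The exceptional null set is absorbed by a constant value on the sphere. *)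
Definition Slim (t x : R) : 'rV[R]_3 := \row_(i < 3)
  if \sum_(l < 3) slim t x l ^+ 2 == 1 then slim t x i else (i == 0)%:R.

Lemma Slim_sphere t x : sphere2 (Slim t x).
Proof.
rewrite /sphere2; case: (eqVneq (\sum_(l < 3) slim t x l ^+ 2) 1) => h.
  by rewrite -[RHS]h; apply: eq_bigr => i _; rewrite mxE h eqxx.
have e i : Slim t x 0 i = (i == 0)%:R by rewrite mxE (negbTE h).
by rewrite sum3E !e /= expr1n !expr0n /= !addr0.
Qed.

Lemma rtp_periodic J a (x : R) : rtp J a (x + 2 * pi) = rtp J a x.
Proof. by rewrite /rtp expiD expi_2pi mulr1. Qed.

Lemma Slim_periodic t : periodic_vec (Slim t).
Proof.
move=> x; have e : slim t (x + 2 * pi) = slim t x.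
  apply/funext => i.
  have e' : (fun j => rtp (4 ^ j) (fun k => c t k 0 i) (x + 2 * pi)) =
     (fun j => rtp (4 ^ j) (fun k => c t k 0 i) x) by apply/funext => j; exact:
       rtp_periodic.
  exact: (congr1 (fun u : nat -> R => lim (u j @[j --> \oo])) e').
exact: (congr1 (fun f : 'I_3 -> R =>
  \row_(i < 3) if \sum_(l < 3) f l ^+ 2 == 1 then f i else (i == 0)%:R) e).
Qed.

(** Joint measurability in (t, x): the truncated series are measurable because each coefficient is
    continuous in time, and [measurable_lim] handles the pointwise limit together with its default
    value. *)
Lemma Slim_measurable i : measurable_fun [set: R * R] (fun p : R * R => Slim p.1 p.2 0 i).
Proof.
have mslim l : measurable_fun [set: R * R] (fun p : R * R => slim p.1 p.2 l).
  apply: measurable_lim => // j.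
  have -> : (fun p : R * R => rtp (4 ^ j) (fun k => c p.1 k 0 l) p.2) = (fun p : R * R =>
      \sum_(k <- sseq (4 ^ j)) (Re (c p.1 k 0 l) * ec k p.2 + Im (c p.1 k 0 l) * es k
        p.2)).
    by apply/funext => p; rewrite rtpE symsumE.
  apply: measurable_sum => k; have [c1 c2] := c_cont k l.
  apply: measurable_funD; apply: measurable_funM.
  - by apply: (measurableT_comp (continuous_measurable_fun c1)); exact: measurable_fst.
  - by apply: (measurableT_comp (continuous_measurable_fun (@ec_cont R k))); exact:
    measurable_snd.
  - by apply: (measurableT_comp (continuous_measurable_fun c2)); exact: measurable_fst.
  - by apply: (measurableT_comp (continuous_measurable_fun (@es_cont R k))); exact:
    measurable_snd.
have -> : (fun p : R * R => Slim p.1 p.2 0 i) = (fun p : R * R =>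
   if \sum_(l <- index_enum 'I_3) slim p.1 p.2 l ^+ 2 == 1 then slim p.1 p.2 i else (i
     == 0)%:R).
  by apply/funext => p; rewrite mxE.
apply: measurable_fun_if => //.
- apply: measurable_fun_eqr; last exact: measurable_cst.
  by apply: measurable_sum => l; exact: measurable_funX.
- exact: measurable_funTS.
Qed.

Lemma Slim_measurable_at t i : measurable_fun circ (fun x => Slim t x 0 i).
Proof.
have h : measurable_fun [set: R] (fun x : R => (t, x)).
  by apply: measurable_fun_pair; [exact: measurable_cst|exact: measurable_id].
apply: measurable_funTS.
exact: (measurableT_comp (Slim_measurable i) h).
Qed.

Lemma Slim_repr t i : itime T t -> repr (fun x => Slim t x 0 i) (fun k => c t k 0 i) M.
Proof.
move=> it; have t0 := itime_ge0 it; have hc k := c_cvg k it.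
have hb := hbd_c sol hE hsig t0 hc; have rc := real_c hc.
have r0 l : repr (fun x => slim t x l) (fun k => c t k 0 l) M.
  by apply: lim_rtp_repr => [k|]; [exact: rc|exact: tail_hbd].
have ae := sphere_ae (S := fun l x => slim t x l) (sigma_ge hsig)
  (fun j k => flow_sphere (sol (sigma j)) k t0) (fun j => energy_le sol hE (sigma j)
    t0) r0
  (fun j => hbd_tdft sol hE (sigma j) t0) (tdft_cvg hsig hc).
apply: (repr_ae _ _ (r0 i)); last exact: Slim_measurable_at.
by apply: ae_mono ae => x hx cx; rewrite mxE hx // eqxx.
Qed.

Lemma fourier_Slim t : itime T t -> fourier (Slim t) = c t.
Proof. by move=> it; apply: (coefs_fourier (M := M)) => i; exact: Slim_repr. Qed.

Lemma Slim_L2 t i : itime T t -> L2 (fun x => Slim t x 0 i).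
Proof. by move=> it; exact: repr_L2 (Slim_repr i it). Qed.

Lemma hbd_ct t : itime T t -> hbd 2^-1 (c t) M.
Proof. by move=> it; exact: (hbd_c sol hE hsig (itime_ge0 it) (fun k => c_cvg k it)). Qed.

Lemma Slim_sobolev t : itime T t -> sobolev_fun 2^-1 (Slim t).
Proof.
move=> it; split; first exact: Slim_periodic.
- by move=> i; exact: Slim_measurable_at.
- by move=> i; have [_ h] := Slim_L2 i it.
- by rewrite fourier_Slim //; exact: hbd_sobolev_norm_fin (hbd_ct it).
Qed.

(** Frequencies above K are controlled by the H^{1/2} bound, uniform in time, and the finitely many
    others by their Lipschitz dependence on time. *)
Lemma Slim_dist (t e : R) : itime T t -> 0 < e -> exists2 d : R, 0 < d &
  forall s i, itime T s -> `|t - s| < d -> dist2 (fun x => Slim s x 0 i) (fun x => Slim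
    t x 0 i) <= e.
Proof.
move=> it e0.
have M0 : 0 <= M := hbd_ge0 (hbd_ct it).
have p0 := twopi_gt0 R.
pose K := Num.bound (16 * (2 * pi * M) / e).
have hK : 4 * (2 * pi * M / K.+1%:R) + 4 * (2 * pi * M / K.+1%:R) <= e / 2.
  have -> : 4 * (2 * pi * M / K.+1%:R) + 4 * (2 * pi * M / K.+1%:R) = 8 * (2 * pi * M)
    / K.+1%:R by ring.
  rewrite ler_pdivrMr ?ltr0n //.
  have : 16 * (2 * pi * M) / e <= K.+1%:R.
    apply: (@le_trans _ _ K%:R); last by rewrite ler_nat.
    by apply/ltW/archi_boundP; rewrite divr_ge0 ?(ltW e0) // mulr_ge0 // mulr_ge0 // ltW.
  by rewrite ler_pdivrMr //; lra.
pose X : R := symsum K (fun k => 2 * k%:~R ^+ 2).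
have X0 : 0 <= X by apply: symsum_ge0 => k; rewrite mulr_ge0 ?sqr_ge0.
pose Y := 4 * (2 * pi) * X + 1.
have Y0 : 0 < Y by rewrite ltr_wpDl // mulr_ge0 // mulr_ge0 // ltW.
(* The bound by 1 gives |t - s|^2 <= |t - s|, which makes the low-frequency estimate linear in |t -
   s|. *)
exists (Num.min 1 (e / 2 / Y)); first by rewrite lt_min ltr01 !divr_gt0.
move=> s i is_; rewrite lt_min => /andP[h1 h2].
apply: le_trans (repr_dist K (Slim_repr i is_) (Slim_repr i it)) _.
have hX : symsum K (fun k => csq (c s k 0 i - c t k 0 i)) <= X * `|t - s|.
  rewrite mulr_symsuml; apply: ler_symsum => k _.
  have [u1 u2] := hLip k i s t.
  have E1 : csq (c s k 0 i - c t k 0 i) = `|Re (c t k 0 i) - Re (c s k 0 i)| ^+ 2 +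
    `|Im (c t k 0 i) - Im (c s k 0 i)| ^+ 2.
    by rewrite !real_normK ?num_real // /csq; case: (c s k 0 i) (c t k 0 i) => [a b]
      [a' b'] /=; ring.
  rewrite E1; have v1 : `|Re (c t k 0 i) - Re (c s k 0 i)| ^+ 2 <= (`|k%:~R| * `|t -
    s|) ^+ 2.
    by rewrite ler_sqr ?nnegrE // mulr_ge0.
  have v2 : `|Im (c t k 0 i) - Im (c s k 0 i)| ^+ 2 <= (`|k%:~R| * `|t - s|) ^+ 2.
    by rewrite ler_sqr ?nnegrE // mulr_ge0.
  apply: le_trans (lerD v1 v2) _; rewrite exprMn real_normK ?num_real //.
  have : `|t - s| ^+ 2 <= `|t - s| by rewrite expr2 ler_piMr // ltW.
  have := sqr_ge0 (k%:~R : R); have := normr_ge0 (t - s).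
  move: (`|t - s|) (k%:~R ^+ 2 : R) => y z; nra.
have hY : 4 * (2 * pi) * (X * `|t - s|) <= e / 2.
  apply: (@le_trans _ _ (Y * `|t - s|)).
    by rewrite mulrA ler_wpM2r // /Y lerDl.
  by move: h2; rewrite ltr_pdivlMr // mulrC => /ltW.
have p8 : 0 <= 4 * (2 * pi) :> R by rewrite mulr_ge0 // ltW.
have := ler_wpM2l p8 hX; have aux (a b u v e' : R) : a + b <= e' / 2 -> v <= e' / 2 ->
  u <= v -> a + b + u <= e' by lra.
exact: aux hK hY.
Qed.

Lemma Slim_L2_continuous : L2_continuous T Slim.
Proof.
move=> t it.
have mc := @circle_measurable R.
have Edist s : itime T s -> (\int[mu]_(x in circ) (\sum_(i < 3) (Slim s x 0 i - Slim t
  x 0 i) ^+ 2)%R%:E)%E =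
    (\sum_(i < 3) dist2 (fun x => Slim s x 0 i) (fun x => Slim t x 0 i))%:E.
  move=> is_; have L i := L2B (Slim_L2 i is_) (Slim_L2 i it).
  rewrite circ_intE; last first.
    by apply: (@circ_int_sum _ _ _ (fun i x => (Slim s x 0 i - Slim t x 0 i) ^+ 2)) =>
      i; have [] := L i.
  congr EFin; rewrite (@circ_int_of_sum _ _ _ (fun i x => (Slim s x 0 i - Slim t x 0 i)
    ^+ 2)).
    by apply: eq_bigr => i _; rewrite dist2E.
  by move=> i; have [] := L i.
pose Phi s := \sum_(i < 3) dist2 (fun x => Slim s x 0 i) (fun x => Slim t x 0 i).
have c1 : Phi s @[s --> within (itime T) (nbhs t)] --> (0 : R).
  apply/cvgrPdist_le => e e0; rewrite near_withinE.
  have e3 : 0 < e / 3 by rewrite divr_gt0.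
  have [d d0 hd] := Slim_dist it e3.
  apply/nbhs_ballP; exists d => // s; rewrite -ball_normE /= => hs is_.
  rewrite sub0r normrN ger0_norm; last by apply: sumr_ge0 => i _; exact: dist2_ge0.
  have h i := hd s i is_ hs; rewrite /Phi sum3E.
  have aux (x y z e' : R) : x <= e' / 3 -> y <= e' / 3 -> z <= e' / 3 -> x + y + z <=
    e' by lra.
  by apply: aux; exact: h.
have c2 : (Phi s)%:E @[s --> within (itime T) (nbhs t)] --> (0 : R)%:E.
  by apply: cvg_EFin; [exact: nearW|exact: c1].
apply: cvg_trans c2; apply: near_eq_cvg; rewrite near_withinE; apply: nearW => s is_.
exact/esym/Edist.
Qed.

Local Notation vel j t := (dft (velocity (SN (sigma j)) t)).
Local Notation g t := (limit_torque (c t)).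

Lemma vel_cvg t k : itime T t -> vcvg (fun j => vel j t k) (g t k).
Proof. by move=> it; exact: (velocity_cvg sol hE hsig (itime_ge0 it) (fun l => c_cvg l
  it)). Qed.

Lemma hcont_measurable (f : R -> R) : hcont f -> measurable_fun (itime T) f.
Proof.
move=> hf; apply: subspace_continuous_measurable_fun; first exact: (@itime_measurable R
  T).
exact: (hcont_within hf (lexx 0) T_gt0).
Qed.

Lemma dft_measurable n k i : measurable_fun (itime T) (fun t => Re (dft (SN n t) k 0
  i)) /\
  measurable_fun (itime T) (fun t => Im (dft (SN n t) k 0 i)).
Proof.
have [h1 h2] := dft_hderiv (sol n) k i.
by split; apply: hcont_measurable; [exact: hderiv_hcont h1|exact: hderiv_hcont h2].
Qed.

Lemma velocity_measurable n k i :
  measurable_fun (itime T) (fun t => Re (dft (velocity (SN n) t) k 0 i)) /\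
  measurable_fun (itime T) (fun t => Im (dft (velocity (SN n) t) k 0 i)).
Proof.
have [h1 h2] := dft_velocity_hcont (sol n) k i.
by split; exact: hcont_measurable.
Qed.

(** Coefficients of the interpolated velocity, cut at n for the same reason as in [tdft]. *)
Definition tvel n t (k : int) : cvec3 :=
  if (`|k| <= n)%N then dft (velocity (SN n) t) k else 0.

Lemma tvel_cvg t k : itime T t -> vcvg (fun j => tvel (sigma j) t k) (g t k).
Proof.
move=> it i; apply: ccvg_near_eq (vel_cvg k it i).
by move: (sigma_ge hsig `|k|); apply: filterS => j hj; rewrite /tvel hj.
Qed.

Lemma hbd_tvel n t : 0 <= t -> hbd (- 2^-1) (tvel n t) E.
Proof.
move=> t0 m; apply: le_trans (hsum_trunc _ _ _ _) _.
apply: le_trans (torque_hsum_le (fun j => flow_sphere (sol n) j t0) (@kap_even R n)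
  (@kap_ge0 R n) _) (energy_le sol hE n t0).
by move=> k.
Qed.

Lemma cintegral_real (a : R -> R) (z : R -> C) : cintegral (itime T) (fun t => (a t)%:C
  * z t) =
  (\int[mu]_(t in itime T) (a t * Re (z t))) +i* (\int[mu]_(t in itime T) (a t * Im (z
    t))).
Proof.
apply: complex_eq => /=; apply: eq_Rintegral => t _; case: (z t) => x y /=; ring.
Qed.

Lemma dft_ibp n eta k i : test_function T eta ->
  (\int[mu]_(t in itime T) (derive1 eta t * Re (dft (SN n t) k 0 i)) =
    - \int[mu]_(t in itime T) (eta t * Re (dft (velocity (SN n) t) k 0 i))) /\
  (\int[mu]_(t in itime T) (derive1 eta t * Im (dft (SN n t) k 0 i)) =
    - \int[mu]_(t in itime T) (eta t * Im (dft (velocity (SN n) t) k 0 i))).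
Proof.
move=> heta; have [d1 d2] := dft_hderiv (sol n) k i.
have [c1 c2] := dft_velocity_hcont (sol n) k i.
by split; [exact: test_function_ibp d1 c1|exact: test_function_ibp d2 c2].
Qed.

Lemma tdft_time_derivative n : time_derivative T (fun t => tdft (SN n t)) (tvel n).
Proof.
move=> eta heta k i; have [h1 h2] := dft_ibp n k i heta.
rewrite /tdft /tvel; case: (`|k| <= n)%N.
  have e1 := cintegral_real (derive1 eta) (fun t => dft (SN n t) k 0 i).
  have e2 := cintegral_real eta (fun t => dft (velocity (SN n) t) k 0 i).
  apply: (etrans e1); apply: (etrans _ (esym (congr1 (fun z => - z) e2))).
  by apply: complex_eq; [exact h1|exact h2].
have z (a : R -> R) : cintegral (itime T) (fun t => (a t)%:C * (0 : cvec3) 0 i) = 0.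
  rewrite (cintegral_real a (fun=> (0 : cvec3) 0 i)) mxE /=.
  have -> : (fun t => a t * 0) = fun=> 0 by apply/funext => t; rewrite mulr0.
  by rewrite Rintegral_cst ?mul0r //; exact: (@itime_measurable R T).
by rewrite (z (derive1 eta)) (z eta) oppr0.
Qed.

Lemma itime_int_cont (f : R -> R) : continuous f -> mu.-integrable (itime T) (EFin \o f).
Proof.
by move=> cf; apply: continuous_compact_integrable; [exact: segment_compact|exact:
  continuous_subspaceT].
Qed.

Lemma test_dct (a : R -> R) (f_ : nat -> R -> R) (f : R -> R) (B : R) : continuous a ->
  (forall j, measurable_fun (itime T) (f_ j)) -> (forall j t, itime T t -> `|f_ j t| <=
    B) ->
  (forall t, itime T t -> f_ j t @[j --> \oo] --> f t) ->
  \int[mu]_(t in itime T) (a t * f_ j t) @[j --> \oo] --> \int[mu]_(t in itime T) (a t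
    * f t).
Proof.
move=> ca mf hB hf.
have ma : measurable_fun (itime T) a by apply: measurable_funTS; exact:
  continuous_measurable_fun.
have mlim : measurable_fun (itime T) f := measurable_fun_cvg mf hf.
apply: (@time_dct R T _ _ (fun t => (B * `|a t|)%:E)).
- by move=> j; exact: measurable_funM.
- exact: measurable_funM.
- by apply: aeW => t it; apply: cvgM; [exact: cvg_cst|exact: hf].
- apply: itime_int_cont => t; apply: cvgM; first exact: cvg_cst.
  by apply: cvg_norm; exact: ca.
- apply: aeW => t j it; rewrite abse_EFin lee_fin normrM mulrC.
  by rewrite ler_wpM2r //; exact: hB.
Qed.

Lemma limit_time_derivative : time_derivative T (fun t => fourier (Slim t)) (fun t => g
  t).
Proof.
move=> eta heta k i; rewrite (cintegral_real (derive1 eta)) (cintegral_real eta).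
have [se _] := heta.
have ce : continuous eta := is_derive_continuous (smooth_is_derive se).
have ce' : continuous (derive1 eta) := is_derive_continuous (smooth_is_derive
  (smooth_derive1 se)).
(* [val] stands for the real or the imaginary part, so that one argument treats both: integration by
   parts on the lattice, then dominated convergence in time on each side. *)
have side (val : C -> R) :
   (forall n, measurable_fun (itime T) (fun t => val (dft (SN n t) k 0 i))) ->
   (forall n, measurable_fun (itime T) (fun t => val (dft (velocity (SN n) t) k 0 i))) ->
   (forall n t, 0 <= t -> `|val (dft (SN n t) k 0 i)| <= 1) ->
   (forall n t, 0 <= t -> `|val (dft (velocity (SN n) t) k 0 i)| <= `|k%:~R|) ->
   (forall t, itime T t -> val (D j t k 0 i) @[j --> \oo] --> val (c t k 0 i)) ->
   (forall t, itime T t -> val (vel j t k 0 i) @[j --> \oo] --> val (g t k 0 i)) ->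
   (forall n, \int[mu]_(t in itime T) (derive1 eta t * val (dft (SN n t) k 0 i)) =
    - \int[mu]_(t in itime T) (eta t * val (dft (velocity (SN n) t) k 0 i))) ->
   \int[mu]_(t in itime T) (derive1 eta t * val (fourier (Slim t) k 0 i)) =
   - \int[mu]_(t in itime T) (eta t * val (g t k 0 i)).
  move=> m1 m2 b1 b2 c1 c2 ibp.
  have -> : \int[mu]_(t in itime T) (derive1 eta t * val (fourier (Slim t) k 0 i)) =
     \int[mu]_(t in itime T) (derive1 eta t * val (c t k 0 i)).
    by apply: eq_Rintegral => t; rewrite inE => it; rewrite fourier_Slim.
  have l1 := test_dct ce' (fun j => m1 (sigma j)) (fun j t it => b1 (sigma j) t
    (itime_ge0 it)) c1.
  have l2 := test_dct ce (fun j => m2 (sigma j)) (fun j t it => b2 (sigma j) t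
    (itime_ge0 it)) c2.
  have e : (fun j => \int[mu]_(t in itime T) (derive1 eta t * val (D j t k 0 i))) =
     (fun j => - \int[mu]_(t in itime T) (eta t * val (vel j t k 0 i))).
    by apply/funext => j; exact: ibp.
  rewrite e in l1; apply: (cvg_unique _ l1) => //; exact: cvgN.
have s1 := side Re; have s2 := side Im.
apply: complex_eq => /=.
  apply: s1 => [n|n|n t t0|n t t0|t it|t it|n].
  - by have [] := dft_measurable n k i.
  - by have [] := velocity_measurable n k i.
  - by have [] := dft_coord_le1 sol n k i t0.
  - by have [] := vel_coord_le sol n k i t0.
  - by have [] := c_cvg k it i.
  - by have [] := vel_cvg k it i.
  - by have [] := dft_ibp n k i heta.
apply: s2 => [n|n|n t t0|n t t0|t it|t it|n].
- by have [] := dft_measurable n k i.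
- by have [] := velocity_measurable n k i.
- by have [] := dft_coord_le1 sol n k i t0.
- by have [] := vel_coord_le sol n k i t0.
- by have [] := c_cvg k it i.
- by have [] := vel_cvg k it i.
- by have [] := dft_ibp n k i heta.
Qed.

Lemma trunc_measurable_coefs N (f : R -> int -> cvec3) :
  (forall k i, measurable_fun (itime T) (fun t => Re (f t k 0 i)) /\
    measurable_fun (itime T) (fun t => Im (f t k 0 i))) ->
  measurable_coefs T (fun t k => if (`|k| <= N)%N then f t k else 0).
Proof.
move=> h k i /=; case: (`|k| <= N)%N; first exact: h.
by split; under eq_fun do rewrite mxE; exact: measurable_cst.
Qed.

Lemma trunc_real N (f : int -> cvec3) : real_coefs f ->
  real_coefs (fun k => if (`|k| <= N)%N then f k else 0).
Proof. by move=> h k i; rewrite abszN; case: ifP => _ //; rewrite !mxE rmorph0. Qed.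

Lemma tdft_weakstar s : s <= 2^-1 ->
  weakstar_Linfty s T (fun j t => fourier (interp (SN (sigma j) t))) (fun t => fourier
    (Slim t)).
Proof.
move=> hs; have -> : (fun j t => fourier (interp (SN (sigma j) t))) = (fun j t => tdft
  (SN (sigma j) t)).
  by apply/funext => j; apply/funext => t; exact: fourier_interp.
apply: (@weakstar_of R s T _ _ M).
- by move=> j; apply: trunc_measurable_coefs => k i; exact: dft_measurable.
- by move=> j t it; apply: trunc_real; exact: dft_real.
- by move=> j t it; apply: hbd_le hs _; exact: (hbd_tdft sol hE (sigma j) (itime_ge0 it)).
- by move=> t k it; rewrite fourier_Slim //; exact: (tdft_cvg hsig (fun l => c_cvg l it)).
Qed.

Lemma tvel_weakstar s : s <= - 2^-1 ->
  weakstar_Linfty s T (fun j t => tvel (sigma j) t) (fun t => g t).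
Proof.
move=> hs; apply: (@weakstar_of R s T _ _ E).
- by move=> j; apply: trunc_measurable_coefs => k i; exact: velocity_measurable.
- by move=> j t it; apply: trunc_real; exact: dft_real.
- by move=> j t it; apply: hbd_le hs _; exact: (hbd_tvel (sigma j) (itime_ge0 it)).
- by move=> t k it; exact: tvel_cvg.
Qed.

(** The limit torque is the time derivative, and its weak form holds at every time of [0, T] by
    [half_wave_value_pairing]. The value of the limit map at time 0 is itself the initial datum. *)
Lemma Slim_weak_solution : HWM_weak_solution T (Slim 0) Slim.
Proof.
have [_ ws _] := tdft_weakstar (lexx 2^-1).
have [_ wg _] := tvel_weakstar (lexx (- 2^-1)).
split.
- by move=> t _; split; [exact: Slim_periodic|exact: Slim_sphere].
- split; last exact: ws.
    by move=> i; apply: measurable_funTS; exact: Slim_measurable.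
  by apply: aeW => t it; exact: Slim_sobolev.
- exists (fun t => g t); split; [exact: wg|exact: limit_time_derivative|].
  move=> phi hphi; apply: aeW => t it; have t0 := itime_ge0 it.
  apply: (half_wave_value_pairing (c := c t) (M := M) (E := E)) => //.
  + by move=> i; exact: Slim_repr.
  + exact: Slim_sphere.
  + exact: hbd_ct.
  + by move=> p; exact: (hbd_conv_yos sol hE hsig t0 (fun l => c_cvg l it) (ltr0Sn R p)).
  + by move=> k; exact: (cvg_conv_yos sol hE hsig t0 (fun l => c_cvg l it)).
- exact: Slim_L2_continuous.
- exact: aeW.
Qed.

Lemma coordB (u v : cvec3) i : Re ((u - v) 0 i) = Re (u 0 i) - Re (v 0 i) /\
  Im ((u - v) 0 i) = Im (u 0 i) - Im (v 0 i).
Proof. by rewrite !mxE; case: (u 0 i) (v 0 i) => [x y] [x' y']. Qed.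

(** High frequencies are uniformly small because s < 1/2 against the common H^{1/2} bound
    ([hsum_split]); the finitely many low ones converge uniformly in time. *)
Lemma coefs_uniform s (e : R) : s < 2^-1 -> 0 < e -> \forall j \near \oo, forall t,
  itime T t ->
  hbd s (fun k => tdft (SN (sigma j) t) k - c t k) e.
Proof.
move=> hs e0; have M0 : 0 <= M by rewrite addr_ge0 // mulr_ge0 // (E_ge0 hE).
(* By [hbdB] the difference has squared H^{1/2} norm at most 2 (M + M); e1 times this is below e /
   2, and the added 1 keeps the denominator positive. *)
pose e1 := e / 2 / (2 * (M + M) + 1).
have MM : 0 < 2 * (M + M) + 1 by rewrite ltr_wpDl // mulr_ge0 // addr_ge0.
have e10 : 0 < e1 by rewrite !divr_gt0.
have [K hK] := hsum_split e10 hs.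
have e2 : 0 < e / 2 by rewrite divr_gt0.
have low := @symsum_near_le R (fun j t k => wt s k * cnormsq (tdft (SN (sigma j) t) k -
  c t k)) (itime T) K _ _ e2.
have {}low := low _; move: low => /(_ _) low.
have : \forall j \near \oo, forall t, itime T t -> hsum s (fun k => tdft (SN (sigma j)
  t) k - c t k) K <= e / 2.
  apply: low => k r r0.
  (* Three coordinates with two squares each give 6 d^2, and d <= 1 allows d^2 <= d. *)
  pose d := Num.min 1 (r / (6 * wt s k)).
  have w0 : 0 < 6 * wt s k by rewrite mulr_gt0 // wt_gt0.
  have d0 : 0 < d by rewrite lt_min ltr01 divr_gt0.
  have hall : \forall j \near \oo, forall i t, itime T t ->
      `|Re (D j t k 0 i) - Re (c t k 0 i)| <= d /\ `|Im (D j t k 0 i) - Im (c t k 0 i)|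
        <= d.
    by apply: filter_forall => i; exact: hconv.
  have hk0 := sigma_ge hsig `|k|%N.
  case: hall => N1 _ hN1; case: hk0 => N2 _ hN2.
  exists (maxn N1 N2) => // j; rewrite /= geq_max => /andP[j1 j2] t it.
  have hj := hN1 j j1; have hk := hN2 j j2; rewrite /= in hj hk.
  have d1 : d <= 1 by rewrite ge_min lexx.
  have d2 : 6 * wt s k * d <= r.
    have : d <= r / (6 * wt s k) by rewrite ge_min lexx orbT.
    by rewrite ler_pdivlMr // mulrC.
  have dd : d ^+ 2 <= d by rewrite expr2 ler_piMr // ltW.
  apply: le_trans d2; rewrite [6 * _]mulrC -mulrA ler_wpM2l ?wt_ge0 //.
  rewrite cnormsqE.
  have one i : Re ((tdft (SN (sigma j) t) k - c t k) 0 i) ^+ 2 + Im ((tdft (SN (sigma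
    j) t) k - c t k) 0 i) ^+ 2 <= 2 * d.
    have [u1 u2] := hj i t it; rewrite /tdft hk.
    have -> : Re ((D j t k - c t k) 0 i) ^+ 2 + Im ((D j t k - c t k) 0 i) ^+ 2 =
      `|Re (D j t k 0 i) - Re (c t k 0 i)| ^+ 2 + `|Im (D j t k 0 i) - Im (c t k 0 i)|
        ^+ 2.
      by have [-> ->] := coordB (D j t k) (c t k) i; rewrite !real_normK ?num_real.
    have v1 : `|Re (D j t k 0 i) - Re (c t k 0 i)| ^+ 2 <= d ^+ 2 by rewrite ler_sqr
      ?nnegrE // ltW.
    have v2 : `|Im (D j t k 0 i) - Im (c t k 0 i)| ^+ 2 <= d ^+ 2 by rewrite ler_sqr
      ?nnegrE // ltW.
    by apply: le_trans (lerD v1 v2) _; lra.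
  rewrite sum3E; have := one 0; have := one 1; have := one 2%:R.
  have aux (x y z d' : R) : x <= 2 * d' -> y <= 2 * d' -> z <= 2 * d' -> z + y + x <= 6
    * d' by lra.
  exact: aux.
apply: filterS => j hj t it n; have t0 := itime_ge0 it.
apply: le_trans (hK _ n) _.
have hb := hbdB (hbd_tdft sol hE (sigma j) t0) (hbd_ct it) n.
have h1 : e1 * (2 * (M + M)) <= e / 2.
  by rewrite /e1 mulrAC ler_pdivrMr // ler_pM2l // lerDl.
have h2 := ler_wpM2l (ltW e10) hb.
have := hj t it; have aux (x y z e' : R) : z <= e' / 2 -> y <= z -> x <= e' / 2 -> x +
  y <= e' by lra.
exact: aux h1 h2.
Qed.

Lemma strong_convergence s : s < 2^-1 ->
  L2_sobolev_norm s T (fun t => fourier (fun x => interp (SN (sigma j) t) x - Slim t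
    x)) @[j --> \oo] --> 0%E.
Proof.
move=> hs.
have fE j t : itime T t -> fourier (fun x => interp (SN (sigma j) t) x - Slim t x) =
    fun k => tdft (SN (sigma j) t) k - c t k.
  move=> it; rewrite fourierB; first by rewrite fourier_interp fourier_Slim.
    by move=> i; exact: repr_L2 (interp_repr i (hbd_tdft sol hE (sigma j) (itime_ge0
      it))).
  by move=> i; exact: Slim_L2.
have mc : measurable_coefs T c.
  by move=> k i; have [c1 c2] := c_cont k i; split; apply: measurable_funTS; exact:
    continuous_measurable_fun.
have md j : measurable_coefs T (fun t k => tdft (SN (sigma j) t) k - c t k).
  move=> k i; have [m1 m2] := mc k i.
  have [m3 m4] := trunc_measurable_coefs (sigma j) (fun k i => dft_measurable (sigma j)
    k i) k i.
  split.
    have -> : (fun t => Re ((tdft (SN (sigma j) t) k - c t k) 0 i)) =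
       (fun t => Re (tdft (SN (sigma j) t) k 0 i) - Re (c t k 0 i)).
      by apply/funext => t; have [-> _] := coordB (tdft (SN (sigma j) t) k) (c t k) i.
    exact: measurable_funB.
  have -> : (fun t => Im ((tdft (SN (sigma j) t) k - c t k) 0 i)) =
     (fun t => Im (tdft (SN (sigma j) t) k 0 i) - Im (c t k 0 i)).
    by apply/funext => t; have [_ ->] := coordB (tdft (SN (sigma j) t) k) (c t k) i.
  exact: measurable_funB.
have small (e : R) : 0 < e -> \forall j \near \oo,
    (L2_sobolev_norm s T (fun t => fourier (fun x => (interp (SN (sigma j) t) x - Slim
      t x)%R)) <= e%:E)%E.
  (* Squared norms below e^2 / T at every time integrate over [0, T] to at most e^2. *)
  move=> e0; have e1 : 0 < e ^+ 2 / T by rewrite divr_gt0 // exprn_gt0.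
  move: (coefs_uniform hs e1); apply: filterS => j hj.
  rewrite /L2_sobolev_norm.
  have -> : (e%:E = sqrte ((e ^+ 2)%:E))%E by rewrite /= sqrtr_sqr ger0_norm // ltW.
  rewrite lee_sqrt ?lee_fin ?sqr_ge0 //.
  have -> : (\int[mu]_(t in itime T) sobolev_norm s (fourier (fun x => (interp (SN
    (sigma j) t) x - Slim t x)%R)) ^+ 2 =
     \int[mu]_(t in itime T) sobolev_norm s (fun k => (tdft (SN (sigma j) t) k - c t
       k)%R) ^+ 2)%E.
    by apply: eq_integral => t; rewrite inE => it; rewrite fE.
  apply: (@le_trans _ _ (\int[mu]_(t in itime T) (cst (e ^+ 2 / T)%:E) t)%E).
    apply: ge0_le_integral => //.
    - exact: (@itime_measurable R T).
    - by move=> t _; exact: sqre_ge0.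
    - have mn := measurable_sobolev_norm s (md j).
      have -> : (fun t => sobolev_norm s (fun k => (tdft (SN (sigma j) t) k - c t k)%R)
        ^+ 2)%E =
        (fun t => sobolev_norm s (fun k => (tdft (SN (sigma j) t) k - c t k)%R) *
          sobolev_norm s (fun k => (tdft (SN (sigma j) t) k - c t k)%R))%E.
        by apply/funext => t; rewrite expe2.
      exact: emeasurable_funM.
    move=> t it; have h := sobolev_norm_le_sqrt (ltW e1) (hj t it).
    have n0 := sobolev_norm_ge0 s (fun k => tdft (SN (sigma j) t) k - c t k).
    rewrite expe2 /cst -[X in X%:E](sqr_sqrtr (ltW e1)) expr2 EFinM.
    exact: lee_pmul.
  rewrite integral_cst; last exact: (@itime_measurable R T).
  have muT : mu (itime T) = T%:E.
    by rewrite /itime lebesgue_measure_itv /= lte_fin T_gt0 oppr0 adde0.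
  by rewrite [X in (_ * X)%E]muT -EFinM divfK // gt_eqF.
have nn j : (0 <= L2_sobolev_norm s T (fun t => fourier (fun x => (interp (SN (sigma j)
  t) x - Slim t x)%R)))%E.
  exact: sqrte_ge0.
apply: cvg_EFin.
  move: (small 1 ltr01); apply: filterS => j hj.
  by rewrite ge0_fin_numE // (le_lt_trans hj) // ltry.
apply/cvgrPdist_le => e e0; move: (small e e0); apply: filterS => j hj /=.
rewrite sub0r normrN ger0_norm ?fine_ge0 //.
have fin : L2_sobolev_norm s T (fun t => fourier (fun x => (interp (SN (sigma j) t) x -
  Slim t x)%R)) \is a fin_num.
  by rewrite ge0_fin_numE // (le_lt_trans hj) // ltry.
by rewrite -lee_fin fineK.
Qed.

End LimitFunction.

Theorem theorem1 (R : realType)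
    (S0N : forall n : nat, 'I_n.*2.+1 -> 'rV[R]_3)
    (S0N_sphere : forall n k, sphere2 (S0N n k))
    (S0N_bounded :
       (ereal_sup (range (fun n : nat =>
          sobolev_norm 2^-1 (fourier (interp (S0N n))))) < +oo)%E)
    (SN : forall n : nat, R -> 'I_n.*2.+1 -> 'rV[R]_3)
    (SN_solution : forall n, lattice_solution (S0N n) (SN n))
    (T eps : R) (T_gt0 : 0 < T) (eps_gt0 : 0 < eps) :
  exists (sigma : nat -> nat) (S : R -> R -> 'rV[R]_3),
    let tildeS := fun (j : nat) (t : R) => interp (SN (sigma j) t) in
    let hatS := fun (j : nat) (t : R) => fourier (tildeS j t) in
    [/\ {homo sigma : i j / (i < j)%N},
        weakstar_Linfty 2^-1 T hatS (fun t => fourier (S t)) /\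
        weakstar_W1infty (- 2^-1 - eps) T hatS (fun t => fourier (S t)),
        exists S0 : R -> 'rV[R]_3,
          sobolev_sphere 2^-1 S0 /\ HWM_weak_solution T S0 S &
        L2_sobolev_norm (2^-1 - eps) T
          (fun t => fourier (fun x => tildeS j t x - S t x)) @[j --> \oo]
          --> 0%E].
Proof.
have [E hE] := initial_energy S0N_sphere S0N_bounded.
have [sigma [c [hsig hLip hconv]]] := convergent_subsequence SN_solution T_gt0.
exists sigma, (Slim c); split => //.
- split; first exact: (tdft_weakstar SN_solution hE hsig T_gt0 hLip hconv (lexx _)).
  (* The velocities are bounded in H^{-1/2} itself, and lowering the order by eps only weakens the
     bound. *)
  have lt : - 2^-1 - eps <= - 2^-1 by rewrite gerBl ltW.
  have lt' : - 2^-1 - eps <= 2^-1 by apply: le_trans lt _; rewrite -subr_ge0 opprK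
    addr_ge0 ?invr_ge0.
  exists (fun j => tvel SN (sigma j)), (fun t => limit_torque (c t)); split.
  + move=> j; have -> : (fun t => fourier (interp (SN (sigma j) t))) = (fun t => tdft
    (SN (sigma j) t)).
      by apply/funext => t; exact: fourier_interp.
    exact: (tdft_time_derivative SN_solution T_gt0).
  + exact: (limit_time_derivative SN_solution hE hsig T_gt0 hLip hconv).
  + exact: (tdft_weakstar SN_solution hE hsig T_gt0 hLip hconv lt').
  + exact: (tvel_weakstar SN_solution hE hsig T_gt0 hconv lt).
- have it0 : itime T 0 by rewrite /itime /= in_itv /= lexx ltW.
  exists (Slim c 0); split; last exact: (Slim_weak_solution SN_solution hE hsig T_gt0
    hLip hconv).
  split; first exact: (Slim_sobolev SN_solution hE hsig hLip hconv it0).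
  by apply: aeW => x; exact: Slim_sphere.
- apply: (strong_convergence SN_solution hE hsig T_gt0 hLip hconv).
  by rewrite gtrBl.
Qed.
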